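(* For each case below, there is at least one Gaussian vector $X$ with nonnegative correlations which satisfies it. (i) $X^h$ has a color representation for all sufficiently large $h$ and for all sufficiently small $h>0$. (ii) $X^h$ has no color representation for any sufficiently large $h$ nor for any sufficiently small $h>0$. (iii) $X^h$ has a color representation for all sufficiently large $h$ but not for any sufficiently small $h>0$. (iv) $X^h$ has a color representation for all sufficiently small $h>0$ but not for any sufficiently large $h$. In particular, the property of $X^h$ being a color process for a fixed $X$ is not monotone in $h$ (in either direction) for $h>0$.
   Context: A $\{0,1\}$-valued process $(Y_i)_{i\in S}$ has a color representation (equivalently, is a color process) if there are $p\in[0,1]$ and a random partition $\pi$ of $S$ such that $(Y_i)$ has the same law as the process obtained by sampling $\pi$ and then, independently of $\pi$ and independently for different partition elements, assigning all elements of a partition element the value $1$ with probability $p$ and the value $0$ with probability $1-p$. For a random vector $X=(X_i)$ and $h\in\mathbb{R}$, $X^h=(X^h_i)$ with $X^h_i=I(X_i>h)$. When nonzero thresholds are considered, Gaussian vectors are finite-dimensional with all marginals of mean zero and variance one, and are assumed nondegenerate: $P(X_i\neq X_j)=1$ for $i\ne j$. ''Not for any sufficiently large (small) $h$'' means that there is $h_0>0$ such that there is no color representation for any $h>h_0$ (for any $h\in(0,h_0)$). *)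

(* Defs.v *)
From HB Require Import structures.
From mathcomp Require Import all_boot all_order all_algebra.
From mathcomp Require Import all_classical all_reals all_analysis.

Set Implicit Arguments.
Unset Strict Implicit.
Unset Printing Implicit Defensive.

Import Order.TTheory GRing.Theory Num.Theory.
Import numFieldNormedType.Exports.

Local Open Scope ring_scope.
Local Open Scope classical_set_scope.

(* finset.partition and finset.pblock, not the homonyms on classical sets. *)
Definition random_partition_law (R : numDomainType) (S : finType)
    (q : {set {set S}} -> R) : Prop :=
  (forall pi, finset.partition pi (finset.setT : {set S}) -> 0 <= q pi) /\
  \sum_(pi | finset.partition pi (finset.setT : {set S})) q pi = 1.

(* Law on {0,1}^S obtained by sampling a partition pi from q and then, given
   pi, a colouring c of its blocks with independent Bernoulli(p) values; the
   block of i is pblock pi i.  Membership of c in pffun_on false (mem pi) predT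
   says that c is an arbitrary function on the blocks, extended by false. *)
Definition color_pmf (R : numDomainType) (S : finType) (p : R)
    (q : {set {set S}} -> R) (y : {ffun S -> bool}) : R :=
  \sum_(pi | finset.partition pi (finset.setT : {set S}))
    q pi *
    \sum_(c : {ffun {set S} -> bool}
          | (c \in pffun_on false (mem pi) predT)
            && [forall i, c (finset.pblock pi i) == y i])
      \prod_(B in pi) bernoulli_pmf p (c B).

Definition color_process (R : realType) (d : measure_display)
    (T : measurableType d) (P : probability T R) (S : finType)
    (Y : S -> T -> bool) : Prop :=
  exists (p : R) (q : {set {set S}} -> R),
    [/\ 0 <= p <= 1, random_partition_law q &
      forall y : {ffun S -> bool},
        P [set w | forall i, Y i w = y i] = (color_pmf p q y)%:E].

(* normal_prob m 0 is the uniform law on [0, 1], so the degenerate Gaussian law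
   has to be treated separately. *)
Definition gaussian_law (R : realType) (m s : R) (A : set R) : \bar R :=
  if s == 0 then \d_m A else normal_prob m s A.

Definition jointly_gaussian (R : realType) (d : measure_display)
    (T : measurableType d) (P : probability T R) (n : nat)
    (X : 'I_n -> {RV P >-> R}) : Prop :=
  forall a : 'I_n -> R, exists m s : R, forall A : set R, measurable A ->
    P ((fun w => \sum_(i < n) a i * X i w) @^-1` A) = gaussian_law m s A.

Record gaussianVector (R : realType) := GaussianVector {
  gv_dim : nat;
  gv_dim_gt0 : (0 < gv_dim)%N;
  gv_disp : measure_display;
  gv_space : measurableType gv_disp;
  gv_prob : probability gv_space R;
  gv_coord :> 'I_gv_dim -> {RV gv_prob >-> R};
  gv_gaussian : jointly_gaussian gv_coord;
  gv_mean : forall i, ('E_gv_prob[gv_coord i] = 0)%E;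
  gv_variance : forall i, ('V_gv_prob[gv_coord i] = 1)%E;
  gv_nondegenerate : forall i j, i != j ->
    gv_prob [set w | gv_coord i w <> gv_coord j w] = 1%:E
}.

Definition correlation (R : realType) (d : measure_display)
    (T : measurableType d) (P : probability T R) (X Y : {RV P >-> R}) : R :=
  fine (covariance P X Y) /
    (Num.sqrt (fine 'V_P[X]%E) * Num.sqrt (fine 'V_P[Y]%E)).

Definition nonneg_correlations (R : realType) (X : gaussianVector R) : Prop :=
  forall i j, 0 <= correlation (X i) (X j).

Definition threshold (R : realType) (X : gaussianVector R) (h : R) :
    'I_(gv_dim X) -> gv_space X -> bool :=
  fun i w => h < X i w.

Definition threshold_color (R : realType) (X : gaussianVector R) (h : R) :
    Prop :=
  color_process (gv_prob X) (threshold (X := X) h).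

Definition for_large (R : realType) (Q : R -> Prop) : Prop :=
  exists2 h0 : R, 0 < h0 & forall h, h0 < h -> Q h.

Definition for_small (R : realType) (Q : R -> Prop) : Prop :=
  exists2 h0 : R, 0 < h0 & forall h, 0 < h < h0 -> Q h.

(* Main.v *)
(** Every Gaussian vector used here consists of unit linear forms of a standard
    Gaussian vector in dimension at most three.

    For large h the joint exceedances of two coordinates are negligible, and for
    small h the exceedance probability p is close to 1/2; in both regimes a color
    representation of a three-point process, or of a four-point process with the
    symmetry of the square, exists as soon as a few linear inequalities between
    pattern probabilities hold, since the weights of the partitions can be solved
    for.  Conversely a color process on three points satisfies
    P(010) p <= P(101) (1 - p) when p <= 1/2, and a color process with a null
    pattern has P(0...0) >= (1 - p)^(n-1).

    (i) is a single variable.  For (ii), if X_1 is a multiple of X_0 + X_2 the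
    pattern 101 is impossible while 010 is not.  For (iii), X_1 is moved slightly
    out of the plane of X_0 and X_2: for large h boxes show that the patterns with
    two exceedances dominate p^2, while for small h the difference P(010) - P(101)
    is of order (1 - 2p) times a planar angle that exceeds 2 P(101).  For (iv), the
    four vectors form a thin square around an axis: the pattern where one diagonal
    exceeds and the other does not is empty, which is incompatible with
    P(0000) <= 1 - 4p + o(p) for large h, whereas for small h a mixture of
    partitions compatible with that empty pattern works. *)

From HB Require Import structures.
From mathcomp Require Import all_boot all_order all_algebra.
From mathcomp Require Import all_classical all_reals all_analysis.
From mathcomp Require Import measurable_realfun ring lra.
Require Import Defs.

Set Implicit Arguments.
Unset Strict Implicit.
Unset Printing Implicit Defensive.

Import Order.TTheory GRing.Theory Num.Theory.
Import numFieldNormedType.Exports.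

Local Open Scope classical_set_scope.
Local Open Scope ring_scope.

(** * Rotation invariance of the standard Gaussian measure *)

(** Everything Gaussian rests on the density and on invariance under rotations of two coordinates:
    laws of linear forms follow by turning a vector onto an axis, and the estimates use
    one-dimensional substitutions, factorizing boxes, sectors and cones, so that no orthant
    probability is computed. The obstacle at small h is that the decisive inequalities become
    equalities at h = 0. Each estimate is therefore kept proportional to 1 - 2p, so that this factor
    cancels and a comparison without it remains. It is won by a linear term against a quadratic one.
    In (iii), with X_1 = c' g + b' z_2, the angle is linear and P(101) quadratic in b'; but too
    small a b' makes 101 too rare for large h, and b' = 12/37 meets both requirements. In (iv) the
    deficit P(1000) - P(1110) is at most quadratic in the width d of the square, because the axis
    has coefficient c = 1 - O(d^2), whereas the cells that compensate it have mass at least linear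
    in d; hence d is fixed first, below constants independent of h. *)

Definition image_measure d d' (T1 : measurableType d) (T2 : measurableType d')
    (R : realFieldType) (m : {measure set T1 -> \bar R}) (f : T1 -> T2)
    (mf : measurable_fun setT f) : {measure set T2 -> \bar R} :=
  measure_function_pushforward__canonical__measure_function_Measure m mf.

Section affine_substitution.
Context {R : realType}.
Local Notation mu := (@lebesgue_measure R).
Variables (k m : R).

Let aff (x : measurableTypeR R) : measurableTypeR R := k * x + m.

Let maff : measurable_fun setT aff.
Proof. by apply: measurable_funD => //; exact: measurable_funM. Qed.

(** Lebesgue measure is determined by its values on half-open intervals; the sign of [k] decides
    which end of the preimage is closed. *)
Lemma lebesgue_measure_affine (A : set R) : k != 0 -> measurable A ->
  mu A = (`|k|%:E * mu (aff @^-1` A))%E.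
Proof.
move=> k0 mA.
pose nu := mscale (NngNum (normr_ge0 k)) (image_measure mu maff).
rewrite -[RHS]/(nu A).
apply: (@lebesgue_measure_unique _ (mscale (NngNum (normr_ge0 k)) (image_measure mu maff) : {measure set _ -> \bar R})) => // _ [[a b] _ <-].
rewrite [RHS](_ : _ = `|k|%:E * mu (aff @^-1` `]a, b]))%E; last by [].
rewrite /aff.
have [k_gt0|] := ltP 0 k.
  rewrite [X in (_ * _ X)%E](_ : _ = `](a - m) / k, (b - m) / k]%classic); last first.
    by apply/seteqP; split=> x /=; rewrite !in_itv/= ltr_pdivrMr// ler_pdivlMr//
      (mulrC x) ltrBlDr lerBrDr.
  rewrite !lebesgue_measure_itv/= !lte_fin ltr_pM2r ?invr_gt0// ltrD2r.
  case: ifPn => _; last by rewrite mule0.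
  rewrite gtr0_norm// -!EFinD -EFinM; congr EFin.
  by rewrite -mulrBl mulrCA divff// mulr1 opprD addrACA opprK addNr addr0.
rewrite le_eqVlt (negbTE k0)/= => k_lt0.
rewrite [X in (_ * _ X)%E](_ : _ = `[(b - m) / k, (a - m) / k[%classic); last first.
  by apply/seteqP; split=> x /=; rewrite !in_itv/= ltr_ndivlMr// ler_ndivrMr//
    (mulrC x) ltrBlDr lerBrDr// andbC.
rewrite !lebesgue_measure_itv/= !lte_fin ltr_nM2r ?invr_lt0// ltrD2r.
case: ifPn => _; last by rewrite mule0.
rewrite ltr0_norm// -!EFinD -EFinM; congr EFin.
rewrite -mulrBl mulrCA mulNr divff// mulrN1 opprB.
by rewrite opprD addrACA opprK addNr addr0.
Qed.

Lemma ge0_integral_affine (f : R -> \bar R) : k != 0 ->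
  measurable_fun setT f -> (forall x, 0 <= f x)%E ->
  (\int[mu]_x f x = \int[mu]_x (`|k|%:E * f (k * x + m)%R))%E.
Proof.
move=> k0 mf f0.
pose nu := mscale (NngNum (normr_ge0 k)) (image_measure mu maff).
have -> : (\int[mu]_x f x = \int[nu]_x f x)%E.
  apply: eq_measure_integral => A mA _.
  exact: lebesgue_measure_affine.
rewrite ge0_integral_mscale//= (ge0_integral_pushforward maff)//.
by rewrite ge0_integralZl//; exact: measurableT_comp.
Qed.

End affine_substitution.

Section rotation_lebesgue.
Context {R : realType}.
Local Notation mu := (@lebesgue_measure R).
Local Notation T := (measurableTypeR R).

Definition rot (a b : R) (z : T * T) : T * T :=
  (a * z.1 + b * z.2, - b * z.1 + a * z.2).

Lemma measurable_rot a b : measurable_fun setT (rot a b).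
Proof.
apply/measurable_fun_pairP; split => /=;
  by apply: measurable_funD; apply: measurable_funM.
Qed.

(** The rotation is split into two substitutions of one variable each: [y] is replaced by the first
    rotated coordinate at fixed [x], the integrals are exchanged, and then [x] is replaced by the
    second rotated coordinate. The factors [|b^-1|] and [|b|] cancel. *)
Lemma ge0_integral_rot (a b : R) (f : T * T -> \bar R) : a ^+ 2 + b ^+ 2 = 1 ->
  measurable_fun setT f -> (forall z, 0 <= f z)%E ->
  (\int[mu]_x \int[mu]_y f (rot a b (x, y)) = \int[mu]_x \int[mu]_y f (x, y))%E.
Proof.
move=> ab1 mf f0.
(* For [b = 0] the substitutions would divide by zero; then [a] is 1 or -1 and the coordinates
   change at most their signs. *)
have [b0|b0] := eqVneq b 0.
  have aa : a * a = 1 by rewrite -expr2 -ab1 b0 expr0n/= addr0.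
  have a0 : a != 0 by apply/eqP => a0; move: aa; rewrite a0 mul0r => /eqP; rewrite eq_sym oner_eq0.
  have na : `|a| = 1.
    by apply/eqP; rewrite -sqrp_eq1// -normrX ger0_norm ?sqr_ge0// expr2 aa.
  rewrite [RHS](@ge0_integral_affine _ a 0) //; first last.
  - by move=> x; apply: integral_ge0.
  - apply: (@measurable_fun_fubini_tonelli_F _ _ _ _ _ mu f) => //.
  apply: eq_integral => x _; rewrite na mul1e.
  rewrite [RHS](@ge0_integral_affine _ a 0) //; last first.
    by apply: measurableT_comp => //; exact: measurable_pair1.
  by apply: eq_integral => y _; rewrite na mul1e /rot/= b0 oppr0 !mul0r add0r !addr0.
have mpair1 x : measurable_fun setT (fun y : T => f (x, y)).
  by apply: measurableT_comp => //; exact: measurable_pair1.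
(* With [u = a x + b y] fixed, the second rotated coordinate is [(a u - x) / b], because
   [a^2 + b^2 = 1]. *)
pose g (z : T * T) : \bar R := (`|b^-1|%:E * f (z.1, (a * z.1 - z.2) / b)%R)%E.
have mg : measurable_fun setT g.
  apply: measurable_funeM; apply: measurableT_comp => //.
  apply: measurable_fun_pair => //=.
  apply: (@measurable_funM _ _ _ _ _ (cst b^-1)) => //; apply: measurable_funB => //.
  exact: measurable_funM.
have g0 z : (0 <= g z)%E by apply: mule_ge0.
transitivity (\int[mu]_x \int[mu]_u g (u, x))%E.
  apply: eq_integral => x _.
  rewrite (@ge0_integral_affine _ b^-1 (- a * x / b)) ?invr_neq0//; last first.
    by apply: measurableT_comp => //; apply: measurableT_comp;
       [exact: measurable_rot|exact: measurable_pair1].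
  apply: eq_integral => u _; rewrite /g /rot/=; congr (_ * f (_, _))%E.
    by field.
  rewrite -[in RHS](mul1r x) -[in RHS]ab1; field => //.
rewrite -(fubini_tonelli (m1 := mu) (m2 := mu) g mg g0).
apply: eq_integral => u _.
rewrite [LHS](@ge0_integral_affine _ (- b) (a * u)) ?oppr_eq0//; last first.
  by apply: (measurableT_comp mg); exact: measurable_pair1.
apply: eq_integral => v _; rewrite /g/= muleA -EFinM normrN -normrM divff// normr1.
rewrite mul1e; congr (f (_, _)); field => //.
Qed.

End rotation_lebesgue.

HB.lock Definition gauss (R : realType) : probability (measurableTypeR R) R :=
  normal_prob 0 1.

HB.lock Definition phi (R : realType) (x : R) : R := normal_pdf 0 1 x.

Section gauss_measure.
Context {R : realType}.
Local Notation mu := (@lebesgue_measure R).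
Local Notation T := (measurableTypeR R).
Local Notation gauss := (gauss R).
Local Notation phi := (@phi R).

Lemma phi_ge0 x : 0 <= phi x. Proof. by rewrite unlock; exact: normal_pdf_ge0. Qed.

Lemma measurable_phi : measurable_fun setT phi.
Proof. by rewrite unlock; exact: measurable_normal_pdf. Qed.

Lemma phi_expR x : phi x = normal_peak 1 * expR (- (x ^+ 2 / 2)).
Proof.
rewrite unlock normal_pdfE ?oner_eq0// /normal_fun subr0 expr1n.
by congr (_ * expR _); rewrite mulNr.
Qed.

Lemma phi_gt0 x : 0 < phi x.
Proof. by rewrite phi_expR mulr_gt0 ?expR_gt0// normal_peak_gt0// oner_eq0. Qed.

Lemma phi_even x : phi (- x) = phi x.
Proof. by rewrite !phi_expR sqrrN. Qed.

Lemma phi0 : phi 0 = normal_peak 1.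
Proof. by rewrite phi_expR expr0n/= mul0r oppr0 expR0 mulr1. Qed.

Lemma phiE x : phi x = phi 0 * expR (- (x ^+ 2 / 2)).
Proof. by rewrite phi0 phi_expR. Qed.

Lemma gaussE (A : set T) : gauss A = (\int[mu]_(x in A) (phi x)%:E)%E.
Proof. by rewrite phi.unlock gauss.unlock. Qed.

Lemma gauss_indicE (A : set T) : measurable A ->
  gauss A = (\int[mu]_x (\1_A x * phi x)%:E)%E.
Proof.
move=> mA; rewrite gaussE integral_mkcond; apply: eq_integral => x _.
by rewrite patchE indicE; case: ifPn => _; rewrite ?mul1r ?mul0r.
Qed.

(** The Radon-Nikodym derivative and [phi] have the same integral over every measurable set, so they
    agree almost everywhere. *)
Lemma ge0_integral_gauss (f : T -> \bar R) :
  measurable_fun setT f -> (forall x, 0 <= f x)%E ->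
  (\int[gauss]_x f x = \int[mu]_x (f x * (phi x)%:E))%E.
Proof.
move=> mf f0.
have dom : gauss `<< mu by rewrite gauss.unlock; exact: normal_prob_dominates.
pose RN := Radon_Nikodym_SigmaFinite.f gauss mu.
have -> : (\int[gauss]_x f x = \int[mu]_x (f x * RN x))%E.
  exact/esym/(Radon_Nikodym_SigmaFinite.change_of_variables dom).
have mRN : measurable_fun setT RN.
  exact: (measurable_int mu (Radon_Nikodym_SigmaFinite.f_integrable dom)).
have mphi : measurable_fun setT (fun x => (phi x)%:E).
  by apply/measurable_EFinP; exact: measurable_phi.
apply: ae_eq_integral => //; try exact: emeasurable_funM.
have : ae_eq mu setT RN (EFin \o phi).
  apply: integral_ae_eq => //.
    exact: Radon_Nikodym_SigmaFinite.f_integrable.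
  by move=> A _ mA; rewrite -Radon_Nikodym_SigmaFinite.f_integral//; exact: gaussE.
by apply: filterS => x /= /[apply] ->.
Qed.

End gauss_measure.

HB.lock Definition gauss2 (R : realType) :
    probability (measurableTypeR R * measurableTypeR R)%type R :=
  (gauss R \x gauss R)%E.

Section gauss2.
Context {R : realType}.
Local Notation mu := (@lebesgue_measure R).
Local Notation T := (measurableTypeR R).
Local Notation gauss := (gauss R).
Local Notation gauss2 := (gauss2 R).
Local Notation phi := (@phi R).

Lemma gauss2_xsection (C : set (T * T)) :
  gauss2 C = (\int[gauss]_x gauss (xsection C x))%E.
Proof. by rewrite gauss2.unlock. Qed.

Lemma gauss2E (C : set (T * T)) : measurable C ->
  gauss2 C = (\int[mu]_x \int[mu]_y (\1_C (x, y) * (phi x * phi y))%:E)%E.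
Proof.
move=> mC.
have mI : measurable_fun setT (fun z : T * T => (\1_C z * phi z.2)%:E).
  apply/measurable_EFinP; apply: measurable_funM => //.
  by apply: measurableT_comp => //; exact: measurable_phi.
have I0 (z : T * T) : (0 <= (\1_C z * phi z.2)%:E)%E.
  by rewrite lee_fin mulr_ge0 ?phi_ge0.
have sec x : gauss (xsection C x) = (\int[mu]_y (\1_C (x, y) * phi y)%:E)%E.
  rewrite gauss_indicE; last exact: measurable_xsection.
  by apply: eq_integral => y _; rewrite !indicE mem_xsection.
rewrite gauss2_xsection.
under eq_integral do rewrite sec.
rewrite ge0_integral_gauss; first last.
- by move=> x; apply: integral_ge0 => y _; exact: (I0 (x, y)).
- exact: (@measurable_fun_fubini_tonelli_F _ _ _ _ _ mu _ mI I0).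
apply: eq_integral => x _; rewrite -ge0_integralZr//; last 2 first.
- by apply: (measurableT_comp mI); exact: measurable_pair1.
- by rewrite lee_fin phi_ge0.
by apply: eq_integral => y _; rewrite -EFinM -mulrA (mulrC (phi y)).
Qed.

Lemma phi_rot a b x y : a ^+ 2 + b ^+ 2 = 1 ->
  phi (rot a b (x, y)).1 * phi (rot a b (x, y)).2 = phi x * phi y.
Proof.
move=> ab1; have phiM u v : phi u * phi v = phi 0 ^+ 2 * expR (- ((u ^+ 2 + v ^+ 2) / 2)).
  by rewrite (phiE u) (phiE v) mulrACA -expRD mulrDl opprD.
have E : (a * x + b * y) ^+ 2 + (- b * x + a * y) ^+ 2 = x ^+ 2 + y ^+ 2.
  by rewrite -[RHS]mul1r -ab1; ring.
by apply: (etrans (phiM _ _)); apply: (etrans _ (esym (phiM _ _))); rewrite E.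
Qed.

Lemma gauss2_rot a b (C : set (T * T)) : a ^+ 2 + b ^+ 2 = 1 ->
  measurable C -> gauss2 (rot a b @^-1` C) = gauss2 C.
Proof.
move=> ab1 mC.
have mC' : measurable (rot a b @^-1` C).
  by rewrite -[X in measurable X]setTI; apply: measurable_rot.
rewrite [LHS](gauss2E mC') [RHS](gauss2E mC).
pose f (z : T * T) := (\1_C z * (phi z.1 * phi z.2))%:E.
have mf : measurable_fun setT f.
  apply/measurable_EFinP; apply: measurable_funM => //.
  by apply: measurable_funM; apply: measurableT_comp => //; exact: measurable_phi.
have f0 z : (0 <= f z)%E by rewrite lee_fin !mulr_ge0 ?phi_ge0.
apply: etrans (ge0_integral_rot ab1 mf f0).
apply: eq_integral => x _; apply: eq_integral => y _.
by rewrite /f (phi_rot x y ab1).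
Qed.

End gauss2.

HB.lock Definition gauss3 (R : realType) : probability
    (measurableTypeR R * measurableTypeR R * measurableTypeR R)%type R :=
  (gauss2 R \x gauss R)%E.

Section gauss3.
Context {R : realType}.
Local Notation T := (measurableTypeR R).
Local Notation gauss := (gauss R).
Local Notation gauss2 := (gauss2 R).
Local Notation gauss3 := (gauss3 R).

Definition rot12 (a b : R) (w : T * T * T) : T * T * T := (rot a b w.1, w.2).

Definition rot23 (a b : R) (w : T * T * T) : T * T * T :=
  let yz := rot a b (w.1.2, w.2) in ((w.1.1, yz.1), yz.2).

Lemma measurable_rot12 a b : measurable_fun setT (rot12 a b).
Proof.
apply: measurable_fun_pair => //=.
by apply: measurableT_comp => //; exact: measurable_rot.
Qed.

Lemma measurable_rot23 a b : measurable_fun setT (rot23 a b).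
Proof.
have m : measurable_fun setT (fun w : T * T * T => rot a b (w.1.2, w.2)).
  apply: measurableT_comp; first exact: measurable_rot.
  by apply: measurable_fun_pair => //; exact: measurableT_comp.
apply: measurable_fun_pair; last exact: measurableT_comp.
by apply: measurable_fun_pair; exact: measurableT_comp.
Qed.

Lemma gauss3_xsection (C : set (T * T * T)) :
  gauss3 C = (\int[gauss2]_z gauss (xsection C z))%E.
Proof. by rewrite gauss3.unlock. Qed.

Lemma gauss3_ysection (C : set (T * T * T)) : measurable C ->
  gauss3 C = (\int[gauss]_z gauss2 (ysection C z))%E.
Proof.
move=> mC; have mI : measurable_fun setT (fun w => (\1_C w : R)%:E).
  exact/measurable_EFinP.
have I0 w : (0 <= (\1_C w : R)%:E)%E by rewrite lee_fin.
rewrite -[C in LHS]setIT -integral_indic// gauss3.unlock.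
rewrite (fubini_tonelli2 _ mI I0); apply: eq_integral => z _.
have mS : measurable (ysection C z) by exact: measurable_ysection.
rewrite -[ysection C z in RHS]setIT -integral_indic//.
by apply: eq_integral => x _; rewrite !indicE mem_ysection.
Qed.

(** The triple product is nested to the left, so fixing its first coordinate is neither an x-section
    nor a y-section; rotations of the last two coordinates call for it. *)
Definition tail_section (C : set (T * T * T)) (x : T) : set (T * T) :=
  [set yz | C ((x, yz.1), yz.2)].

Lemma measurable_tail_section C x : measurable C -> measurable (tail_section C x).
Proof.
move=> mC.
have m : measurable_fun setT (fun yz : T * T => ((x, yz.1), yz.2)).
  apply: measurable_fun_pair; last exact: measurable_snd.
  apply: measurable_fun_pair; [exact: measurable_cst|exact: measurable_fst].
by rewrite -[X in measurable X]setTI; exact: (m measurableT C mC).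
Qed.

Lemma gauss3_tail_section (C : set (T * T * T)) : measurable C ->
  gauss3 C = (\int[gauss]_x gauss2 (tail_section C x))%E.
Proof.
move=> mC; rewrite gauss3_xsection gauss2.unlock.
have mS : measurable_fun setT (fun z => gauss (xsection C z)).
  exact: measurable_fun_xsection.
rewrite (fubini_tonelli1 (m1 := gauss) (m2 := gauss) _ mS)//.
Qed.

Lemma gauss3_rot12 a b C : a ^+ 2 + b ^+ 2 = 1 -> measurable C ->
  gauss3 (rot12 a b @^-1` C) = gauss3 C.
Proof.
move=> ab1 mC.
have mC' : measurable (rot12 a b @^-1` C).
  by rewrite -[X in measurable X]setTI; apply: measurable_rot12.
rewrite (gauss3_ysection mC') (gauss3_ysection mC).
apply: eq_integral => z _.
rewrite -[RHS](gauss2_rot ab1); last exact: measurable_ysection.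
by congr (gauss2 _); apply/seteqP; split=> x; rewrite /ysection/= !inE.
Qed.

Lemma gauss3_rot23 a b C : a ^+ 2 + b ^+ 2 = 1 -> measurable C ->
  gauss3 (rot23 a b @^-1` C) = gauss3 C.
Proof.
move=> ab1 mC.
have mC' : measurable (rot23 a b @^-1` C).
  by rewrite -[X in measurable X]setTI; apply: measurable_rot23.
rewrite (gauss3_tail_section mC') (gauss3_tail_section mC).
apply: eq_integral => x _.
rewrite -[RHS](gauss2_rot ab1); last exact: measurable_tail_section.
congr (gauss2 _); apply/seteqP; split=> -[y z] //=.
Qed.

Lemma gauss3_box (A B C : set T) :
  measurable A -> measurable B -> measurable C ->
  gauss3 [set w | [/\ A w.1.1, B w.1.2 & C w.2]] =
  (gauss A * gauss B * gauss C)%E.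
Proof.
move=> mA mB mC.
have <- : gauss2 (A `*` B) = (gauss A * gauss B)%E.
  by rewrite gauss2.unlock; exact: product_measure1E.
have <- : gauss3 (A `*` B `*` C) = (gauss2 (A `*` B) * gauss C)%E.
  by rewrite gauss3.unlock; apply: product_measure1E => //; exact: measurableX.
congr (gauss3 _).
by apply/seteqP; split=> -[[x y] z] /=; [case|case; case].
Qed.

Lemma gauss3_setX (A : set T) (C : set (T * T)) :
  measurable A -> measurable C ->
  gauss3 [set w | A w.1.1 /\ C (w.1.2, w.2)] = (gauss A * gauss2 C)%E.
Proof.
move=> mA mC.
have mAC : measurable [set w : T * T * T | A w.1.1 /\ C (w.1.2, w.2)].
  have m1 : measurable_fun setT (fun w : T * T * T => w.1.1).
    exact: measurableT_comp.
  have m2 : measurable_fun setT (fun w : T * T * T => (w.1.2, w.2)).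
    by apply: measurable_fun_pair => //; exact: measurableT_comp.
  rewrite -[X in measurable X]setTI.
  exact: (measurable_fun_pair m1 m2 measurableT (measurableX mA mC)).
rewrite (gauss3_tail_section mAC).
transitivity (\int[gauss]_x ((\1_A x)%:E * gauss2 C))%E.
  apply: eq_integral => x _; rewrite indicE.
  case: (boolP (x \in A)) => [|] xA; rewrite ?mul1e ?mul0e.
    congr (gauss2 _); apply/seteqP; split=> [[y z] [_ Cyz]//|[y z] Cyz].
    by split => //; rewrite inE in xA.
  rewrite (_ : tail_section _ _ = set0) ?measure0//.
  by apply/seteqP; split=> -[y z]// [Ax _]; move: xA; rewrite notin_setE.
rewrite ge0_integralZr//=; last exact/measurable_EFinP.
by rewrite integral_indic ?setIT.
Qed.

Definition dot (u w : T * T * T) : T :=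
  u.1.1 * w.1.1 + u.1.2 * w.1.2 + u.2 * w.2.

Lemma measurable_dot u : measurable_fun setT (dot u).
Proof.
apply: measurable_funD; first apply: measurable_funD;
  apply: measurable_funM => //; exact: measurableT_comp.
Qed.

Definition norm3 (u : T * T * T) : R := Num.sqrt (dot u u).

End gauss3.

(** * Gaussian moments and linear forms *)

Section gaussian_integrals.
Context {R : realType}.
Local Notation mu := (@lebesgue_measure R).

Lemma is_derive_expR_sqr (K x : R) :
  is_derive x 1 (fun y : R => expR (- (K * y ^+ 2 / 2))) (- (K * x) * expR (- (K * x ^+ 2 / 2))).
Proof.
have d : is_derive x 1 (fun y : R => - (K * y ^+ 2 / 2)) (- (K * x)).
  by apply: is_derive_eq; rewrite /GRing.scale/=; field.
have := @is_derive1_comp R expR (fun y : R => - (K * y ^+ 2 / 2)) x _ _ (is_derive_expR _) d.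
by rewrite mulrC.
Qed.

Lemma integral_expR_sqr (K t : R) : 0 < K -> 0 <= t ->
  (\int[mu]_(x in `[t, +oo[) (x * expR (- (K * x ^+ 2 / 2)))%:E =
   (K^-1 * expR (- (K * t ^+ 2 / 2)))%:E)%E.
Proof.
move=> K0 t0.
pose F (x : R) : R := - K^-1 * expR (- (K * x ^+ 2 / 2)).
have dF (x : R) : is_derive x 1 F (x * expR (- (K * x ^+ 2 / 2))).
  have := is_deriveZ (- K^-1) (is_derive_expR_sqr K x).
  rewrite /GRing.scale/= => d; apply: is_derive_eq d _.
  by rewrite mulrA mulrNN mulrA mulVf ?mul1r// gt_eqF.
have cE : continuous (fun x : R => expR (- (K * x ^+ 2 / 2))).
  move=> x; apply/differentiable_continuous/derivable1_diffP.
  by case: (is_derive_expR_sqr K x).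
have cf : continuous (fun x : R => x * expR (- (K * x ^+ 2 / 2))).
  by move=> x; apply: cvgM; [exact: cvg_id|exact: cE].
have cF : continuous F.
  move=> x; apply/differentiable_continuous/derivable1_diffP.
  by case: (dF x).
rewrite (@ge0_continuous_FTC2y _ _ F _ 0).
- by rewrite /F sub0e -EFinN mulNr opprK.
- by move=> x tx; rewrite mulr_ge0 ?expR_ge0// (le_trans t0).
- exact: continuous_subspaceT.
- rewrite /F -(mulr0 (- K^-1)); apply: cvgM; first exact: cvg_cst.
  rewrite (_ : (fun x => expR _) = (fun x => expR (- x)) \o (fun x : R => x ^+ 2 * (K / 2))).
    2: by apply/funext => x /=; congr (expR (- _)); field.
  apply: cvg_comp.
    apply/gt0_cvgMly; first by rewrite divr_gt0.
    exact: cvgr_expr2.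
  exact: cvgr_expR.
- by move=> x _; case: (dF x).
- exact: cvg_at_right_filter (cF t).
- by move=> x _; rewrite derive1E; case: (dF x).
Qed.

End gaussian_integrals.

Section measurable_comparison.
Context d (T : measurableType d) {R : realType}.

Lemma measurable_le_set (f g : T -> R) :
  measurable_fun setT f -> measurable_fun setT g ->
  measurable [set x | f x <= g x].
Proof.
move=> mf mg; rewrite (_ : [set _ | _] = (f \- g) @^-1` `]-oo, 0]); last first.
  by apply/seteqP; split=> x /=; rewrite in_itv/= subr_le0.
by rewrite -[X in measurable X]setTI; apply: measurable_funB.
Qed.

Lemma measurable_lt_set (f g : T -> R) :
  measurable_fun setT f -> measurable_fun setT g ->
  measurable [set x | f x < g x].
Proof.
move=> mf mg; rewrite (_ : [set _ | _] = (f \- g) @^-1` `]-oo, 0[); last first.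
  by apply/seteqP; split=> x /=; rewrite in_itv/= subr_lt0.
by rewrite -[X in measurable X]setTI; apply: measurable_funB.
Qed.

End measurable_comparison.

Section gauss_moments.
Context {R : realType}.
Local Notation mu := (@lebesgue_measure R).
Local Notation T := (measurableTypeR R).
Local Notation gauss := (gauss R).
Local Notation phi := (@phi R).

Lemma continuous_phi : continuous phi.
Proof. by rewrite phi.unlock; apply: continuous_normal_pdf; rewrite oner_eq0. Qed.

Lemma integral_id_phi (t : R) : 0 <= t ->
  (\int[mu]_(x in `[t, +oo[) (x * phi x)%:E = (phi t)%:E)%E.
Proof.
move=> t0.
transitivity ((phi 0)%:E * \int[mu]_(x in `[t, +oo[) (x * expR (- (1 * x ^+ 2 / 2)))%:E)%E.
  rewrite -ge0_integralZl//=.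
  - apply: eq_integral => x _; rewrite (phiE x) mul1r -EFinM; congr EFin; ring.
  - apply/measurable_EFinP/measurable_funTS; apply: measurable_funM => //.
    apply: continuous_measurable_fun => x.
    apply/differentiable_continuous/derivable1_diffP.
    by case: (is_derive_expR_sqr 1 x).
  - by move=> x; rewrite in_itv/= andbT => tx; rewrite lee_fin mulr_ge0 ?expR_ge0 ?(le_trans t0).
  - by rewrite lee_fin phi_ge0.
by rewrite integral_expR_sqr// invr1 !mul1r -EFinM -phiE.
Qed.

Lemma integral_phi_ge0 : (\int[mu]_(x in `[0%R, +oo[) (phi x)%:E = (2^-1)%:E)%E.
Proof.
have := @ge0_symfun_integralT R phi phi_ge0 continuous_phi.
rewrite -set_itvcy => /(_ (fun x => esym (phi_even x))).
have -> : (\int[mu]_x (phi x)%:E = 1)%E.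
  by rewrite -gaussE probability_setT.
have : (0 <= \int[mu]_(x in `[0%R, +oo[) (phi x)%:E)%E.
  by apply: integral_ge0 => x _; rewrite lee_fin phi_ge0.
case: (integral _ _ _) => [r| |]//.
  by rewrite -EFinM => _ [] r2; congr EFin; rewrite -[RHS]mulr1 [X in _ * X]r2; field.
by rewrite mulry gtr0_sg// mul1e.
Qed.

(** One factor [x] is written as the length of [[0, x]]. After exchanging the integrals, [x * phi x]
    integrates to [phi t] from [t] on, which leaves the mass of the half-line. *)
Lemma half_second_moment :
  (\int[mu]_(x in `[0%R, +oo[) (x ^+ 2 * phi x)%:E = (2^-1)%:E)%E.
Proof.
pose D := [set z : T * T | 0 <= z.1] `&` [set z : T * T | z.1 <= z.2].
have mD : measurable D.
  by apply: measurableI; apply: measurable_le_set => //; exact: measurable_cst.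
pose H (z : T * T) : \bar R := (\1_D z * (z.2 * phi z.2))%:E.
have mH : measurable_fun setT H.
  apply/measurable_EFinP; apply: measurable_funM => //.
  apply: measurable_funM => //.
  by apply: measurableT_comp => //; exact: measurable_phi.
have H0 z : (0 <= H z)%E.
  rewrite lee_fin indicE; case: (boolP (z \in D)); rewrite ?mul0r ?mul1r// inE.
  by move=> [/= z1 z12]; rewrite mulr_ge0 ?phi_ge0// (le_trans z1).
transitivity (\int[mu]_x \int[mu]_t H (t, x))%E.
  rewrite integral_mkcond; apply: eq_integral => x _; rewrite patchE.
  transitivity (\int[mu]_t ((\1_(`[0%R, x]%classic) t)%:E * (x * phi x)%:E))%E; last first.
    apply: eq_integral => t _; rewrite /H -EFinM; congr (_ * _)%:E.
    rewrite !indicE; congr (nat_of_bool _)%:R.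
    by apply/idP/idP; rewrite !inE/= in_itv/=; [move=> /andP|move=> [-> ->]].
  have [x0|x0] := leP 0 x; last first.
    rewrite ifF; last by apply/negP; rewrite inE/= in_itv/= andbT leNgt x0.
    rewrite set_itv_ge ?bnd_simp -?ltNge//.
    by under eq_integral do rewrite indic0 mul0e; rewrite integral0.
  rewrite ifT ?inE/= ?in_itv/= ?x0//.
  rewrite ge0_integralZr//; last 2 first.
  - exact/measurable_EFinP.
  - by rewrite lee_fin mulr_ge0 ?phi_ge0.
  have mux : mu `[0%R, x]%classic = x%:E.
    rewrite lebesgue_measure_itv/= lte_fin oppr0 adde0.
    by case: ltP => // x0'; congr EFin; apply/eqP; rewrite eq_le x0 x0'.
  by rewrite integral_indic// setIT [X in (X * _)%E]mux -EFinM mulrA.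
rewrite -(fubini_tonelli (m1 := mu) (m2 := mu) H mH H0).
rewrite -integral_phi_ge0 [RHS]integral_mkcond; apply: eq_integral => t _.
rewrite patchE; case: ifPn => [|].
  rewrite inE/= in_itv/= andbT => t0; rewrite -integral_id_phi//.
  rewrite [RHS]integral_mkcond; apply: eq_integral => x _; rewrite patchE /H indicE.
  have [tx|tx] := leP t x.
    by rewrite mem_set// mem_set ?mul1r//= in_itv/= tx.
  rewrite memNset; last by move=> -[] _ /=; rewrite leNgt tx.
  by rewrite memNset ?mul0r//= in_itv/= andbT leNgt tx.
move=> t0; apply: integral0_eq => x _.
rewrite /H indicE memNset ?mul0r// => -[/= t0' _].
by move: t0; rewrite notin_setE/= in_itv/= t0'.
Qed.

Lemma second_moment : (\int[gauss]_x (x ^+ 2)%:E = 1)%E.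
Proof.
rewrite ge0_integral_gauss; last 2 first.
- by apply/measurable_EFinP.
- by move=> x; rewrite lee_fin sqr_ge0.
under eq_integral do rewrite -EFinM.
rewrite (ge0_symfun_integralT (f := fun x : R => x ^+ 2 * phi x)).
- by rewrite -set_itvcy half_second_moment -EFinM; congr EFin; field.
- by move=> x; rewrite mulr_ge0 ?sqr_ge0 ?phi_ge0.
- move=> x; apply: cvgM; [exact: exprn_continuous|exact: continuous_phi].
- by move=> x /=; rewrite sqrrN phi_even.
Qed.

End gauss_moments.

Section dot_law.
Context {R : realType}.
Local Notation mu := (@lebesgue_measure R).
Local Notation T := (measurableTypeR R).
Local Notation V := (T * T * T)%type.
Local Notation gauss := (gauss R).
Local Notation gauss3 := (gauss3 R).
Local Notation phi := (@phi R).

Lemma gauss_scaled (n : R) (A : set T) : n != 0 -> measurable A ->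
  gauss [set x | A (n * x)] = normal_prob 0 n A.
Proof.
move=> n0 mA.
have mn : measurable_fun setT (fun x : T => n * x : T) by exact: measurable_funM.
have mA' : measurable [set x | A (n * x)].
  by rewrite -[X in measurable X]setTI; exact: (mn measurableT A mA).
rewrite gauss_indicE// /normal_prob [RHS]integral_mkcond.
rewrite [RHS](@ge0_integral_affine R n 0)//; last 2 first.
- rewrite -measurable_restrictT//.
  by apply/measurable_EFinP/measurable_funTS; exact: measurable_normal_pdf.
- by move=> x; apply: erestrict_ge0 => y _; rewrite lee_fin normal_pdf_ge0.
apply: eq_integral => x _; rewrite addr0 patchE.
have -> : \1_[set x0 | A (n * x0)] x = (n * x \in A)%:R :> R.
  by rewrite indicE; congr (nat_of_bool _)%:R; apply/idP/idP; rewrite !inE.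
case: (n * x \in A); last by rewrite mul0r mule0.
rewrite mul1r -EFinM; congr EFin.
rewrite phi_expR normal_pdfE// /normal_fun subr0 mulrA; congr (_ * expR _).
  have pk : normal_peak n = `|n|^-1 * normal_peak 1.
    rewrite /normal_peak -invfM expr1n mul1r -sqrtr_sqr -sqrtrM ?sqr_ge0//.
    by rewrite -mulrnAr.
  by rewrite pk mulrA divff ?mul1r// normr_eq0.
by rewrite exprMn -mulr_natr; field.
Qed.

(** With this rotation the form [x * w1 + y * w2] is [Num.sqrt (x ^+ 2 + y ^+ 2)] times the second
    rotated coordinate; at the origin any rotation will do. *)
Lemma rotation_exists (x y : R) : exists a b : R,
  [/\ a ^+ 2 + b ^+ 2 = 1, x = - Num.sqrt (x ^+ 2 + y ^+ 2) * b &
      y = Num.sqrt (x ^+ 2 + y ^+ 2) * a].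
Proof.
have xy0 : 0 <= x ^+ 2 + y ^+ 2 by rewrite addr_ge0 ?sqr_ge0.
set s := Num.sqrt _; have ss : s ^+ 2 = x ^+ 2 + y ^+ 2 by rewrite sqr_sqrtr.
have [s0|s0] := eqVneq s 0.
  exists 1, 0; rewrite expr1n expr0n/= addr0 mulr0 mulr1 s0.
  move: ss; rewrite s0 expr0n/= => /esym/eqP.
  by rewrite paddr_eq0 ?sqr_ge0// !sqrf_eq0 => /andP[/eqP-> /eqP->].
exists (y / s), (- x / s); split; last 2 first.
- by field.
- by field.
by rewrite !expr_div_n sqrrN -mulrDl addrC -ss divff// expf_neq0.
Qed.

(** Two rotations, of the first two and then of the last two coordinates, turn [u] onto the last
    axis, where the form is [norm3 u] times a standard Gaussian variable. *)
Lemma dot_law (u : V) (A : set T) : measurable A ->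
  gauss3 (dot u @^-1` A) = gauss [set x | A (norm3 u * x)].
Proof.
move=> mA; case: u => -[x y] z.
have mdA (v : V) : measurable (dot v @^-1` A).
  rewrite -[X in measurable X]setTI. have := measurable_dot v.
  by move=> H; exact: (H measurableT A mA).
have [a [b [ab1 xE yE]]] := rotation_exists x y.
set s := Num.sqrt _ in xE yE.
have -> : dot (x, y, z) @^-1` A = rot12 a b @^-1` (dot (0, s, z) @^-1` A).
  apply/seteqP; split=> -[[w1 w2] w3]; rewrite /preimage /dot /rot12 /rot/=;
    by congr (A _); rewrite {1}xE {1}yE; ring.
rewrite (gauss3_rot12 ab1)//.
have [a' [b' [ab1' sE zE]]] := rotation_exists s z.
set t := Num.sqrt _ in sE zE.
have -> : dot (0, s, z) @^-1` A = rot23 a' b' @^-1` (dot (0, 0, t) @^-1` A).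
  apply/seteqP; split=> -[[w1 w2] w3]; rewrite /preimage /dot /rot23 /rot/=;
    by congr (A _); rewrite {1}sE {1}zE; ring.
rewrite (gauss3_rot23 ab1')//.
have -> : norm3 (x, y, z) = t.
  rewrite /norm3 /dot/= /t /s sqr_sqrtr ?addr_ge0 ?sqr_ge0//.
have mn : measurable_fun setT (fun x : T => t * x : T) by exact: measurable_funM.
have mA' : measurable [set x | A (t * x)].
  by rewrite -[X in measurable X]setTI; exact: (mn measurableT A mA).
transitivity (gauss3 [set w | [/\ [set: T] w.1.1, [set: T] w.1.2 & A (t * w.2)]]).
  congr (gauss3 _); apply/seteqP; split=> -[[w1 w2] w3]; rewrite /preimage /dot/= !mul0r !add0r.
    by split.
  by case.
by rewrite (gauss3_box measurableT measurableT mA') probability_setT !mul1e.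
Qed.

Lemma dot_gaussian (u : V) (A : set T) : measurable A ->
  gauss3 (dot u @^-1` A) = gaussian_law 0 (norm3 u) A.
Proof.
move=> mA; rewrite dot_law// /gaussian_law; case: eqVneq => [->|n0].
  rewrite diracE; have [A0|A0] := pselect (A 0).
    rewrite mem_set// (_ : [set x | _] = setT) ?probability_setT//.
    by apply/seteqP; split=> x //= _; rewrite mul0r.
  rewrite memNset// (_ : [set x | _] = set0) ?measure0//.
  by apply/seteqP; split=> x //=; rewrite mul0r.
by rewrite gauss_scaled.
Qed.

Lemma ge0_integral_dot (u : V) (f : T -> \bar R) : measurable_fun setT f ->
  (forall x, 0 <= f x)%E ->
  (\int[gauss3]_w f (dot u w) = \int[gauss]_x f (norm3 u * x)%R)%E.
Proof.
move=> mf f0.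
have mn : measurable_fun setT (fun x : T => norm3 u * x : T) by exact: measurable_funM.
rewrite -(@ge0_integral_pushforward _ _ _ _ _ _ (measurable_dot u) gauss3 setT f)//.
rewrite -(@ge0_integral_pushforward _ _ _ _ _ _ mn gauss setT f)//.
apply: (@eq_measure_integral _ _ _ _ (image_measure gauss mn) (image_measure gauss3 (measurable_dot u))).
by move=> A mA _; exact: dot_law.
Qed.

Lemma integral_dot_sqr (u : V) :
  (\int[gauss3]_w ((dot u w) ^+ 2)%:E = (dot u u)%:E)%E.
Proof.
rewrite (@ge0_integral_dot u (fun x => (x ^+ 2)%:E)); last 2 first.
- by apply/measurable_EFinP.
- by move=> x; rewrite lee_fin sqr_ge0.
under eq_integral do rewrite exprMn EFinM.
have ms : measurable_fun setT (fun x : T => (x ^+ 2)%:E) by apply/measurable_EFinP.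
have s0 (x : T) : setT x -> (0 <= (x ^+ 2)%:E)%E by rewrite lee_fin sqr_ge0.
rewrite (ge0_integralZl _ measurableT ms s0) ?lee_fin ?sqr_ge0//.
rewrite second_moment mule1 sqr_sqrtr//.
by rewrite /dot -!expr2 !addr_ge0 ?sqr_ge0.
Qed.

(** The opposite vector has the same norm, hence its form has the same law, so the integral equals
    its own opposite; integrability excludes infinite values. *)
Lemma integral_dot0 (u : V) : gauss3.-integrable setT (EFin \o dot u) ->
  (\int[gauss3]_w (dot u w)%:E = 0)%E.
Proof.
move=> intu.
pose v : V := (- u.1.1, - u.1.2, - u.2).
have vE w : dot v w = - dot u w by rewrite /dot/=; ring.
have intv : gauss3.-integrable setT (EFin \o dot v).
  apply: eq_integrable (integrableN intu) => // w _ /=.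
  by rewrite vE.
have nvu : norm3 v = norm3 u by rewrite /norm3 /dot/=; congr Num.sqrt; ring.
have e : (\int[gauss3]_w (dot v w)%:E = \int[gauss3]_w (dot u w)%:E)%E.
  have mE : measurable_fun [set: T] (@EFin R) by exact/measurable_EFinP.
  rewrite -[LHS](@integral_pushforward _ _ _ _ _ _ (measurable_dot v) gauss3 setT _ mE intv)//.
  rewrite -[RHS](@integral_pushforward _ _ _ _ _ _ (measurable_dot u) gauss3 setT _ mE intu)//.
  apply: (@eq_measure_integral _ _ _ _ (image_measure gauss3 (measurable_dot u)) (image_measure gauss3 (measurable_dot v))).
  by move=> A mA _; rewrite /image_measure/= /pushforward !dot_law// nvu.
move: e; under eq_integral do rewrite vE EFinN.
rewrite integralN; last first.
  by apply: integrable_add_def.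
have : (\int[gauss3]_w (dot u w)%:E)%E \is a fin_num by exact: integrable_fin_num.
case: (integral _ _ _) => [r| |]// _ [] /eqP.
by rewrite eq_sym -subr_eq0 opprK -mulr2n mulrn_eq0/= => /eqP->.
Qed.

Lemma dot_Lfun2 (u : V) : dot u \in Lfun gauss3 2%:E.
Proof.
rewrite inE; apply/andP; split; rewrite inE/=; first exact: measurable_dot.
rewrite /finite_norm unlock poweR_lty//.
under eq_integral => w _.
  rewrite -[2%R]/(2%:R) poweR_EFin powR_mulrn// real_normK ?num_real//.
  over.
by rewrite integral_dot_sqr ltry.
Qed.

End dot_law.

Section linear_vector.
Context {R : realType}.
Local Notation T := (measurableTypeR R).
Local Notation V := (T * T * T)%type.
Local Notation gauss3 := (gauss3 R).

Definition dot_rv (u : V) : {RV gauss3 >-> R} :=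
  MeasurableFun.Pack (MeasurableFun.Class
    (isMeasurableFun.Build _ _ V R (dot u) (measurable_dot u))).

Lemma dotC (u v : V) : dot u v = dot v u.
Proof. by rewrite /dot mulrC (mulrC u.1.2) (mulrC u.2). Qed.

Lemma dot_ge0 (u : V) : 0 <= dot u u.
Proof. by rewrite /dot -!expr2 !addr_ge0 ?sqr_ge0. Qed.

Lemma dot_eq0 (u : V) : (dot u u == 0) = (u == 0).
Proof.
case: u => -[x y] z; rewrite /dot/= -!expr2.
by rewrite !paddr_eq0 ?addr_ge0 ?sqr_ge0// !sqrf_eq0.
Qed.

Lemma dotDl (u v w : V) : dot (u + v) w = dot u w + dot v w.
Proof. by rewrite /dot/=; ring. Qed.

Lemma dotNl (u w : V) : dot (- u) w = - dot u w.
Proof. by rewrite /dot/=; ring. Qed.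

Lemma dot_Lfun1 (u : V) : dot u \in Lfun gauss3 1.
Proof. by apply: Lfun_subset12 (dot_Lfun2 u); exact: fin_num_measure. Qed.

Lemma dot_expectation (u : V) : ('E_gauss3[dot u] = 0)%E.
Proof.
by rewrite unlock; apply: integral_dot0; apply/Lfun1_integrable/dot_Lfun1.
Qed.

Lemma dot_variance (u : V) : ('V_gauss3[dot u] = (dot u u)%:E)%E.
Proof.
rewrite varianceE ?dot_Lfun2// dot_expectation expe2 mule0 sube0.
by rewrite unlock; exact: integral_dot_sqr.
Qed.

(** Polarization: the variances of both forms and of their sum are known from [dot_variance]. *)
Lemma dot_covariance (u v : V) : (covariance gauss3 (dot u) (dot v) = (dot u v)%:E)%E.
Proof.
have := @varianceD _ _ R gauss3 (dot u) (dot v) (dot_Lfun2 u) (dot_Lfun2 v).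
rewrite (_ : (dot u \+ dot v) = dot (u + v)); last first.
  by apply/funext => w; rewrite dotDl.
rewrite !dot_variance.
have : covariance gauss3 (dot u) (dot v) \is a fin_num.
  by rewrite covariance_fin_num ?dot_Lfun1//; exact: Lfun2_mul_Lfun1 (dot_Lfun2 u) (dot_Lfun2 v).
case: (covariance _ _ _) => [r| |]// _; rewrite -EFinM -!EFinD => -[] e; congr EFin.
apply: (@mulfI _ 2) => //; apply: (@addrI _ (dot u u + dot v v)).
by rewrite -e /dot/=; ring.
Qed.

Lemma dot_rv_gaussian n (alpha : 'I_n -> V) :
  jointly_gaussian (fun i => dot_rv (alpha i)).
Proof.
move=> a.
pose u : V := ((\sum_(i < n) a i * (alpha i).1.1, \sum_(i < n) a i * (alpha i).1.2),
  \sum_(i < n) a i * (alpha i).2).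
exists 0, (norm3 u) => A mA; rewrite -dot_gaussian//.
congr (gauss3 (_ @^-1` A)); apply/funext => w /=.
rewrite {2}/dot/= !mulr_suml -!big_split/=; apply: eq_bigr => i _.
by rewrite /dot; ring.
Qed.

(** The form of [u - v] has a normal law with nonzero deviation, which has no atom at 0. *)
Lemma dot_nondegenerate (u v : V) : u != v ->
  gauss3 [set w | dot u w <> dot v w] = 1%:E.
Proof.
move=> uv; have d0 : u - v != 0 by rewrite subr_eq0.
have m0 : measurable (dot (u - v) @^-1` [set 0]).
  have := measurable_dot (u - v).
  move=> H; rewrite -[X in measurable X]setTI.
  exact: (H measurableT [set 0] (measurable_set1 0)).
rewrite (_ : [set w | _] = ~` (dot (u - v) @^-1` [set 0])); last first.
  apply/seteqP; split=> w /=; rewrite dotDl dotNl => ne e; apply: ne.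
    by apply/eqP; rewrite -subr_eq0; apply/eqP.
  by rewrite e subrr.
rewrite probability_setC// dot_gaussian//.
have n0 : norm3 (u - v) != 0.
  by rewrite /norm3 sqrtr_eq0 -ltNge lt_neqAle dot_ge0 andbT eq_sym dot_eq0.
rewrite /gaussian_law (negbTE n0).
have /null_content_dominatesP := @normal_prob_dominates R 0 (norm3 (u - v)).
by move=> /(_ [set 0] (measurable_set1 0) (lebesgue_measure_set1 0)) ->; rewrite sube0.
Qed.

Section builder.
Variables (n : nat) (alpha : 'I_n.+1 -> V).
Hypothesis alpha1 : forall i, dot (alpha i) (alpha i) = 1.
Hypothesis alpha_inj : injective alpha.

(** Transparent, so that [threshold_color] of this vector reduces to half-spaces under [gauss3]. *)
Definition linear_gaussian : gaussianVector R.
Proof.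
refine (@GaussianVector R n.+1 isT _ _ gauss3 (fun i => dot_rv (alpha i)) _ _ _ _).
- exact: dot_rv_gaussian.
- by move=> i; exact: dot_expectation.
- by move=> i; rewrite [LHS]dot_variance alpha1.
- by move=> i j ij; apply: dot_nondegenerate; apply: contra_neq ij; exact: alpha_inj.
Defined.

Lemma linear_gaussian_correlations :
  (forall i j, 0 <= dot (alpha i) (alpha j)) -> nonneg_correlations linear_gaussian.
Proof.
move=> a0 i j; have c := dot_covariance (alpha i) (alpha j).
rewrite /correlation divr_ge0 ?mulr_ge0 ?sqrtr_ge0//.
have -> : covariance (gv_prob linear_gaussian) (linear_gaussian i) (linear_gaussian j) =
    (dot (alpha i) (alpha j))%:E by exact c.
exact: a0.
Qed.

End builder.

End linear_vector.

(** * Color processes as mixtures of labellings *)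

Section labels.
Context {R : realType} {S L : finType}.
Implicit Types (p : R) (f : S -> L) (y : {ffun S -> bool}) (B : {set S}).

Definition fiber f l : {set S} := [set i | f i == l]%SET.

Definition block_weight p y B : R :=
  p * [forall i in B, y i]%:R + (1 - p) * [forall i in B, ~~ y i]%:R.

Definition label_weight p f y : R := \prod_l block_weight p y (fiber f l).

Lemma block_weightE p y B :
  block_weight p y B = \sum_(b : bool) bernoulli_pmf p b * [forall i in B, b == y i]%:R.
Proof.
rewrite big_bool/= /bernoulli_pmf /block_weight; congr (_ * _%:R + _ * _%:R);
  congr nat_of_bool; apply: eq_forallb => i; by case: (y i); rewrite ?implybT.
Qed.

Lemma block_weight0 p y : block_weight p y finset.set0 = 1.
Proof.
rewrite /block_weight; have all0 (Q : pred S) : [forall i in finset.set0, Q i].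
  by apply/forall_inP => i; rewrite inE.
by rewrite !all0 !mulr1; ring.
Qed.

Lemma block_weight_ge0 p y B : 0 <= p <= 1 -> 0 <= block_weight p y B.
Proof. by move=> /andP[p0 p1]; rewrite addr_ge0// mulr_ge0// subr_ge0. Qed.

Lemma label_weight_ge0 p f y : 0 <= p <= 1 -> 0 <= label_weight p f y.
Proof. by move=> p01; apply: prodr_ge0 => l _; exact: block_weight_ge0. Qed.

Lemma label_weight_coloring p f y : label_weight p f y =
  \sum_(c : {ffun L -> bool} | [forall i, c (f i) == y i]) \prod_l bernoulli_pmf p (c l).
Proof.
rewrite /label_weight; under eq_bigr do rewrite block_weightE.
rewrite bigA_distr_bigA/= [RHS]big_mkcond/=; apply: eq_bigr => c _.
rewrite big_split/=; case: ifPn => [/forallP cy|].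
  rewrite [X in _ * X]big1 ?mulr1// => l _.
  rewrite (_ : [forall _ in _, _])//; apply/forall_inP => i.
  by rewrite inE => /eqP <-; exact: cy.
rewrite negb_forall => /existsP[i ciy].
rewrite [X in _ * X](bigD1 (f i))//= (_ : [forall _ in _, _] = false) ?mul0r ?mulr0//.
by apply/negbTE; rewrite negb_forall; apply/existsP; exists i; rewrite inE eqxx.
Qed.

Lemma label_weight_marginal p f i : \sum_(y : {ffun S -> bool} | y i) label_weight p f y = p.
Proof.
under eq_bigr do rewrite label_weight_coloring.
rewrite (exchange_big_dep predT)//=.
transitivity (\sum_(c : {ffun L -> bool})
    \prod_l (((l == f i) ==> c l)%:R * bernoulli_pmf p (c l))).
  apply: eq_bigr => c _; rewrite big_split/=.
  have [cfi|cfi] := boolP (c (f i)).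
    rewrite [X in X * _]big1 ?mul1r; last first.
      by move=> l _; case: eqVneq => //= ->; rewrite cfi.
    rewrite (big_pred1 [ffun j => c (f j)])// => y; apply/andP/eqP => [[_ /forallP cy]|->].
      by apply/ffunP => j; rewrite ffunE (eqP (cy j)).
    by split; [rewrite ffunE|apply/forallP => j; rewrite ffunE].
  rewrite big_pred0 => [|y].
    by rewrite (bigD1 (f i))//= eqxx (negbTE cfi)/= !mul0r.
  by apply/negbTE; apply: contra cfi => /andP[yi /forallP/(_ i)/eqP ->].
rewrite -(bigA_distr_bigA (fun l b => ((l == f i) ==> b)%:R * bernoulli_pmf p b))/=.
rewrite (bigD1 (f i))//= big_bool/= eqxx/= mul1r mul0r addr0.
rewrite big1 ?mulr1// => l lfi; rewrite big_bool/= (negbTE lfi)/= !mul1r.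
by rewrite /bernoulli_pmf; ring.
Qed.

Lemma label_weight_cst p f y b : (forall i, y i = b) ->
  label_weight p f y = bernoulli_pmf p b ^+ #|[set f i | i : S]|.
Proof.
move=> yb; rewrite /label_weight (bigID (mem [set f i | i : S]))/=.
rewrite [X in _ * X]big1 ?mulr1 => [|l lf]; last first.
  rewrite (_ : fiber f l = finset.set0) ?block_weight0//.
  apply/setP => i; rewrite !inE; apply/negbTE; apply: contra lf => /eqP <-.
  exact: imset_f.
rewrite -prodr_const; apply: eq_bigr => l /imsetP[i _ ->].
rewrite block_weightE big_bool/=.
have E c : [forall j in fiber f (f i), c == y j] = (c == b).
  apply/forall_inP/eqP => [/(_ i)|-> j _]; last by rewrite yb.
  by rewrite inE eqxx yb => /(_ isT)/eqP.
by rewrite !E; case: b {yb E} => /=; rewrite mulr1 mulr0 ?addr0 ?add0r.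
Qed.

Lemma label_weight_eq0 p f y i j : f i = f j -> y i != y j ->
  label_weight p f y = 0.
Proof.
move=> fij yij; rewrite /label_weight (bigD1 (f i))//= block_weightE.
rewrite big1 ?mul0r// => b _; rewrite (_ : [forall _ in _, _] = false) ?mulr0//.
apply/negbTE; apply/negP => /forall_inP yb.
have ei : b = y i by apply/eqP/yb; rewrite inE.
have ej : b = y j by apply/eqP/yb; rewrite inE fij.
by rewrite -ei -ej eqxx in yij.
Qed.

Lemma label_weight_gt0 p f y : 0 < p < 1 -> (forall i j, f i = f j -> y i = y j) ->
  0 < label_weight p f y.
Proof.
move=> /andP[p0 p1] fy; apply: prodr_gt0 => l _.
have q0 : 0 < 1 - p by rewrite subr_gt0.
rewrite /block_weight; have [i|noi] := pickP (mem (fiber f l)); last first.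
  have all0 (Q : pred S) : [forall i in fiber f l, Q i].
    by apply/forall_inP => i; rewrite -[_ \in _]/(mem (fiber f l) i) noi.
  by rewrite !all0 !mulr1 addr_gt0.
rewrite /= inE => /eqP fi; have [yi|yi] := boolP (y i).
  rewrite (_ : [forall _ in _, y _]); last first.
    by apply/forall_inP => j; rewrite inE => /eqP fj; rewrite (fy j i)// fi.
  by rewrite mulr1 ltr_wpDr// mulr_ge0// ltW.
rewrite (_ : [forall _ in _, ~~ _]); last first.
  by apply/forall_inP => j; rewrite inE => /eqP fj; rewrite (fy j i)// fi.
by rewrite mulr1 ltr_wpDl// mulr_ge0// ltW.
Qed.

Lemma prod_preim_partition f (w : {set S} -> R) : w finset.set0 = 1 ->
  \prod_(B in preim_partition f finset.setT) w B = \prod_l w (fiber f l).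
Proof.
move=> w0.
have -> : preim_partition f finset.setT = [set fiber f l | l in [set f i | i : S]]%SET.
  apply/setP => B; apply/imsetP/imsetP => [[i _ ->]|[_ /imsetP[i _ ->] ->]].
    exists (f i); first exact: imset_f.
    by apply/setP => j; rewrite !inE eq_sym.
  by exists i => //; apply/setP => j; rewrite !inE eq_sym.
rewrite big_imset/=; last first.
  move=> _ _ /imsetP[i _ ->] /imsetP[j _ ->] /setP/(_ i).
  by rewrite !inE eqxx => /esym/eqP.
rewrite [RHS](bigID (mem [set f i | i : S]))/= [X in _ * X]big1 ?mulr1// => l lf.
rewrite (_ : fiber f l = finset.set0)//.
apply/setP => i; rewrite !inE; apply/negbTE; apply: contra lf => /eqP <-.
exact: imset_f.
Qed.

End labels.

Section color_law.
Context {R : realType} {S : finType}.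
Implicit Types (p : R) (q : {set {set S}} -> R) (y : {ffun S -> bool}).

Lemma color_pmf_blocks p q y : color_pmf p q y =
  \sum_(pi | finset.partition pi (finset.setT : {set S}))
    q pi * \prod_(B in pi) block_weight p y B.
Proof.
apply: eq_bigr => pi /and3P[/eqP covT tI n0]; congr (_ * _).
under [RHS]eq_bigr do rewrite block_weightE.
rewrite (big_distr_big false) /= big_mkcondr/=; apply: eq_bigr => c _.
rewrite big_split/=; case: ifPn => [/forallP cy|].
  rewrite [X in _ * X]big1 ?mulr1// => B Bpi.
  rewrite (_ : [forall _ in _, _])//; apply/forall_inP => i iB.
  by rewrite -(finset.def_pblock tI Bpi iB); exact: cy.
rewrite negb_forall => /existsP[i ciy].
have ic : i \in finset.cover pi by rewrite covT inE.
rewrite [X in _ * X](bigD1 (finset.pblock pi i))/= ?finset.pblock_mem//.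
rewrite (_ : [forall _ in _, _] = false) ?mul0r ?mulr0//.
by apply/negbTE; rewrite negb_forall; apply/existsP; exists i; rewrite finset.mem_pblock ic.
Qed.

Lemma color_pmf_labels p q y : color_pmf p q y =
  \sum_(pi | finset.partition pi (finset.setT : {set S}))
    q pi * label_weight p (finset.pblock pi) y.
Proof.
rewrite color_pmf_blocks; apply: eq_bigr => pi parpi; congr (_ * _).
by rewrite -{1}(finset.preim_partition_pblock parpi) prod_preim_partition ?block_weight0.
Qed.

Lemma color_pmf_marginal p q i : random_partition_law q ->
  \sum_(y : {ffun S -> bool} | y i) color_pmf p q y = p.
Proof.
move=> [q0 q1]; under eq_bigr do rewrite color_pmf_labels.
rewrite exchange_big/= -[RHS]mul1r -q1 mulr_suml; apply: eq_bigr => pi _.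
by rewrite -mulr_sumr label_weight_marginal.
Qed.

(** The mixture may be indexed by any finite type. Different indices can induce the same partition,
    so [q] adds up their weights. *)
Lemma color_process_labels d (T : measurableType d) (P : probability T R)
    (Y : S -> T -> bool) (L K : finType) (p : R) (w : K -> R) (f : K -> S -> L) :
  0 <= p <= 1 -> (forall k, 0 <= w k) -> \sum_k w k = 1 ->
  (forall y : {ffun S -> bool}, P [set t | forall i, Y i t = y i] =
    (\sum_k w k * label_weight p (f k) y)%:E) ->
  color_process P Y.
Proof.
move=> p01 w0 w1 PY.
pose q (pi : {set {set S}}) : R := \sum_(k | preim_partition (f k) finset.setT == pi) w k.
have sumq (G : {set {set S}} -> R) :
    \sum_(pi | finset.partition pi (finset.setT : {set S})) q pi * G pi =
    \sum_k w k * G (preim_partition (f k) finset.setT).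
  rewrite (partition_big (fun k => preim_partition (f k) finset.setT)
    (fun pi => finset.partition pi (finset.setT : {set S})))/=; last first.
    by move=> k _; exact: finset.preim_partitionP.
  by apply: eq_bigr => pi _; rewrite /q mulr_suml; apply: eq_bigr => k /eqP ->.
exists p, q; split=> //.
  split; first by move=> pi _; apply: sumr_ge0.
  have := sumq (fun=> 1); under eq_bigr do rewrite mulr1.
  by under [RHS]eq_bigr do rewrite mulr1; rewrite w1.
move=> y; rewrite PY color_pmf_blocks sumq; congr EFin; apply: eq_bigr => k _.
by rewrite prod_preim_partition ?block_weight0.
Qed.

End color_law.

Section events.
Context d (T : measurableType d) {R : realType} (P : probability T R) {S : finType}.
Variable Y : S -> T -> bool.
Hypothesis mY : forall i, measurable [set t | Y i t].

Definition pattern (y : {ffun S -> bool}) : set T := [set t | forall i, Y i t = y i].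

Lemma measurable_pattern y : measurable (pattern y).
Proof.
rewrite (_ : pattern y = \bigcap_(i in [set: S]) [set t | Y i t = y i]).
  apply: fin_bigcap_measurable => // i _; case: (y i); first exact: mY.
  rewrite (_ : [set t | _] = ~` [set t | Y i t]); first exact/measurableC/mY.
  by apply/seteqP; split=> t /=; [move=> ->|move/negP/negbTE].
by apply/seteqP; split=> t /=; [move=> h i _; exact: h|move=> h i; exact: h].
Qed.

Lemma pattern_sum (Q : pred {ffun S -> bool}) :
  P [set t | Q [ffun i => Y i t]] = (\sum_(y | Q y) P (pattern y))%E.
Proof.
pose F y := if Q y then pattern y else set0.
rewrite (_ : [set t | _] = \bigcup_(y in [set: {ffun S -> bool}]) F y); last first.
  apply/seteqP; split=> t /=.
    by move=> Qt; exists [ffun i => Y i t] => //; rewrite /F Qt => i; rewrite ffunE.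
  move=> [y _]; rewrite /F; case: ifP => // Qy ty.
  by rewrite (_ : [ffun i => _] = y)//; apply/ffunP => i; rewrite ffunE ty.
rewrite measure_fin_bigcup//; last 2 first.
- apply/trivIsetP => y z _ _ yz; apply/seteqP; split=> t //= []; rewrite /F.
  case: ifP => // _ ty; case: ifP => // _ tz.
  by move/eqP : yz; apply; apply/ffunP => i; rewrite -ty tz.
- by move=> y _; rewrite /F; case: ifP => // _; exact: measurable_pattern.
rewrite (fsbigE (index_enum {ffun S -> bool})) ?index_enum_uniq//; last first.
  by move=> y _; rewrite mem_index_enum.
under eq_bigl do rewrite in_setT.
rewrite [RHS]big_mkcond/=; apply: eq_bigr => y _.
  by rewrite /F; case: ifP => // _; rewrite measure0.
exact: finite_finset.
Qed.

(** The parameter inside [color_process] is existentially quantified; this pins it to the one-point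
    probability. *)
Lemma color_marginal p q i : random_partition_law q ->
  (forall y, P (pattern y) = (color_pmf p q y)%:E) -> P [set t | Y i t] = p%:E.
Proof.
move=> hq PY.
rewrite (_ : [set t | _] = [set t | [ffun i => Y i t] i]); last first.
  by apply/seteqP; split=> t /=; rewrite ffunE.
rewrite (pattern_sum (fun y => y i)); under eq_bigr do rewrite PY.
by rewrite sumEFin color_pmf_marginal.
Qed.

(** Both sides are linear in the mixing law, so an inequality between two pattern probabilities can
    be checked one partition at a time. *)
Lemma color_pattern_le p q (y z : {ffun S -> bool}) (a b : R) :
  0 <= p <= 1 -> random_partition_law q ->
  (forall y, P (pattern y) = (color_pmf p q y)%:E) ->
  (forall (f : S -> {set S}), label_weight p f y * a <= label_weight p f z * b) ->
  (P (pattern y) * a%:E <= P (pattern z) * b%:E)%E.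
Proof.
move=> p01 [q0 _] PY yz; rewrite !PY -!EFinM lee_fin !color_pmf_labels !mulr_suml.
apply: ler_sum => pi parpi; rewrite -!mulrA ler_wpM2l// q0//.
Qed.

End events.

(** * Necessary inequalities for color processes *)

Section necessary.
Context d (T : measurableType d) {R : realType} (P : probability T R).

(** The weight depends only on which points share a label, which lets an arbitrary block map be
    replaced by an explicit [lab]. *)
Lemma eq_label_weight (S L L' : finType) (p : R) (f : S -> L) (g : S -> L')
    (y : {ffun S -> bool}) : (forall i j, (f i == f j) = (g i == g j)) ->
  label_weight p f y = label_weight p g y.
Proof.
move=> fg; rewrite /label_weight -!(prod_preim_partition _ (block_weight0 p y)).
suff -> : preim_partition f finset.setT = preim_partition g finset.setT by [].
by apply: eq_in_imset => i _; apply/setP => j; rewrite !inE fg.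
Qed.

(* The partition into singletons gives every pattern positive weight, so a null
   pattern excludes it and every charged partition has at most #|S| - 1 blocks. *)
Lemma null_pattern_nonseparated (S : finType) (Y : S -> T -> bool)
    (p : R) (q : {set {set S}} -> R) (y : {ffun S -> bool}) :
  0 < p < 1 -> random_partition_law q ->
  (forall z, P (pattern Y z) = (color_pmf p q z)%:E) ->
  P (pattern Y y) = 0%E ->
  (((1 - p) ^+ #|S|.-1)%:E <= P (pattern Y [ffun=> false]))%E.
Proof.
move=> p01 [q0 q1] PY; rewrite !PY => -[]; rewrite !color_pmf_labels => sum0.
rewrite lee_fin -[leLHS]mul1r -{1}q1 mulr_suml; apply: ler_sum => pi parpi.
have p01' : 0 <= p <= 1 by case/andP: p01 => /ltW -> /ltW ->.
have /andP[p0 p1] := p01'.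
have q0pi := q0 _ parpi.
have [inj|ninj] := boolP (injectiveb (finset.pblock pi)).
  suff -> : q pi = 0 by rewrite !mul0r.
  have lw0 : 0 < label_weight p (finset.pblock pi) y.
    by apply: label_weight_gt0 => // i j /(injectiveP _ inj) ->.
  have /psumr_eq0P := sum0.
  move=> /(_ _)/(_ _ parpi)/eqP; rewrite mulf_eq0 (gt_eqF lw0) orbF => e.
  by apply/eqP; apply: e => rho parrho; rewrite mulr_ge0 ?q0// label_weight_ge0.
rewrite ler_wpM2l// (@label_weight_cst _ _ _ _ _ _ false); last by move=> i; rewrite ffunE.
rewrite /bernoulli_pmf/= ler_wiXn2l ?subr_ge0// ?lerBlDr ?lerDl//.
have : (#|[set finset.pblock pi i | i : S]| < #|S|)%N.
  rewrite ltn_neqAle leq_imset_card andbT; apply: contra ninj => /imset_injP inj.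
  by apply/injectiveP => i j; exact: inj.
by case: #|S|.
Qed.

Definition pat3 (b0 b1 b2 : bool) : {ffun 'I_3 -> bool} :=
  [ffun i => nth false [:: b0; b1; b2] (nat_of_ord i)].

Definition pat4 (b0 b1 b2 b3 : bool) : {ffun 'I_4 -> bool} :=
  [ffun i => nth false [:: b0; b1; b2; b3] (nat_of_ord i)].

Lemma pat3_surj (y : {ffun 'I_3 -> bool}) : exists b0 b1 b2, y = pat3 b0 b1 b2.
Proof.
exists (y (inord 0)), (y (inord 1)), (y (inord 2)); apply/ffunP => -[[|[|[|//]]] ?];
  by rewrite ffunE/=; congr (y _); apply/val_inj; rewrite /= inordK.
Qed.

Lemma pat4_surj (y : {ffun 'I_4 -> bool}) : exists b0 b1 b2 b3, y = pat4 b0 b1 b2 b3.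
Proof.
exists (y (inord 0)), (y (inord 1)), (y (inord 2)), (y (inord 3)).
apply/ffunP => -[[|[|[|[|//]]]] ?];
  by rewrite ffunE/=; congr (y _); apply/val_inj; rewrite /= inordK.
Qed.

Definition lab n (ls : seq nat) (i : 'I_n.+1) : 'I_n.+1 := inord (nth 0%N ls i).

Lemma lab_weightE n (ls : seq nat) (p : R) (y : {ffun 'I_n.+1 -> bool}) :
  all (fun l => l < n.+1)%N ls ->
  label_weight p (@lab n ls) y = \prod_(l < n.+1)
    (p * (\big[andb/true]_(i < n.+1) ((nth 0%N ls i == l) ==> y i))%:R
     + (1 - p) * (\big[andb/true]_(i < n.+1) ((nth 0%N ls i == l) ==> ~~ y i))%:R).
Proof.
move=> lsn; apply: eq_bigr => l _; rewrite /block_weight.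
have E (i : 'I_n.+1) : (i \in fiber (@lab n ls) l) = (nth 0%N ls i == l).
  rewrite inE -val_eqE/= /lab inordK//; case: (ltnP i (size ls)) => ils.
    by apply: (allP lsn); exact: mem_nth.
  by rewrite nth_default.
have F (Q : pred 'I_n.+1) : [forall i in fiber (@lab n ls) l, Q i] =
    \big[andb/true]_(i < n.+1) ((nth 0%N ls i == l) ==> Q i).
  by rewrite big_andE; apply: eq_forallb => i; rewrite E.
by rewrite !F.
Qed.

(* The inequality holds for each of the five partitions separately; p <= 1/2 is
   needed only for {0, 2}, {1}. *)
Lemma color_triple_le (Y : 'I_3 -> T -> bool) (p : R) :
  (forall i, measurable [set t | Y i t]) ->
  P [set t | Y ord0 t] = p%:E -> p <= 1 / 2 -> color_process P Y ->
  (P (pattern Y (pat3 false true false)) * p%:E <=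
   P (pattern Y (pat3 true false true)) * (1 - p)%:E)%E.
Proof.
move=> mY Pp p2 [p' [q [p01 hq PY]]].
have pp' : p = p'.
  by have := color_marginal mY ord0 hq PY; rewrite Pp => -[].
rewrite -{}pp' in p01 PY.
apply: (color_pattern_le p01 hq PY) => f.
have q0 : 0 <= 1 - p by case/andP: p01; rewrite subr_ge0.
have p0 : 0 <= p by case/andP: p01.
pose i0 : 'I_3 := inord 0; pose i1 : 'I_3 := inord 1; pose i2 : 'I_3 := inord 2.
(* The pattern 010 separates 1 from 0 and from 2, so its weight vanishes unless 1 is alone in its
   block; two partitions remain. *)
have [f01|f01] := eqVneq (f i0) (f i1).
  rewrite (@label_weight_eq0 _ _ _ _ _ _ i0 i1)// ?mul0r.
    by rewrite mulr_ge0// label_weight_ge0.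
  by rewrite !ffunE !inordK.
have [f12|f12] := eqVneq (f i1) (f i2).
  rewrite (@label_weight_eq0 _ _ _ _ _ _ i1 i2)// ?mul0r.
    by rewrite mulr_ge0// label_weight_ge0.
  by rewrite !ffunE !inordK.
have lw (ls : seq nat) : all (fun l => l < 3)%N ls ->
    (forall i j, (i < j)%N -> (j < 3)%N ->
      (f (inord i) == f (inord j)) = (nth 0%N ls i == nth 0%N ls j)) ->
    forall y, label_weight p f y = label_weight p (@lab 2 ls) y.
  move=> l3 fl y; apply: eq_label_weight => i j; rewrite -[RHS](inj_eq val_inj) /=.
  have nthlt (k : nat) : (nth 0%N ls k < 3)%N.
    by case: (ltnP k (size ls)) => ks; [exact/(allP l3)/mem_nth|rewrite nth_default].
  have fl' (a b : 'I_3) : (a < b)%N -> (f a == f b) = (nth 0%N ls a == nth 0%N ls b).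
    by move=> ab; rewrite -fl ?inord_val.
  rewrite !inordK//; case: (ltngtP i j) => [/fl'//|/fl' e|/val_inj ->]; last by rewrite !eqxx.
  by rewrite eq_sym e eq_sym.
have [f02|f02] := eqVneq (f i0) (f i2).
  have L y : label_weight p f y = label_weight p (@lab 2 [:: 0; 1; 0]%N) y.
    apply: lw => // -[|[|i]] [|[|[|j]]] //= _ _; rewrite -/i0 -/i1 -/i2.
    - exact: negbTE.
    - by rewrite f02 eqxx.
    - exact: negbTE.
  rewrite !L !lab_weightE// !big_ord_recr !big_ord0/= !ffunE/=.
  have key : 0 <= p * (1 - p) * (1 - p - p) by rewrite !mulr_ge0//; lra.
  lra.
have L y : label_weight p f y = label_weight p (@lab 2 [:: 0; 1; 2]%N) y.
  by apply: lw => // -[|[|i]] [|[|[|j]]] //= _ _; rewrite -/i0 -/i1 -/i2; exact: negbTE.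
rewrite !L !lab_weightE// !big_ord_recr !big_ord0/= !ffunE/=; lra.
Qed.

End necessary.

(** * Solving for the partition weights on three and four points *)

Section sufficient.
Context d (T : measurableType d) {R : realType} (P : probability T R).

Lemma lab3_weightE (p : R) (l0 l1 l2 : nat) (b0 b1 b2 : bool) :
  let bw l := p * [&& (l0 == l) ==> b0, (l1 == l) ==> b1 & (l2 == l) ==> b2]%:R +
    (1 - p) * [&& (l0 == l) ==> ~~ b0, (l1 == l) ==> ~~ b1 & (l2 == l) ==> ~~ b2]%:R in
  all (fun l => l < 3)%N [:: l0; l1; l2] ->
  label_weight p (@lab 2 [:: l0; l1; l2]) (pat3 b0 b1 b2) = bw 0%N * bw 1%N * bw 2%N.
Proof.
move=> bw l3; rewrite lab_weightE//.
have E (l : nat) :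
    p * (\big[andb/true]_(i < 3) ((nth 0%N [:: l0; l1; l2] i == l) ==> pat3 b0 b1 b2 i))%:R +
    (1 - p) * (\big[andb/true]_(i < 3) ((nth 0%N [:: l0; l1; l2] i == l) ==> ~~ pat3 b0 b1 b2 i))%:R
    = bw l.
  by rewrite !big_ord_recr !big_ord0/= !ffunE/= -!andbA.
under eq_bigr => l _ do rewrite E.
by rewrite !big_ord_recr big_ord0/= mul1r.
Qed.

Lemma color_of_triple (Y : 'I_3 -> T -> bool) (p : R) (m : bool -> bool -> bool -> R) :
  0 < p < 1 / 2 ->
  (forall b0 b1 b2, P (pattern Y (pat3 b0 b1 b2)) = (m b0 b1 b2)%:E) ->
  let p01 := m true true true + m true true false in
  let p02 := m true true true + m true false true in
  let p12 := m true true true + m false true true in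
  p01 + m true false true + m true false false = p ->
  p01 + m false true true + m false true false = p ->
  p02 + m false true true + m false false true = p ->
  p01 + m true false true + m true false false + m false true true +
    m false true false + m false false true + m false false false = 1 ->
  m false true false * p <= m true false true * (1 - p) ->
  m true false false * p <= m false true true * (1 - p) ->
  m false false true * p <= m true true false * (1 - p) ->
  m true false true <= m false true false ->
  p * (p01 + p02 + p12) <= m true true true + 2 * p ^+ 3 ->
  color_process P Y.
Proof.
move=> p012 PY p01 p02 p12 m0 m1 m2 mtot h1 h0 h2 hc ha.
have [p0 pl] : 0 < p /\ p < 1 / 2 by apply/andP.
pose D := p * (1 - p) * (1 - 2 * p).
have D0 : 0 < D by rewrite /D !mulr_gt0//; lra.
have pN0 : p != 0 by rewrite gt_eqF.
have qN0 : 1 - p != 0 by rewrite gt_eqF//; lra.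
have rN0 : 1 - 2 * p != 0 by rewrite gt_eqF//; lra.
(* The weights solve the linear system expressing the law of Y as a mixture over
   the five partitions of three points. *)
pose c := (m false true false - m true false true) / D.
pose b02 := (m true false true * (1 - p) - m false true false * p) / D.
pose b12 := (m false true true * (1 - p) - m true false false * p) / D.
pose b01 := (m true true false * (1 - p) - m false false true * p) / D.
pose a := (m true true true + 2 * p ^+ 3 - p * (p01 + p02 + p12)) / D.
(* One hypothesis controls the weight of the singletons: since the three marginals are equal, the
   differences m010 - m101, m100 - m011 and m001 - m110 coincide. *)
have c0 : 0 <= c by rewrite divr_ge0 ?(ltW D0)// subr_ge0.
have b020 : 0 <= b02 by rewrite divr_ge0 ?(ltW D0)// subr_ge0.
have b120 : 0 <= b12 by rewrite divr_ge0 ?(ltW D0)// subr_ge0.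
have b010 : 0 <= b01 by rewrite divr_ge0 ?(ltW D0)// subr_ge0.
have a0 : 0 <= a by rewrite divr_ge0 ?(ltW D0)// subr_ge0.
pose ws := [:: a; b01; b02; b12; c].
pose ls := [:: [:: 0; 0; 0]; [:: 0; 0; 1]; [:: 0; 1; 0]; [:: 1; 0; 0]; [:: 0; 1; 2]]%N.
apply: (@color_process_labels _ _ _ _ P Y 'I_3 'I_5 p
  (fun k => nth 0 ws k) (fun k => @lab 2 (nth [::] ls k))).
- by rewrite ltW//= ; lra.
- by case=> -[|[|[|[|[|//]]]]].
- rewrite !big_ord_recr big_ord0/= add0r /c /b02 /b12 /b01 /a /D.
  have e0 : m true false false = p - p01 - m true false true by lra.
  have e1 : m false true false = p - p01 - m false true true by lra.
  have e2 : m false false true = p - p02 - m false true true by lra.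
  by rewrite e0 e1 e2 /p01 /p02 /p12; field; rewrite pN0 qN0 rN0.
move=> y; have [b0 [b1 [b2 ->]]] := pat3_surj y.
have e0 : m true false false = p - p01 - m true false true by lra.
have e1 : m false true false = p - p01 - m false true true by lra.
have e2 : m false false true = p - p02 - m false true true by lra.
have e3 : m false false false = 1 - p - m false true true - m false true false - m false false true by lra.
have [p1 p2] : p01 = m true true true + m true true false /\ p02 = m true true true + m true false true by [].
rewrite PY; congr EFin; rewrite !big_ord_recr big_ord0 /= !lab3_weightE//=.
rewrite /c /b02 /b12 /b01 /a /D.
case: b0 b1 b2 => -[] [] /=; rewrite ?e3 ?e0 ?e1 ?e2 /p12 p1 p2;
  by field; rewrite pN0 qN0 rN0.
Qed.

Lemma lab4_weightE (p : R) (l0 l1 l2 l3 : nat) (b0 b1 b2 b3 : bool) :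
  let bw l := p * [&& (l0 == l) ==> b0, (l1 == l) ==> b1,
                      (l2 == l) ==> b2 & (l3 == l) ==> b3]%:R +
    (1 - p) * [&& (l0 == l) ==> ~~ b0, (l1 == l) ==> ~~ b1,
                  (l2 == l) ==> ~~ b2 & (l3 == l) ==> ~~ b3]%:R in
  all (fun l => l < 4)%N [:: l0; l1; l2; l3] ->
  label_weight p (@lab 3 [:: l0; l1; l2; l3]) (pat4 b0 b1 b2 b3) =
  bw 0%N * bw 1%N * bw 2%N * bw 3%N.
Proof.
move=> bw l4; rewrite lab_weightE//.
have E (l : nat) :
    p * (\big[andb/true]_(i < 4) ((nth 0%N [:: l0; l1; l2; l3] i == l) ==> pat4 b0 b1 b2 b3 i))%:R +
    (1 - p) * (\big[andb/true]_(i < 4) ((nth 0%N [:: l0; l1; l2; l3] i == l) ==> ~~ pat4 b0 b1 b2 b3 i))%:R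
    = bw l.
  by rewrite !big_ord_recr !big_ord0/= !ffunE/= -!andbA.
under eq_bigr => l _ do rewrite E.
by rewrite !big_ord_recr big_ord0/= mul1r.
Qed.

(* Indices 0, 1 and 2, 3 are the two diagonals of the square. *)
Definition square_pattern (A B f1 f3 g : R) (b0 b1 b2 b3 : bool) : R :=
  match (b0 + b1 + b2 + b3)%N with
  | 0%N => B | 1%N => f1 | 3%N => f3 | 4%N => A
  | _ => if b0 == b1 then 0 else g
  end.

Lemma color_of_square (Y : 'I_4 -> T -> bool) (p A B f1 f3 g : R) :
  1 / 4 <= p < 1 / 2 -> 0 <= f3 ->
  (forall b0 b1 b2 b3, P (pattern Y (pat4 b0 b1 b2 b3)) =
     (square_pattern A B f1 f3 g b0 b1 b2 b3)%:E) ->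
  A + 3 * f3 + f1 + 2 * g = p ->
  A + B + 4 * f1 + 4 * f3 + 4 * g = 1 ->
  f3 <= f1 ->
  f1 * p <= f3 * (1 - p) ->
  f1 - f3 <= 2 * g * (1 - 2 * p) ->
  4 * f3 + 2 * g <= p * (1 - p) ->
  color_process P Y.
Proof.
move=> p1412 f30 PY mp mtot hx hv hw ht.
have [p14 pl] : 1 / 4 <= p /\ p < 1 / 2 by apply/andP.
pose D := p * (1 - p) * (1 - 2 * p).
have r0 : 0 < 1 - 2 * p by lra.
have D0 : 0 < D by rewrite /D !mulr_gt0//; lra.
have pN0 : p != 0 by rewrite gt_eqF//; lra.
have qN0 : 1 - p != 0 by rewrite gt_eqF//; lra.
have rN0 : 1 - 2 * p != 0 by rewrite gt_eqF//; lra.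
(* t, v, w, x are the weights of the one-block partition, of each partition
   triple + singleton, of each of the two partitions into adjacent pairs, and of
   each partition adjacent pair + two singletons; by symmetry they are the only
   ones needed when the diagonal patterns 1100 and 0011 have mass zero. *)
pose x := (f1 - f3) / (2 * D).
pose v := (f3 * (1 - p) - f1 * p) / D.
pose w := (2 * g * (1 - 2 * p) - (f1 - f3)) / (2 * D).
pose t := (D + f1 * (4 * p - 1) - f3 * (3 - 4 * p) - 2 * g * (1 - 2 * p)) / D.
have x0 : 0 <= x by rewrite divr_ge0 ?subr_ge0// mulr_ge0// ltW.
have v0 : 0 <= v by rewrite divr_ge0 ?(ltW D0)// subr_ge0.
have w0 : 0 <= w by rewrite divr_ge0 ?subr_ge0// mulr_ge0// ltW.
have t0 : 0 <= t.
  rewrite divr_ge0 ?(ltW D0)//.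
  (* The numerator of [t] is (f1 - f3)(4p - 1) + (p(1 - p) - 4 f3 - 2 g)(1 - 2p); this is where
     [1 / 4 <= p] enters. *)
  have k1 : 0 <= (f1 - f3) * (4 * p - 1) by rewrite mulr_ge0 ?subr_ge0//; lra.
  have k2 : 0 <= (p * (1 - p) - (4 * f3 + 2 * g)) * (1 - 2 * p).
    by rewrite mulr_ge0 ?subr_ge0//; lra.
  by move: k1 k2; rewrite /D; lra.
pose ws := [:: t; v; v; v; v; w; w; x; x; x; x].
pose ls := [:: [:: 0; 0; 0; 0]; [:: 1; 0; 0; 0]; [:: 0; 1; 0; 0]; [:: 0; 0; 1; 0];
  [:: 0; 0; 0; 1]; [:: 0; 1; 0; 1]; [:: 0; 1; 1; 0];
  [:: 0; 1; 0; 2]; [:: 0; 1; 2; 0]; [:: 1; 0; 0; 2]; [:: 1; 0; 2; 0]]%N.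
have eB : B = 1 - p - f1 * 3 - f3 - 2 * g by lra.
have eA : A = p - 3 * f3 - f1 - 2 * g by lra.
apply: (@color_process_labels _ _ _ _ P Y 'I_4 'I_11 p
  (fun k => nth 0 ws k) (fun k => @lab 3 (nth [::] ls k))).
- by apply/andP; split; lra.
- by case=> -[|[|[|[|[|[|[|[|[|[|[|//]]]]]]]]]]].
- rewrite !big_ord_recr big_ord0/= /t /v /w /x /D.
  by field; rewrite pN0 qN0 rN0.
move=> y; have [b0 [b1 [b2 [b3 ->]]]] := pat4_surj y.
rewrite PY; congr EFin; rewrite !big_ord_recr big_ord0 /= !lab4_weightE//=.
rewrite /t /v /w /x /D /square_pattern.
case: b0 b1 b2 b3 => -[] [] [] /=; rewrite ?eA ?eB;
  by field; rewrite pN0 qN0 rN0.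
Qed.

End sufficient.

(** * Gaussian tails and boxes *)

Section real_probability.
Context d (T : measurableType d) {R : realType} (P : probability T R).

Definition Pr (A : set T) : R := fine (P A).

Lemma PrE A : measurable A -> P A = (Pr A)%:E.
Proof. by move=> mA; rewrite /Pr fineK// fin_num_measure. Qed.

Lemma Pr_ge0 A : 0 <= Pr A.
Proof. by rewrite /Pr fine_ge0. Qed.

Lemma Pr_mono A B : measurable A -> measurable B -> A `<=` B -> Pr A <= Pr B.
Proof.
by move=> mA mB AB; rewrite -lee_fin -!PrE//; apply: le_measure; rewrite ?inE.
Qed.

Lemma Pr_le1 A : measurable A -> Pr A <= 1.
Proof. by move=> mA; rewrite -lee_fin -PrE// probability_le1. Qed.

Lemma PrT : Pr setT = 1.
Proof. by rewrite /Pr probability_setT. Qed.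

Lemma Pr0 : Pr set0 = 0.
Proof. by rewrite /Pr measure0. Qed.

Lemma PrU A B : measurable A -> measurable B -> (forall t, A t -> B t -> False) ->
  Pr (A `|` B) = Pr A + Pr B.
Proof.
move=> mA mB AB; apply/EFin_inj; rewrite EFinD -!PrE//; last exact: measurableU.
by rewrite measureU//; apply/seteqP; split=> t // [At Bt]; exact: AB At Bt.
Qed.

Lemma PrU_le A B : measurable A -> measurable B -> Pr (A `|` B) <= Pr A + Pr B.
Proof.
move=> mA mB; rewrite -lee_fin EFinD -!PrE//; last exact: measurableU.
exact: measureU2.
Qed.

Lemma Pr_split A B : measurable A -> measurable B ->
  Pr A = Pr (A `&` B) + Pr (A `&` ~` B).
Proof.
move=> mA mB; rewrite -PrU ?setIUr ?setUv//.
- by rewrite -setIUr setUv setIT.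
- exact: measurableI.
- by apply: measurableI => //; exact: measurableC.
- by move=> t [_ Bt] [_].
Qed.

Lemma PrC A : measurable A -> Pr (~` A) = 1 - Pr A.
Proof.
by move=> mA; rewrite -PrT (Pr_split measurableT mA) !setTI addrAC subrr add0r.
Qed.

End real_probability.

Section gauss_real.
Context {R : realType}.
Local Notation mu := (@lebesgue_measure R).
Local Notation T := (measurableTypeR R).
Local Notation gauss := (gauss R).
Local Notation phi := (@phi R).

(** The substitution [k * u + m] reduces the comparison of two masses to a pointwise comparison of
    densities. Reflections, the exponential tail bound and the dilations below are all instances. *)
Lemma gauss_transport (k m K : R) (A B : set T) : k != 0 -> 0 <= K ->
  measurable A -> measurable B ->
  (forall u, A (k * u + m) -> B u /\ `|k| * phi (k * u + m) <= K * phi u) ->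
  Pr gauss A <= K * Pr gauss B.
Proof.
move=> k0 K0 mA mB AB; rewrite -lee_fin EFinM -!PrE// !gauss_indicE//.
have mf (C : set T) : measurable C -> measurable_fun setT (fun x : T => (\1_C x * phi x)%:E).
  move=> mC; apply/measurable_EFinP; apply: measurable_funM => //.
  exact: measurable_phi.
rewrite (@ge0_integral_affine _ k m _ k0 (mf _ mA)); last first.
  by move=> x; rewrite lee_fin mulr_ge0 ?phi_ge0.
have mkm : measurable_fun setT (fun x : T => k * x + m : T).
  by apply: measurable_funD => //; exact: measurable_funM.
have B0 (x : T) : setT x -> (0 <= (\1_B x * phi x)%:E)%E.
  by move=> _; rewrite lee_fin mulr_ge0 ?phi_ge0.
have K0' : (0 <= K%:E)%E by rewrite lee_fin.
rewrite -(ge0_integralZl _ measurableT (mf _ mB) B0 K0').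
apply: ge0_le_integral => //=.
- by move=> x _; rewrite mule_ge0 ?lee_fin// mulr_ge0 ?phi_ge0.
- apply: measurable_funeM; exact: (measurableT_comp (mf _ mA) mkm).
- by apply: measurable_funeM; exact: mf.
move=> x _; rewrite -!EFinM lee_fin !indicE.
case: (boolP (k * x + m \in A)) => [|_]; last first.
  by rewrite mul0r mulr0 mulr_ge0// mulr_ge0 ?phi_ge0.
by rewrite inE => /AB[Bx le]; rewrite (mem_set Bx) !mul1r.
Qed.

Lemma phi_le_phi0 x : phi x <= phi 0.
Proof.
rewrite (phiE x) -[leRHS]mulr1 ler_wpM2l ?phi_ge0// -expR0 ler_expR.
by rewrite oppr_le0 divr_ge0 ?sqr_ge0.
Qed.

Lemma phi0_le1 : phi 0 <= 1.
Proof.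
have pi2 : 1 <= (pi : R) *+ 2 by have := @pi_ge2 R; rewrite -mulr_natr; lra.
rewrite phi0 /normal_peak expr1n mul1r invf_le1 ?sqrtr_gt0 ?(lt_le_trans ltr01)//.
by rewrite -[leLHS]sqrtr1 ler_wsqrtr.
Qed.

Lemma phi_le_abs x y : `|x| <= `|y| -> phi y <= phi x.
Proof.
move=> xy; rewrite (phiE y) (phiE x) ler_wpM2l ?phi_ge0// ler_expR lerN2.
by rewrite ler_wpM2r// -(real_normK (num_real x)) -(real_normK (num_real y)) lerXn2r ?nnegrE.
Qed.

Lemma gauss_itv_ge (x y M : R) : x <= y -> (forall u, x < u <= y -> `|u| <= M) ->
  (y - x) * phi M <= Pr gauss `]x, y]%classic.
Proof.
move=> xy xyM; rewrite -lee_fin -PrE// gaussE.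
apply: (@le_trans _ _ (\int[mu]_(u in `]x, y]) (phi M)%:E)%E).
  rewrite integral_cst//= lebesgue_measure_itv/= lte_fin.
  case: ltP => [_|yx]; first by rewrite -EFinD -EFinM mulrC.
  have -> : y = x by apply/eqP; rewrite eq_le yx xy.
  by rewrite subrr mul0r mule0.
apply: ge0_le_integral => //=.
- by move=> u _; rewrite lee_fin phi_ge0.
- apply/measurable_EFinP/measurable_funTS; exact: measurable_phi.
- move=> u; rewrite in_itv/= => /xyM uM; rewrite lee_fin phi_le_abs//.
  by rewrite (le_trans uM)// ler_norm.
Qed.

Lemma gauss_itv_le_phi0 (x y : R) : x <= y ->
  Pr gauss `]x, y]%classic <= (y - x) * phi 0.
Proof.
move=> xy; rewrite -lee_fin -PrE// gaussE.
apply: (@le_trans _ _ (\int[mu]_(u in `]x, y]) (phi 0)%:E)%E).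
  apply: ge0_le_integral => //=.
  - by move=> u _; rewrite lee_fin phi_ge0.
  - apply/measurable_EFinP/measurable_funTS; exact: measurable_phi.
  - by move=> u _; rewrite lee_fin phi_le_phi0.
rewrite integral_cst//= lebesgue_measure_itv/= lte_fin.
case: ltP => [_|yx]; first by rewrite -EFinD -EFinM mulrC.
by rewrite mule0 lee_fin mulr_ge0 ?phi_ge0// subr_ge0.
Qed.

Lemma gauss_itv_le (x y : R) : x <= y -> Pr gauss `]x, y]%classic <= y - x.
Proof.
move=> xy; apply: le_trans (gauss_itv_le_phi0 xy) _.
by rewrite ler_piMr ?subr_ge0// phi0_le1.
Qed.

Lemma gauss_set1 (x : R) : Pr gauss [set x] = 0.
Proof. by rewrite /Pr gaussE integral_set1.
Qed.

End gauss_real.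

Section tail.
Context {R : realType}.
Local Notation T := (measurableTypeR R).
Local Notation gauss := (gauss R).
Local Notation phi := (@phi R).

Definition tail (x : R) : R := Pr gauss `]x, +oo[%classic.

Lemma gauss_reflect_le (A B : set T) : measurable A -> measurable B ->
  (forall u, A (- u) -> B u) -> Pr gauss A <= Pr gauss B.
Proof.
move=> mA mB AB; rewrite -[leRHS]mul1r; apply: (@gauss_transport _ (-1) 0) => //.
move=> u; rewrite addr0 mulN1r => /AB Bu; split=> //.
by rewrite normrN normr1 phi_even.
Qed.

Lemma tail_ge0 x : 0 <= tail x. Proof. exact: Pr_ge0. Qed.

Lemma tail_le1 x : tail x <= 1. Proof. exact: Pr_le1. Qed.

Lemma tail_itv x y : x <= y -> Pr gauss `]x, y]%classic = tail x - tail y.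
Proof.
move=> xy; apply/eqP; rewrite eq_sym subr_eq; apply/eqP.
rewrite /tail -PrU//.
  congr (Pr _ _); apply/seteqP; split=> u /=; rewrite !in_itv/= !andbT.
    by move=> xu; case: (leP u y) => uy; [left; rewrite xu|right].
  by move=> [/andP[]//|]; exact: le_lt_trans.
by move=> u /=; rewrite !in_itv/= andbT => /andP[_ uy]; rewrite ltNge uy.
Qed.

Lemma tail_anti x y : x <= y -> tail y <= tail x.
Proof. by move=> xy; rewrite -subr_ge0 -tail_itv// Pr_ge0. Qed.

Lemma tailN x : tail (- x) = 1 - tail x.
Proof.
have E : Pr gauss `]-oo, x]%classic = 1 - tail x.
  rewrite /tail -PrC//; congr (Pr _ _); apply/seteqP; split=> u /=;
    by rewrite !in_itv/= andbT leNgt => /negP.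
apply/eqP; rewrite eq_le -E; apply/andP; split.
  by apply: gauss_reflect_le => // u /=; rewrite !in_itv/= andbT ltrN2 => /ltW.
(* Reflection maps open half-lines to open ones, so the endpoint, of mass zero, is split off
   first. *)
apply: (@le_trans _ _ (Pr gauss (`]-oo, x[ `|` [set x]))).
  apply: Pr_mono => //; first exact: measurableU.
  by move=> u /=; rewrite !in_itv/= le_eqVlt => /orP[/eqP->|ux]; [right|left].
rewrite (le_trans (PrU_le _ _ _))// gauss_set1 addr0.
by apply: gauss_reflect_le => // u /=; rewrite !in_itv/= andbT ltrNl.
Qed.

Lemma tail0 : tail 0 = 1 / 2.
Proof. by have := tailN 0; rewrite oppr0; lra. Qed.

Lemma tail_diff_ge x y M : x <= y -> (forall u, x < u <= y -> `|u| <= M) ->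
  (y - x) * phi M <= tail x - tail y.
Proof. by move=> xy xyM; rewrite -tail_itv//; exact: gauss_itv_ge. Qed.

Lemma tail_diff_le x y : x <= y -> tail x - tail y <= y - x.
Proof. by move=> xy; rewrite -tail_itv//; exact: gauss_itv_le. Qed.

Lemma tail_lt_half h : 0 < h -> tail h < 1 / 2.
Proof.
move=> h0; rewrite -tail0 -subr_gt0.
apply: lt_le_trans (@tail_diff_ge 0 h h _ _); rewrite ?ltW//.
  by rewrite subr0 mulr_gt0// phi_gt0.
by move=> u /andP[u0 uh]; rewrite ger0_norm// ltW.
Qed.

Lemma tail_ge_half h : 0 <= h -> 1 / 2 - h <= tail h.
Proof. by move=> h0; have := tail_diff_le h0; rewrite tail0; lra. Qed.

Lemma phi_le_tail x : 0 <= x -> phi (x + 1) <= tail x.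
Proof.
move=> x0; have x1 : x <= x + 1 by lra.
have := @tail_diff_ge x (x + 1) (x + 1) x1; rewrite [_ - x]addrAC subrr add0r mul1r.
have := tail_ge0 (x + 1) => t0 /(_ _)/le_trans; apply; last by lra.
by move=> u /andP[xu ux]; rewrite ger0_norm//; lra.
Qed.

Lemma tail_gt0 x : 0 < tail x.
Proof.
have [x0|x0] := leP 0 x; first exact: lt_le_trans (phi_gt0 _) (phi_le_tail x0).
by apply: lt_le_trans (tail_anti (ltW x0)); rewrite tail0; lra.
Qed.

(** A shift by [h] moves the half-line to []0, +oo[], where it multiplies the density by at most
    [expR (- (h ^+ 2 / 2))]; the mass of that half-line gives the factor 1/2. *)
Lemma tail_expR h : 0 <= h -> tail h <= 1 / 2 * expR (- (h ^+ 2 / 2)).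
Proof.
move=> h0; rewrite -tail0 [leRHS]mulrC.
apply: (@gauss_transport _ 1 h) => //; rewrite ?oner_eq0 ?expR_ge0//.
move=> u /=; rewrite !in_itv/= !andbT mul1r normr1 mul1r => uh.
have u0 : 0 < u by lra.
split=> //; rewrite (phiE (u + h)) (phiE u) mulrCA ler_wpM2l ?phi_ge0//.
rewrite -expRD ler_expR; nra.
Qed.

Lemma tail_scale l h : 1 <= l -> 0 <= h ->
  tail (l * h) <= l * expR (- ((l ^+ 2 - 1) * h ^+ 2 / 2)) * tail h.
Proof.
move=> l1 h0; have l0 : 0 < l by lra.
apply: (@gauss_transport _ l 0) => //; first by rewrite gt_eqF.
  by rewrite mulr_ge0 ?expR_ge0// ltW.
move=> u /=; rewrite !in_itv/= !andbT addr0 ltr_pM2l// => hu; split=> //.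
rewrite (gtr0_norm l0) -[leRHS]mulrA ler_wpM2l ?(ltW l0)//.
rewrite (phiE (l * u)) (phiE u) mulrCA ler_wpM2l ?phi_ge0//.
rewrite -expRD ler_expR.
have hu2 : h ^+ 2 <= u ^+ 2 by rewrite ler_sqr ?nnegrE; lra.
have l2 : 0 <= l ^+ 2 - 1 by nra.
have := mulr_ge0 l2 (_ : 0 <= u ^+ 2 - h ^+ 2); rewrite subr_ge0 => /(_ hu2).
rewrite exprMn; lra.
Qed.

Lemma tail_ratio l e : 1 < l -> 0 < e ->
  exists2 h0 : R, 0 < h0 & forall h, h0 < h -> tail (l * h) <= e * tail h.
Proof.
move=> l1 e0; have l0 : 0 < l by lra.
have l2 : 0 < l ^+ 2 - 1 by nra.
(* Chosen so that the exponent in [tail_scale] reaches [l / e], after which bounding [expR X] below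
   by [X] suffices. *)
exists (1 + 2 * l / ((l ^+ 2 - 1) * e)).
  by rewrite addr_gt0// divr_gt0 ?mulr_gt0.
move=> h hh; have a0 : 0 < 2 * l / ((l ^+ 2 - 1) * e) by rewrite divr_gt0 ?mulr_gt0.
have h1 : 1 < h by lra.
apply: (le_trans (tail_scale (ltW l1) _)); first lra.
rewrite ler_wpM2r ?tail_ge0// expRN ler_pdivrMr ?expR_gt0//.
set X := (_ / 2).
have X0 : 2 * l / ((l ^+ 2 - 1) * e) * ((l ^+ 2 - 1) / 2) <= X.
  rewrite /X -mulrA [leRHS]mulrAC [leRHS]mulrC mulrA ler_pM2r ?divr_gt0//; nra.
have {}X0 : l / e <= X.
  apply: le_trans X0; rewrite le_eqVlt; apply/orP; left; apply/eqP; field.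
  by rewrite !gt_eqF.
rewrite mulrC -ler_pdivrMr//; apply: (le_trans X0).
by apply: le_trans (expR_ge1Dx X); lra.
Qed.

(** Stretching []0, h]] by [c^-1] multiplies lengths by [c^-1] and can only lower the density. The
    bound is proportional to [1 / 2 - tail h], the factor that has to cancel at small thresholds. *)
Lemma tail_dilation c h : 0 < c -> c <= 1 -> 0 <= h ->
  1 / 2 - tail (h / c) <= c^-1 * (1 / 2 - tail h).
Proof.
move=> c0 c1 h0; rewrite -tail0 -!tail_itv ?divr_ge0 ?(ltW c0)//.
apply: (@gauss_transport _ c^-1 0) => //.
- by rewrite invr_eq0 gt_eqF.
- by rewrite invr_ge0 ltW.
move=> u /=; rewrite !in_itv/= addr0 mulrC => /andP[u1 u2].
have u0 : 0 < u by move: u1; rewrite pmulr_lgt0// invr_gt0.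
split; first by rewrite u0/=; move: u2; rewrite ler_pM2r ?invr_gt0.
rewrite ger0_norm ?invr_ge0 ?(ltW c0)// ler_wpM2l ?invr_ge0 ?(ltW c0)//.
apply: phi_le_abs; rewrite !ger0_norm ?(ltW u0) ?(ltW u1)//.
by rewrite ler_peMr ?(ltW u0)// invf_ge1.
Qed.

End tail.

(** * Half-spaces and boxes *)

Section linear_events.
Context {R : realType}.
Local Notation T := (measurableTypeR R).
Local Notation V := (T * T * T)%type.
Local Notation gauss := (gauss R).
Local Notation gauss3 := (gauss3 R).
Local Notation phi := (@phi R).

Lemma measurable_dot_gt (u : V) (h : R) : measurable [set w : V | h < dot u w].
Proof.
by apply: measurable_lt_set; [exact: measurable_cst|exact: measurable_dot].
Qed.

Lemma dot_gt_tail (u : V) (h : R) : u != 0 ->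
  gauss3 [set w | h < dot u w] = (tail (h / norm3 u))%:E.
Proof.
move=> u0; have n0 : 0 < norm3 u.
  by rewrite /norm3 sqrtr_gt0 lt_neqAle dot_ge0 andbT eq_sym dot_eq0.
rewrite (_ : [set w | _] = dot u @^-1` `]h, +oo[); last first.
  by apply/seteqP; split=> w /=; rewrite in_itv/= andbT.
have E : [set x | `]h, +oo[%classic (norm3 u * x)] = `]h / norm3 u, +oo[%classic.
  by apply/seteqP; split=> x /=; rewrite !in_itv/= !andbT ltr_pdivrMr// mulrC.
by rewrite dot_law// E -PrE.
Qed.

Lemma unit_dot_gt (u : V) (h : R) : dot u u = 1 ->
  gauss3 [set w | h < dot u w] = (tail h)%:E.
Proof.
move=> u1; rewrite dot_gt_tail ?/norm3 ?u1 ?sqrtr1 ?divr1//.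
by rewrite -dot_eq0 u1 oner_eq0.
Qed.

Lemma pair_exceedance (u v : V) (e : R) : dot u u = 1 -> dot v v = 1 ->
  0 <= dot u v < 1 -> 0 < e ->
  exists2 h0 : R, 0 < h0 & forall h, h0 < h ->
    Pr gauss3 [set w | h < dot u w /\ h < dot v w] <= e * tail h.
Proof.
move=> u1 v1 /andP[uv0 uv1] e0.
have duv : dot (u + v) (u + v) = 2 + 2 * dot u v.
  by rewrite dotDl !(dotC _ (u + v)) !dotDl u1 v1 (dotC v u); ring.
have n0 : 0 < norm3 (u + v) by rewrite /norm3 sqrtr_gt0 duv; lra.
have n2 : norm3 (u + v) < 2.
  have nn : norm3 (u + v) ^+ 2 = 2 + 2 * dot u v.
    by rewrite -duv /norm3 sqr_sqrtr// dot_ge0.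
  by rewrite ltNge; apply/negP => n2; nra.
have l1 : 1 < 2 / norm3 (u + v) by rewrite ltr_pdivlMr// mul1r.
have [h0 h00 H] := tail_ratio l1 e0.
exists h0 => // h /H; apply: le_trans.
rewrite mulrAC -lee_fin -dot_gt_tail; last by rewrite -dot_eq0 duv gt_eqF//; lra.
rewrite -PrE; last by apply: measurableI; exact: measurable_dot_gt.
apply: le_measure; rewrite ?inE; [|exact: measurable_dot_gt|].
  by apply: measurableI; exact: measurable_dot_gt.
by move=> w [h1 h2] /=; rewrite dotDl; lra.
Qed.

Lemma gauss_itv_gt0 (x y : R) : x < y -> 0 < Pr gauss `]x, y]%classic.
Proof.
move=> xy; apply: lt_le_trans (@gauss_itv_ge _ x y (`|x| + `|y|) (ltW xy) _).
  by rewrite mulr_gt0 ?subr_gt0// phi_gt0.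
move=> u /andP[xu uy]; have := ler_norm y; have := ler_norm (- x); rewrite normrN => x1 y1.
rewrite ler_norml; apply/andP; split; have := normr_ge0 x; have := normr_ge0 y; lra.
Qed.

Lemma box_mass (x x' y y' z z' : R) (A : set V) : measurable A ->
  (forall w : V, x < w.1.1 <= x' -> y < w.1.2 <= y' -> z < w.2 <= z' -> A w) ->
  Pr gauss `]x, x']%classic * Pr gauss `]y, y']%classic * Pr gauss `]z, z']%classic <=
  Pr gauss3 A.
Proof.
move=> mA HA.
have := @gauss3_box _ `]x, x']%classic `]y, y']%classic `]z, z']%classic.
move=> /(_ (measurable_itv _) (measurable_itv _) (measurable_itv _)) B.
set C := [set w | _] in B.
have mC : measurable C.
  have m (f : V -> T) (a b : R) : measurable_fun setT f -> measurable (f @^-1` `]a, b]).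
    by move=> mf; rewrite -[X in measurable X]setTI; exact: (mf measurableT _ (measurable_itv _)).
  rewrite (_ : C = (fun w : V => w.1.1) @^-1` `]x, x'] `&`
    ((fun w : V => w.1.2) @^-1` `]y, y'] `&` (fun w : V => w.2) @^-1` `]z, z'])).
    by apply: measurableI; [|apply: measurableI]; apply: m => //; exact: measurableT_comp.
  by apply/seteqP; split=> w; [move=> [? ? ?]; split|move=> [? []]; split].
apply: (@le_trans _ _ (Pr gauss3 C)); last first.
  by apply: Pr_mono => // w [] /=; rewrite !in_itv/=; exact: HA.
rewrite -lee_fin -(PrE gauss3 mC) B !EFinM !PrE; try exact: measurable_itv.
exact: lexx.
Qed.

Lemma box_lower (x y z Mx My Mz : R) (A : set V) : measurable A ->
  `|x| + 1 <= Mx -> `|y| + 1 <= My -> `|z| + 1 <= Mz ->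
  (forall w : V, x < w.1.1 <= x + 1 -> y < w.1.2 <= y + 1 -> z < w.2 <= z + 1 -> A w) ->
  phi Mx * phi My * phi Mz <= Pr gauss3 A.
Proof.
move=> mA xM yM zM HA; apply: le_trans (box_mass mA HA).
have itv (a M : R) : `|a| + 1 <= M -> phi M <= Pr gauss `]a, a + 1]%classic.
  move=> aM; have a1 : a <= a + 1 by rewrite lerDl.
  have := @gauss_itv_ge _ a (a + 1) M a1; rewrite [_ - a]addrAC subrr add0r mul1r; apply.
  move=> u /andP[au ua]; apply: le_trans aM; rewrite ler_norml; apply/andP; split.
    by have := ler_norm (- a); rewrite normrN; lra.
  by have := ler_norm a; lra.
by rewrite !ler_pM ?mulr_ge0 ?phi_ge0 ?itv.
Qed.

(** The squared tail is at most of order exp(-h^2), whereas a unit box near h (k1, k2, k3) keeps a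
    mass of exponent |k|^2 h^2 / 2; hence the condition that |k|^2 be below 2. *)
Lemma box_beats_square (k1 k2 k3 C1 C2 C3 : R) :
  0 <= k1 -> 0 <= k2 -> 0 <= k3 -> 0 <= C1 -> 0 <= C2 -> 0 <= C3 ->
  k1 ^+ 2 + k2 ^+ 2 + k3 ^+ 2 < 2 ->
  exists2 h0 : R, 0 < h0 & forall h, h0 < h ->
    2 * tail h ^+ 2 <= phi (k1 * h + C1) * phi (k2 * h + C2) * phi (k3 * h + C3).
Proof.
move=> k10 k20 k30 C10 C20 C30 k2s.
(* [s], [t] and [r] are the coefficients of the ratio exp(s h^2 - t h - r) between the exponential
   part of the box bound and exp(-h^2); [K] absorbs the factor [phi 0 ^+ 3]. *)
pose s := 1 - (k1 ^+ 2 + k2 ^+ 2 + k3 ^+ 2) / 2.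
pose t := k1 * C1 + k2 * C2 + k3 * C3.
pose r := (C1 ^+ 2 + C2 ^+ 2 + C3 ^+ 2) / 2.
pose K := (phi 0 ^+ 3)^-1.
have p0 : 0 < phi 0 by exact: phi_gt0.
have K0 : 0 < K by rewrite invr_gt0 exprn_gt0.
have s0 : 0 < s by rewrite /s; lra.
have t0 : 0 <= t by rewrite !addr_ge0 ?mulr_ge0.
have r0 : 0 <= r by rewrite divr_ge0// !addr_ge0 ?sqr_ge0.
exists (1 + (t + r + K) / s).
  by rewrite addr_gt0// divr_gt0//; lra.
move=> h hh.
have q0 : 0 <= (t + r + K) / s by rewrite divr_ge0 ?(ltW s0)//; lra.
have h1 : 1 < h by lra.
have sh : t + r + K <= s * h.
  by rewrite mulrC -ler_pdivrMr//; lra.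
have y : K <= s * h ^+ 2 - t * h - r.
  have : 0 <= (s * h - t - r - K) * h by rewrite mulr_ge0; lra.
  have : 0 <= (r + K) * (h - 1) by rewrite mulr_ge0; lra.
  lra.
have th := tail_expR (_ : 0 <= h).
apply: (@le_trans _ _ (expR (- h ^+ 2))).
  have {}th : tail h <= 1 / 2 * expR (- (h ^+ 2 / 2)) by apply: th; lra.
  have -> : expR (- h ^+ 2) = expR (- (h ^+ 2 / 2)) ^+ 2.
    by rewrite [RHS]expr2 -expRD; congr expR; field.
  have e0 := expR_gt0 (- (h ^+ 2 / 2)).
  have := tail_ge0 h; nra.
rewrite (phiE (k1 * h + C1)) (phiE (k2 * h + C2)) (phiE (k3 * h + C3)).
set E1 := expR (- ((k1 * h + C1) ^+ 2 / 2)); set E2 := expR (- ((k2 * h + C2) ^+ 2 / 2)); set E3 := expR (- ((k3 * h + C3) ^+ 2 / 2)).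
have -> : phi 0 * E1 * (phi 0 * E2) * (phi 0 * E3) = phi 0 ^+ 3 * (E1 * E2 * E3) by ring.
have -> : E1 * E2 * E3 = expR (- h ^+ 2) * expR (s * h ^+ 2 - t * h - r).
  by rewrite /E1 /E2 /E3 -!expRD; congr expR; rewrite /s /t /r; field.
rewrite mulrCA ler_peMr ?expR_ge0// -ler_pdivrMl ?exprn_gt0// mulr1.
by apply: (le_trans y); apply: le_trans (expR_ge1Dx _); lra.
Qed.

End linear_events.

(** * Three vectors *)

Ltac decide_cell t :=
  apply/seteqP; split=> t /=;
  repeat match goal with |- context [?Y ?i t] =>
    match type of (Y i t) with bool => case: (Y i t) end end;
  move=> ?;
  repeat match goal with
  | H : and3 _ _ _ |- _ => destruct H
  | H : _ /\ _ |- _ => destruct H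
  | H : _ = _ :> bool |- _ => discriminate H
  | H : is_true false |- _ => discriminate H
  | H : ~ is_true true |- _ => case: (H isT)
  | |- and3 _ _ _ => split
  | |- _ /\ _ => split
  | |- ~ _ => move=> ?
  end; try done.

Section triple_cells.
Context d (T : measurableType d) {R : realType} (P : probability T R).
Variable Y : 'I_3 -> T -> bool.
Hypothesis mY : forall i, measurable [set t | Y i t].
Local Notation Pr := (Pr P).

Definition i0 : 'I_3 := @Ordinal 3 0 isT.
Definition i1 : 'I_3 := @Ordinal 3 1 isT.
Definition i2 : 'I_3 := @Ordinal 3 2 isT.

Definition cell b0 b1 b2 : R := Pr (pattern Y (pat3 b0 b1 b2)).

Lemma pattern_pat3 b0 b1 b2 : pattern Y (pat3 b0 b1 b2) =
  [set t | [/\ Y i0 t = b0, Y i1 t = b1 & Y i2 t = b2]].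
Proof.
apply/seteqP; split=> t /=.
  by move=> h; split; [have := h i0|have := h i1|have := h i2]; rewrite ffunE.
move=> [h0 h1 h2] [[|[|[|//]]] lt]; rewrite ffunE/=.
- by rewrite -h0; congr (Y _ t); exact/val_inj.
- by rewrite -h1; congr (Y _ t); exact/val_inj.
- by rewrite -h2; congr (Y _ t); exact/val_inj.
Qed.

Let mI i j : measurable [set t | Y i t /\ Y j t].
Proof. by apply: measurableI; exact: mY. Qed.

Lemma pair_cells :
  [/\ Pr [set t | Y i0 t /\ Y i1 t] = cell true true true + cell true true false,
      Pr [set t | Y i0 t /\ Y i2 t] = cell true true true + cell true false true &
      Pr [set t | Y i1 t /\ Y i2 t] = cell true true true + cell false true true].
Proof.
split.
- rewrite (Pr_split P (mI _ _) (mY i2)) /cell !pattern_pat3; congr (Pr _ + Pr _);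
    decide_cell t.
- rewrite (Pr_split P (mI _ _) (mY i1)) /cell !pattern_pat3; congr (Pr _ + Pr _);
    decide_cell t.
- rewrite (Pr_split P (mI _ _) (mY i0)) /cell !pattern_pat3; congr (Pr _ + Pr _);
    decide_cell t.
Qed.

Lemma single_cells :
  [/\ Pr [set t | Y i0 t] = cell true true true + cell true true false +
        cell true false true + cell true false false,
      Pr [set t | Y i1 t] = cell true true true + cell true true false +
        cell false true true + cell false true false &
      Pr [set t | Y i2 t] = cell true true true + cell true false true +
        cell false true true + cell false false true].
Proof.
have [p01 p02 p12] := pair_cells.
have mC i j : measurable ([set t | Y i t] `&` ~` [set t | Y j t]).
  by apply: measurableI; [exact: mY|apply: measurableC; exact: mY].
split.
- rewrite (Pr_split P (mY i0) (mY i1)) p01 -!addrA; congr (_ + (_ + _)).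
  rewrite (Pr_split P (mC _ _) (mY i2)) /cell !pattern_pat3; congr (Pr _ + Pr _);
    decide_cell t.
- rewrite (Pr_split P (mY i1) (mY i0)) [X in Pr X + _]setIC p01 -!addrA; congr (_ + (_ + _)).
  rewrite (Pr_split P (mC _ _) (mY i2)) /cell !pattern_pat3; congr (Pr _ + Pr _);
    decide_cell t.
- rewrite (Pr_split P (mY i2) (mY i0)) [X in Pr X + _]setIC p02 -!addrA; congr (_ + (_ + _)).
  rewrite (Pr_split P (mC _ _) (mY i1)) /cell !pattern_pat3; congr (Pr _ + Pr _);
    decide_cell t.
Qed.

Lemma total_cells : cell true true true + cell true true false +
    cell true false true + cell true false false + cell false true true +
    cell false true false + cell false false true + cell false false false = 1.
Proof.
have [p0 _ _] := single_cells.
have mC : measurable (~` [set t | Y i0 t]) by apply: measurableC; exact: mY.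
have mCC : measurable (~` [set t | Y i0 t] `&` ~` [set t | Y i1 t]).
  by apply: measurableI => //; apply: measurableC; exact: mY.
have mCI : measurable (~` [set t | Y i0 t] `&` [set t | Y i1 t]).
  by apply: measurableI => //; exact: mY.
have := PrC P (mY i0).
rewrite (Pr_split P mC (mY i1)) (Pr_split P mCI (mY i2)) (Pr_split P mCC (mY i2)).
have -> : Pr (~` [set t | Y i0 t] `&` [set t | Y i1 t] `&` [set t | Y i2 t]) = cell false true true.
  by rewrite /cell pattern_pat3; congr Pr; decide_cell t.
have -> : Pr (~` [set t | Y i0 t] `&` [set t | Y i1 t] `&` ~` [set t | Y i2 t]) = cell false true false.
  by rewrite /cell pattern_pat3; congr Pr; decide_cell t.
have -> : Pr (~` [set t | Y i0 t] `&` ~` [set t | Y i1 t] `&` [set t | Y i2 t]) = cell false false true.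
  by rewrite /cell pattern_pat3; congr Pr; decide_cell t.
have -> : Pr (~` [set t | Y i0 t] `&` ~` [set t | Y i1 t] `&` ~` [set t | Y i2 t]) = cell false false false.
  by rewrite /cell pattern_pat3; congr Pr; decide_cell t.
rewrite p0; lra.
Qed.

(** Every cell with one exceedance has mass at most [p], and [1 - p > 1 / 2], so cells of mass at
    least 2 p^2 settle the three pair inequalities; the bound on the sum of the pair probabilities,
    with the cell 111, supplies the other two. *)
Lemma color_of_rare_triple (p : R) : 0 < p < 1 / 2 ->
  (forall i, Pr [set t | Y i t] = p) ->
  Pr [set t | Y i0 t /\ Y i1 t] + Pr [set t | Y i0 t /\ Y i2 t] +
    Pr [set t | Y i1 t /\ Y i2 t] <= p ->
  2 * p ^+ 2 <= cell true true true -> 2 * p ^+ 2 <= cell true true false ->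
  2 * p ^+ 2 <= cell true false true -> 2 * p ^+ 2 <= cell false true true ->
  color_process P Y.
Proof.
move=> p012 Yp; have [s0 s1 s2] := single_cells; have [-> -> ->] := pair_cells.
rewrite !Yp in s0 s1 s2; have tot := total_cells => pairs c111 c110 c101 c011.
have [p0 p12] : 0 < p /\ p < 1 / 2 by apply/andP.
have g b0 b1 b2 : 0 <= cell b0 b1 b2 by exact: Pr_ge0.
have g0 := g true false false; have g1 := g false true false; have g2 := g false false true.
have gt := g true true true.
have g3 := g true true false; have g4 := g true false true; have g5 := g false true true.
apply: (@color_of_triple _ _ _ P Y p cell) => //; try lra.
- by move=> b0 b1 b2; rewrite PrE//; exact: measurable_pattern.
- have : cell false true false <= p by lra.
  nra.
- have : cell true false false <= p by lra.
  nra.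
- have : cell false false true <= p by lra.
  nra.
- nra.
Qed.

End triple_cells.

Section fan.
Context {R : realType}.
Local Notation T := (measurableTypeR R).
Local Notation V := (T * T * T)%type.
Local Notation gauss := (gauss R).
Local Notation gauss3 := (gauss3 R).
Local Notation phi := (@phi R).
Variables c b c' b' : R.

(* X_0 and X_2 are symmetric about the axis g = w.1.2, and X_1 lies in the
   orthogonal plane through that axis: X_0 = c g + b z_1, X_1 = c' g + b' z_2,
   X_2 = c g - b z_1. *)
Definition fan (i : 'I_3) : V :=
  nth (0 : V) [:: ((b, c), 0); ((0, c'), b'); ((- b, c), 0)] i.

Definition exceeds (h : R) (i : 'I_3) (w : V) : bool := h < dot (fan i) w.

Hypothesis cb : c ^+ 2 + b ^+ 2 = 1.
Hypothesis cb' : c' ^+ 2 + b' ^+ 2 = 1.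
Hypothesis b0 : 0 < b.
Hypothesis bc : b < c.
Hypothesis c'0 : 0 < c'.
Hypothesis cc'1 : c * c' < 1.

Lemma fan_unit i : dot (fan i) (fan i) = 1.
Proof.
case: i => -[|[|[|//]]] lt; rewrite /fan /dot/= ?mulr0 ?mul0r ?mulrNN ?add0r ?addr0 -!expr2.
- by rewrite addrC.
- by [].
- by rewrite addrC.
Qed.

Lemma fan_inj : injective fan.
Proof.
move=> i j /(congr1 (fun u : V => u.1.1)).
by case: i j => -[|[|[|//]]] lt [[|[|[|//]]] lt'] /= e; apply/val_inj => //=;
  exfalso; move: b0; rewrite /= in e; lra.
Qed.

Lemma fan_dot : [/\ dot (fan i0) (fan i1) = c * c',
  dot (fan i0) (fan i2) = c ^+ 2 - b ^+ 2 & dot (fan i1) (fan i2) = c * c'].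
Proof. by split; rewrite /fan /dot/=; ring. Qed.

Lemma fan_correlations i j : 0 <= dot (fan i) (fan j).
Proof.
have [d01 d02 d12] := fan_dot.
have c0 : 0 < c := lt_trans b0 bc.
have p1 : 0 <= c * c' by rewrite mulr_ge0// ltW.
have p2 : 0 <= c ^+ 2 - b ^+ 2 by rewrite subr_sqr; apply: mulr_ge0; move: b0 bc; lra.
case: i j => -[|[|[|//]]] lt [[|[|[|//]]] lt'];
  rewrite /fan /dot/=; move: cb cb' p1 p2; lra.
Qed.

Definition fan_vector : gaussianVector R := linear_gaussian fan_unit fan_inj.

Lemma fan_nonneg : nonneg_correlations fan_vector.
Proof. by apply: linear_gaussian_correlations; exact: fan_correlations. Qed.

Lemma fan_colorE h : threshold_color fan_vector h = color_process gauss3 (exceeds h).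
Proof. by []. Qed.

Lemma measurable_exceeds h i : measurable [set w | exceeds h i w].
Proof. exact: measurable_dot_gt. Qed.

Lemma exceeds_prob h i : Pr gauss3 [set w | exceeds h i w] = tail h.
Proof. by rewrite /Pr (unit_dot_gt h (fan_unit i)). Qed.

Lemma dot_fan w : [/\ dot (fan i0) w = b * w.1.1 + c * w.1.2,
  dot (fan i1) w = c' * w.1.2 + b' * w.2 & dot (fan i2) w = - b * w.1.1 + c * w.1.2].
Proof. by split; rewrite /fan /dot/= ?mul0r ?addr0 ?add0r. Qed.

Local Notation C h := (cell gauss3 (exceeds h)).

Lemma fan_not_color h : 0 < h ->
  C h true false true * (1 - tail h) < C h false true false * tail h ->
  ~ threshold_color fan_vector h.
Proof.
move=> h0 lt; rewrite fan_colorE => col.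
have ltT := tail_lt_half h0.
have Y0 : gauss3 [set w | exceeds h ord0 w] = (tail h)%:E.
  exact: unit_dot_gt (fan_unit _).
have := color_triple_le (measurable_exceeds h) Y0 (ltW ltT) col.
have mP y := measurable_pattern (measurable_exceeds h) y.
by rewrite (PrE gauss3 (mP _)) (PrE gauss3 (mP (pat3 true false true))) -!EFinM lee_fin leNgt lt.
Qed.

Lemma fan_cellE h e0 e1 e2 : C h e0 e1 e2 = Pr gauss3
  [set w | [/\ (h < b * w.1.1 + c * w.1.2) = e0, (h < c' * w.1.2 + b' * w.2) = e1 &
    (h < - b * w.1.1 + c * w.1.2) = e2]].
Proof.
rewrite /cell pattern_pat3; congr Pr; apply/seteqP; split=> w /=;
  by rewrite /exceeds; have [-> -> ->] := dot_fan w.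
Qed.

Lemma measurable_fan_cell h e0 e1 e2 : measurable
  [set w : V | [/\ (h < b * w.1.1 + c * w.1.2) = e0, (h < c' * w.1.2 + b' * w.2) = e1 &
    (h < - b * w.1.1 + c * w.1.2) = e2]].
Proof.
rewrite [X in measurable X](_ : _ = pattern (exceeds h) (pat3 e0 e1 e2)).
  exact: measurable_pattern (measurable_exceeds h) _.
rewrite pattern_pat3; apply/seteqP; split=> w /=;
  by rewrite /exceeds; have [-> -> ->] := dot_fan w.
Qed.

Lemma fan_color_large :
  (exists2 h0 : R, 0 < h0 & forall h, h0 < h ->
    [/\ 2 * tail h ^+ 2 <= C h true true true, 2 * tail h ^+ 2 <= C h true true false,
      2 * tail h ^+ 2 <= C h true false true & 2 * tail h ^+ 2 <= C h false true true]) ->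
  for_large (fun h => threshold_color fan_vector h).
Proof.
move=> [h0 h00 H]; have [d01 d02 d12] := fan_dot.
have c0 : 0 < c := lt_trans b0 bc.
have r01 : 0 <= dot (fan i0) (fan i1) < 1 by rewrite d01 cc'1 mulr_ge0// ltW.
have r12 : 0 <= dot (fan i1) (fan i2) < 1 by rewrite d12 cc'1 mulr_ge0// ltW.
have r02 : 0 <= dot (fan i0) (fan i2) < 1.
  rewrite fan_correlations/= d02; have := exprn_gt0 2 b0; move: cb; lra.
(* Three pairs at a third of [tail h] each keep their sum below [tail h]. *)
have e3 : 0 < 1 / 3 :> R by lra.
have [k1 k10 K1] := pair_exceedance (fan_unit i0) (fan_unit i1) r01 e3.
have [k2 k20 K2] := pair_exceedance (fan_unit i0) (fan_unit i2) r02 e3.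
have [k3 k30 K3] := pair_exceedance (fan_unit i1) (fan_unit i2) r12 e3.
exists (h0 + k1 + k2 + k3); first by rewrite !addr_gt0.
move=> h hh; rewrite fan_colorE.
have h_gt0 : 0 < h by lra.
have [c1 c2 c3 c4] : [/\ 2 * tail h ^+ 2 <= C h true true true, 2 * tail h ^+ 2 <= C h true true false,
      2 * tail h ^+ 2 <= C h true false true & 2 * tail h ^+ 2 <= C h false true true].
  by apply: H; lra.
apply: (color_of_rare_triple (measurable_exceeds h) (p := tail h)) => //.
- by rewrite tail_gt0 tail_lt_half.
- by move=> i; exact: exceeds_prob.
have hk1 : k1 < h by lra.
have hk2 : k2 < h by lra.
have hk3 : k3 < h by lra.
by have := K1 h hk1; have := K2 h hk2; have := K3 h hk3; rewrite /exceeds; lra.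
Qed.

End fan.

Section coplanar.
Context {R : realType}.
Local Notation T := (measurableTypeR R).
Local Notation V := (T * T * T)%type.
Local Notation gauss := (gauss R).
Local Notation gauss3 := (gauss3 R).

Lemma coplanar_vector_never_color : exists X : gaussianVector R,
  nonneg_correlations X /\ forall h, 0 < h -> ~ threshold_color X h.
Proof.
have cb : (4 / 5) ^+ 2 + (3 / 5) ^+ 2 = 1 :> R by field.
have cb' : 1 ^+ 2 + 0 ^+ 2 = 1 :> R by ring.
have b0 : 0 < 3 / 5 :> R by lra.
have bc : 3 / 5 < 4 / 5 :> R by lra.
exists (fan_vector cb cb' b0); split.
  by apply: fan_nonneg => //; exact: ltr01.
move=> h h0; apply: fan_not_color => //.
(* With c' = 1, X_1 is a positive multiple of X_0 + X_2 and exceeds h whenever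
   X_0 and X_2 do. *)
rewrite !fan_cellE [X in Pr gauss3 X * (1 - _)](_ : _ = set0); last first.
  apply/seteqP; split=> w //= [h1 h2 h3]; move: h2 => /negbT; rewrite -leNgt; move: h1 h3; lra.
rewrite Pr0 mul0r mulr_gt0 ?tail_gt0//.
have m := @measurable_fan_cell R (4 / 5) (3 / 5) 1 0 h false true false.
(* In this box X_1 = g lies just above h, while X_0 and X_2 are at most 37/40 h. *)
apply: lt_le_trans (@box_mass R 0 (h / 8) h (17 / 16 * h) 0 1 _ m _).
  by rewrite !mulr_gt0// gauss_itv_gt0//; lra.
by move=> w /andP[a1 a2] /andP[g1 g2] _; split; [apply/negbTE; rewrite -leNgt; lra|lra|apply/negbTE; rewrite -leNgt; lra].
Qed.

End coplanar.

(** * The acute fan at large thresholds *)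

Section acute_fan.
Context {R : realType}.
Local Notation T := (measurableTypeR R).
Local Notation V := (T * T * T)%type.
Local Notation gauss := (gauss R).
Local Notation gauss3 := (gauss3 R).
Local Notation phi := (@phi R).

(* The triples (3, 4, 5) and (12, 35, 37) keep all coordinates rational. *)
Lemma fan_cb : (4 / 5) ^+ 2 + (3 / 5) ^+ 2 = 1 :> R. Proof. by field. Qed.
Lemma fan_cb' : (35 / 37) ^+ 2 + (12 / 37) ^+ 2 = 1 :> R. Proof. by field. Qed.
Lemma fan_b0 : 0 < 3 / 5 :> R. Proof. lra. Qed.

Local Notation C h := (cell gauss3 (exceeds (4 / 5) (3 / 5) (35 / 37) (12 / 37) h)).

(** The slopes locate boundary points of the cells: h (0, 5/4, 0) lies on X_0 = X_2 = h, h (9/35,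
    37/35, 0) on X_0 = X_1 = h, and h (0, 5/4, -9/16) on all three planes. Their squared norms
    25/16, 1450/1225 and 481/256 (over h^2) are below 2, and the additive constants push a unit box
    into the cell. The cell 011 mirrors 110. *)
Lemma acute_fan_cells : exists2 h0 : R, 0 < h0 & forall h, h0 < h ->
  [/\ 2 * tail h ^+ 2 <= C h true true true, 2 * tail h ^+ 2 <= C h true true false,
    2 * tail h ^+ 2 <= C h true false true & 2 * tail h ^+ 2 <= C h false true true].
Proof.
have [k1 k10 K1] := @box_beats_square R 0 (5 / 4) 0 1 (7 / 4) 1
  ltac:(lra) ltac:(lra) ltac:(lra) ltac:(lra) ltac:(lra) ltac:(lra) ltac:(lra).
have [k2 k20 K2] := @box_beats_square R (9 / 35) (37 / 35) 0 (10 / 3) 1 1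
  ltac:(lra) ltac:(lra) ltac:(lra) ltac:(lra) ltac:(lra) ltac:(lra) ltac:(lra).
have [k3 k30 K3] := @box_beats_square R 0 (5 / 4) (9 / 16) 1 (7 / 4) (341 / 48)
  ltac:(lra) ltac:(lra) ltac:(lra) ltac:(lra) ltac:(lra) ltac:(lra) ltac:(lra).
exists (k1 + k2 + k3); first by rewrite !addr_gt0.
move=> h hh; have h0 : 0 < h by lra.
have m e0 e1 e2 := @measurable_fan_cell R (4 / 5) (3 / 5) (35 / 37) (12 / 37) h e0 e1 e2.
have F (P : bool) : ~~ P -> P = false by move/negbTE.
rewrite !fan_cellE; split.
- apply: (le_trans (K1 h _)); first lra.
  apply: (@box_lower R 0 (5 / 4 * h + 3 / 4) 0) => //; rewrite ?normr0 ?ger0_norm; try lra.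
  by move=> {K1 K2 K3 m k10 k20 k30 hh} w /andP[a1 a2] /andP[g1 g2] /andP[z1 z2]; split; lra.
- apply: (le_trans (K2 h _)); first lra.
  apply: (@box_lower R (9 / 35 * h + 4 / 3) (37 / 35 * h) 0) => //; rewrite ?normr0 ?ger0_norm; try lra.
  by move=> {K1 K2 K3 m k10 k20 k30 hh} w /andP[a1 a2] /andP[g1 g2] /andP[z1 z2]; split; [lra|lra|apply: F; rewrite -leNgt; lra].
- apply: (le_trans (K3 h _)); first lra.
  apply: (@box_lower R 0 (5 / 4 * h + 3 / 4) (- (9 / 16 * h + 293 / 48))) => //;
    rewrite ?normr0 ?normrN ?ger0_norm; try lra.
  by move=> {K1 K2 K3 m k10 k20 k30 hh} w /andP[a1 a2] /andP[g1 g2] /andP[z1 z2]; split; [lra|apply: F; rewrite -leNgt; lra|lra].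
- apply: (le_trans (K2 h _)); first lra.
  apply: (@box_lower R (- (9 / 35 * h + 7 / 3)) (37 / 35 * h) 0) => //; rewrite ?normr0 ?normrN ?ger0_norm; try lra.
  by move=> {K1 K2 K3 m k10 k20 k30 hh} w /andP[a1 a2] /andP[g1 g2] /andP[z1 z2]; split; [apply: F; rewrite -leNgt; lra|lra|lra].
Qed.

End acute_fan.

(** * Masses of planar sectors and solid cones *)

Section sectors.
Context {R : realType}.
Local Notation mu := (@lebesgue_measure R).
Local Notation T := (measurableTypeR R).
Local Notation V := (T * T * T)%type.
Local Notation gauss := (gauss R).
Local Notation gauss2 := (gauss2 R).
Local Notation gauss3 := (gauss3 R).
Local Notation phi := (@phi R).

Lemma gauss_abs_lt (a : R) : 0 <= a -> Pr gauss [set x | `|x| < a] <= 2 * a * phi 0.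
Proof.
move=> a0; have aa : - a <= a by lra.
apply: le_trans (le_trans (gauss_itv_le_phi0 aa) _); last by rewrite opprK; lra.
apply: Pr_mono => //.
  by apply: measurable_lt_set => //; exact: measurableT_comp.
by move=> x /=; rewrite in_itv/= ltr_norml => /andP[-> /ltW].
Qed.

Lemma measurable_abs_lt (k : R) : measurable [set z : T * T | `|z.1| < k * z.2].
Proof.
by apply: measurable_lt_set; [apply: measurableT_comp|apply: measurable_funM].
Qed.

(** Every vertical section is an interval of length [l], and the Gaussian density is at most 1. *)
Lemma gauss2_strip (f : T -> R) (l : R) : measurable_fun setT f -> 0 <= l ->
  Pr gauss2 [set z : T * T | f z.1 < z.2 <= f z.1 + l] <= l.
Proof.
move=> mf l0; set C := [set z | _].
have mC : measurable C.
  rewrite (_ : C = [set z | f z.1 < z.2] `&` [set z | z.2 <= f z.1 + l]); last first.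
    by apply/seteqP; split=> z /=; [move/andP=> []|move=> [? ?]; apply/andP].
  have mf1 : measurable_fun setT (fun z : T * T => f z.1) by exact: measurableT_comp.
  apply: measurableI; [apply: measurable_lt_set|apply: measurable_le_set] => //.
  exact: measurable_funD.
rewrite -lee_fin -PrE// gauss2_xsection.
apply: (@le_trans _ _ (\int[gauss]_x l%:E)%E); last first.
  by rewrite integral_cst//= -[X in (_ * X)%E]/(gauss setT) probability_setT mule1.
apply: ge0_le_integral => //=.
  exact: measurable_fun_xsection.
move=> x _; have fl : f x <= f x + l by lra.
have := gauss_itv_le fl; rewrite addrAC subrr add0r -lee_fin -PrE//.
apply: le_trans; apply: le_measure; rewrite ?inE//; first exact: measurable_xsection.
by move=> y; rewrite /xsection/= inE in_itv.
Qed.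

Lemma gauss2_swap (C : set (T * T)) : measurable C ->
  gauss2 C = gauss2 [set z | C (- z.2, z.1)].
Proof.
move=> mC; have e : (0 : R) ^+ 2 + (-1) ^+ 2 = 1 by ring.
rewrite -(gauss2_rot e mC); congr (gauss2 _); apply/seteqP; split=> z /=;
  by rewrite /rot !mul0r add0r addr0 mulN1r opprK mul1r.
Qed.

(** At height x the region between the sectors consists of two intervals of length (k2 - k1) x on
    which the density is at least [phi (k2 * x)]; the integral over x is then explicit. The swap of
    coordinates makes the height the variable held fixed. *)
Lemma gauss2_wedge (k1 k2 : R) : 0 < k1 -> k1 <= k2 ->
  Pr gauss2 [set z | `|z.1| < k1 * z.2] + 2 * (k2 - k1) * phi 0 ^+ 2 / (1 + k2 ^+ 2) <=
  Pr gauss2 [set z | `|z.1| < k2 * z.2].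
Proof.
move=> k1_gt0 k12; have k10 := ltW k1_gt0; have k20 := le_trans k10 k12.
pose W : set (T * T) := [set z | 0 < z.2] `&` ([set z | k1 * z.2 <= `|z.1|] `&` [set z | `|z.1| < k2 * z.2]).
have mW : measurable W.
  apply: measurableI; last (apply: measurableI; last exact: measurable_abs_lt).
    exact: measurable_lt_set.
  by apply: measurable_le_set; [apply: measurable_funM|apply: measurableT_comp].
have m1 := measurable_abs_lt k1; have m2 := measurable_abs_lt k2.
have pos (z : T * T) k : 0 <= k -> `|z.1| < k * z.2 -> 0 < z.2.
  move=> k0 zk; have kz : 0 < k * z.2 by apply: le_lt_trans zk.
  by move: k0; rewrite le_eqVlt => /orP[/eqP k0|k0]; move: kz; rewrite -?k0 ?mul0r ?ltxx// pmulr_rgt0.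
apply: (@le_trans _ _ (Pr gauss2 [set z | `|z.1| < k1 * z.2] + Pr gauss2 W)); last first.
  rewrite -PrU//; last by move=> z /= z1 [_ [/= z2 _]]; move: z1; rewrite ltNge z2.
  apply: Pr_mono => //; first exact: measurableU.
  move=> z [/= z1|[_ []//]]; apply: (lt_le_trans z1).
  by rewrite ler_wpM2r// ltW// (pos _ _ k10).
rewrite lerD2l; rewrite -lee_fin -PrE// gauss2_swap// gauss2_xsection.
set C := [set z | _].
have mC : measurable C.
  have mf : measurable_fun setT (fun z : T * T => (- z.2, z.1)).
    by apply: measurable_fun_pair => //; exact: measurableT_comp.
  by rewrite -[X in measurable X]setTI; exact: (mf measurableT _ mW).
have ms := measurable_fun_xsection gauss mC.
rewrite ge0_integral_gauss//.
have K0 : 0 < 1 + k2 ^+ 2 by rewrite ltr_wpDr ?sqr_ge0.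
have cst0 : 0 <= 2 * (k2 - k1) * phi 0 ^+ 2 by rewrite mulr_ge0 ?sqr_ge0// mulr_ge0// subr_ge0.
have := integral_expR_sqr K0 (lexx 0).
rewrite expr0n/= mulr0 mul0r oppr0 expR0 mulr1 => I.
rewrite [leLHS]EFinM -I -ge0_integralZl//; last 2 first.
- apply/measurable_EFinP/measurable_funTS; apply: measurable_funM => //.
  apply: measurableT_comp => //; apply: measurableT_comp => //.
  by apply: measurable_funM => //; apply: measurable_funM.
- by move=> x /=; rewrite in_itv/= andbT => x0; rewrite lee_fin mulr_ge0 ?expR_ge0.
rewrite integral_mkcond; apply: ge0_le_integral => //=.
- move=> x _; rewrite patchE; case: ifPn => //; rewrite inE/= in_itv/= andbT => x0.
  by rewrite -EFinM lee_fin mulr_ge0// mulr_ge0 ?expR_ge0.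
- apply/(measurable_restrictT _ _).1 => //.
  apply/measurable_EFinP; apply: measurable_funM => //; apply/measurable_funTS; apply: measurable_funM => //.
  apply: measurableT_comp => //; apply: measurableT_comp => //.
  by apply: measurable_funM => //; apply: measurable_funM.
- apply: emeasurable_funM => //.
  by apply/measurable_EFinP; exact: measurable_phi.
move=> x _; rewrite patchE; case: ifPn; last by rewrite mule_ge0// lee_fin phi_ge0.
rewrite inE/= in_itv/= andbT => x0.
have mS : measurable (xsection C x) by exact: measurable_xsection.
rewrite PrE// -!EFinM lee_fin.
have -> : 2 * (k2 - k1) * phi 0 ^+ 2 * (x * expR (- ((1 + k2 ^+ 2) * x ^+ 2 / 2))) =
    (2 * ((k2 * x - k1 * x) * phi (k2 * x))) * phi x.
  rewrite (phiE (k2 * x)) (phiE x).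
  have -> : - ((1 + k2 ^+ 2) * x ^+ 2 / 2) = - ((k2 * x) ^+ 2 / 2) + - (x ^+ 2 / 2) by field.
  by rewrite expRD; ring.
rewrite ler_wpM2r ?phi_ge0//.
have kx : k1 * x <= k2 * x by rewrite ler_wpM2r.
have kx0 : 0 <= k1 * x by rewrite mulr_ge0.
have J : (k2 * x - k1 * x) * phi (k2 * x) <= Pr gauss `]- (k2 * x), - (k1 * x)]%classic.
  have := @gauss_itv_ge _ (- (k2 * x)) (- (k1 * x)) (k2 * x).
  rewrite lerN2 opprK addrC; apply=> // u /andP[u1 u2].
  by rewrite ler_norml; apply/andP; split; lra.
have J' : Pr gauss `]- (k2 * x), - (k1 * x)]%classic <= Pr gauss `[k1 * x, k2 * x[%classic.
  by apply: gauss_reflect_le => // u /=; rewrite !in_itv/=; lra.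
move: x0; rewrite le_eqVlt => /orP[/eqP<-|x0].
  by rewrite !mulr0 subrr mul0r mulr0 Pr_ge0.
apply: (@le_trans _ _ (Pr gauss (`]- (k2 * x), - (k1 * x)] `|` `[k1 * x, k2 * x[))).
  have kx_gt0 : 0 < k1 * x by rewrite mulr_gt0.
  rewrite PrU//; first lra.
  by move=> u /=; rewrite !in_itv/= => /andP[_ u1] /andP[u2 _]; lra.
apply: Pr_mono => //; first exact: measurableU.
move=> u /= uu; rewrite /xsection/= inE; split=> //=; rewrite normrN.
case: uu; rewrite in_itv/= => /andP[u1 u2].
  by rewrite ler0_norm; [split|]; move: u1 u2 kx kx0; clear; lra.
by rewrite ger0_norm; [split|]; move: u1 u2 kx kx0; clear; lra.
Qed.

End sectors.

Section cones.
Context {R : realType}.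
Local Notation mu := (@lebesgue_measure R).
Local Notation T := (measurableTypeR R).
Local Notation V := (T * T * T)%type.
Local Notation gauss := (gauss R).
Local Notation gauss2 := (gauss2 R).
Local Notation gauss3 := (gauss3 R).
Local Notation phi := (@phi R).

(** The exact value is [phi 0 - phi a], and 1 - exp(-x) is at most x. *)
Lemma integral_id_phi_le (a : R) : 0 <= a ->
  (\int[mu]_(x in `[0%R, a[) (x * phi x)%:E <= (phi 0 * a ^+ 2 / 2)%:E)%E.
Proof.
move=> a0; have mf : measurable_fun setT (fun x : T => (x * phi x)%:E).
  apply/measurable_EFinP; apply: measurable_funM => //; exact: measurable_phi.
have : (\int[mu]_(x in `[0%R, a[ `|` `[a, +oo[) (x * phi x)%:E = (phi 0)%:E)%E.
  by rewrite -itv_bndbnd_setU ?bnd_simp//; exact: integral_id_phi (lexx 0).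
rewrite ge0_integral_setU//; last 3 first.
- exact: measurable_funTS.
- move=> x xx; have x0 : 0 <= x.
    by case: xx => /=; rewrite in_itv/=; [case/andP|rewrite andbT; exact: le_trans].
  by rewrite lee_fin mulr_ge0 ?phi_ge0.
- rewrite disj_set2E; apply/eqP/seteqP; split=> x //= [].
  by rewrite !in_itv/= andbT => /andP[_ xa]; rewrite leNgt xa.
rewrite integral_id_phi// => E.
have -> : (\int[mu]_(x in `[0%R, a[) (x * phi x)%:E = (phi 0 - phi a)%:E)%E.
  by rewrite EFinB -E addeK.
rewrite lee_fin (phiE a) -[X in X - _]mulr1 -mulrBr -mulrA ler_wpM2l ?phi_ge0//.
by have := expR_ge1Dx (- (a ^+ 2 / 2)); lra.
Qed.

Lemma gauss2_triangle (k a : R) : 0 <= k -> 0 <= a ->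
  Pr gauss2 [set z | 0 < z.1 < a /\ `|z.2| < k * z.1] <= k * phi 0 ^+ 2 * a ^+ 2.
Proof.
move=> k0 a0; set C := [set z | _].
have mC : measurable C.
  rewrite (_ : C = [set z | 0 < z.1] `&` ([set z | z.1 < a] `&` [set z | `|z.2| < k * z.1])).
    apply: measurableI; first exact: measurable_lt_set.
    apply: measurableI; first exact: measurable_lt_set.
    apply: measurable_lt_set; [exact: measurableT_comp|exact: measurable_funM].
  by apply/seteqP; split=> z /=; [move=> [/andP[]]|move=> [? [? ?]]; split=> //; apply/andP].
rewrite -lee_fin -PrE// gauss2_xsection.
have ms := measurable_fun_xsection gauss mC.
rewrite ge0_integral_gauss//.
have K0 : 0 <= 2 * k * phi 0 by rewrite !mulr_ge0 ?phi_ge0.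
have mf : measurable_fun setT (fun x : T => (x * phi x)%:E).
  apply/measurable_EFinP; apply: measurable_funM => //; exact: measurable_phi.
apply: (@le_trans _ _ ((2 * k * phi 0)%:E * \int[mu]_(x in `[0%R, a[) (x * phi x)%:E)%E); last first.
  apply: (@le_trans _ _ ((2 * k * phi 0)%:E * (phi 0 * a ^+ 2 / 2)%:E)%E).
    by rewrite lee_wpmul2l ?lee_fin// integral_id_phi_le.
  by rewrite -EFinM lee_fin; lra.
have f0 (x : T) : `[0, a[%classic x -> (0 <= (x * phi x)%:E)%E.
  by rewrite /= in_itv/= => /andP[x0 _]; rewrite lee_fin mulr_ge0 ?phi_ge0.
rewrite -ge0_integralZl//; last exact: measurable_funTS.
rewrite integral_mkcond; apply: ge0_le_integral => //=.
- by move=> x _; rewrite mule_ge0// lee_fin phi_ge0.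
- apply: emeasurable_funM => //; apply/measurable_EFinP; exact: measurable_phi.
- apply/(measurable_restrictT _ _).1 => //.
  by apply: emeasurable_funM => //; exact: measurable_funTS.
move=> x _; rewrite patchE; case: ifPn => xa; last first.
  rewrite (_ : xsection C x = set0) ?measure0 ?mul0e//.
  apply/seteqP; split=> y //; rewrite /xsection/= inE => -[/= /andP[x0 xa'] _].
  by move: xa; rewrite notin_setE/= in_itv/= xa' ltW.
have x0 : 0 <= x by move: xa; rewrite inE/= in_itv/= => /andP[].
have mS : measurable (xsection C x) by exact: measurable_xsection.
rewrite PrE// -!EFinM lee_fin mulrA ler_wpM2r ?phi_ge0//.
have kx : 0 <= k * x by rewrite mulr_ge0.
have -> : 2 * k * phi 0 * x = 2 * (k * x) * phi 0 by ring.
apply: le_trans (gauss_abs_lt kx); apply: Pr_mono => //.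
  by apply: measurable_lt_set => //; exact: measurableT_comp.
by move=> y; rewrite /xsection/= inE => -[].
Qed.

Lemma measurable_cone (k l : R) :
  measurable [set w : V | 0 < w.1.1 < l * w.2 /\ `|w.1.2| < k * w.1.1].
Proof.
have m1 : measurable_fun setT (fun w : V => w.1.1) by exact: measurableT_comp.
have m2 : measurable_fun setT (fun w : V => w.1.2) by exact: measurableT_comp.
rewrite (_ : [set w : V | _] = [set w | 0 < w.1.1] `&` ([set w | w.1.1 < l * w.2] `&` [set w | `|w.1.2| < k * w.1.1])).
  apply: measurableI; first exact: measurable_lt_set.
  apply: measurableI; first by apply: measurable_lt_set => //; exact: measurable_funM.
  by apply: measurable_lt_set; [exact: measurableT_comp|exact: measurable_funM].
  by apply/seteqP; split=> z /=; [move=> [/andP[]]|move=> [? [? ?]]; split=> //; apply/andP].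
Qed.

(** The section at height [x] is a triangle of area [k * (l * x) ^+ 2]. With its planar density
    bounded by [phi 0 ^+ 2], what remains is the second moment of the height over the half-line,
    which is 1/2. *)
Lemma gauss3_cone (k l : R) : 0 <= k -> 0 <= l ->
  Pr gauss3 [set w | 0 < w.1.1 < l * w.2 /\ `|w.1.2| < k * w.1.1] <=
  k * l ^+ 2 * phi 0 ^+ 2 / 2.
Proof.
move=> k0 l0; set C := [set w | _].
have mC : measurable C := measurable_cone k l.
rewrite -lee_fin -PrE// gauss3_ysection//.
have ms := measurable_fun_ysection gauss2 mC.
rewrite ge0_integral_gauss//.
have K0 : 0 <= k * l ^+ 2 * phi 0 ^+ 2 by rewrite mulr_ge0 ?sqr_ge0// mulr_ge0 ?sqr_ge0.
have mf : measurable_fun setT (fun x : T => (x ^+ 2 * phi x)%:E).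
  by apply/measurable_EFinP; apply: measurable_funM => //; exact: measurable_phi.
have f0 (x : T) : (0 <= (x ^+ 2 * phi x)%:E)%E.
  by rewrite lee_fin mulr_ge0 ?phi_ge0 ?sqr_ge0.
rewrite [leRHS]EFinM -half_second_moment -ge0_integralZl//; last exact: measurable_funTS.
rewrite integral_mkcond; apply: ge0_le_integral => //=.
- by move=> x _; rewrite mule_ge0// lee_fin phi_ge0.
- apply: emeasurable_funM => //; apply/measurable_EFinP; exact: measurable_phi.
- apply/(measurable_restrictT _ _).1 => //.
  by apply: emeasurable_funM => //; exact: measurable_funTS.
move=> x _; have mS : measurable (ysection C x) by exact: measurable_ysection.
rewrite patchE; case: ifPn => xa; last first.
  rewrite (_ : ysection C x = set0) ?measure0 ?mul0e//.
  apply/seteqP; split=> -[y z] //; rewrite /ysection/= inE => -[/= /andP[y0 yx] _].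
  move: xa; rewrite notin_setE/= in_itv/= andbT => /negP; rewrite -ltNge => x0.
  have : l * x <= 0 by rewrite mulr_ge0_le0// ltW.
  lra.
have x0 : 0 <= x by move: xa; rewrite inE/= in_itv/= andbT.
rewrite PrE// -!EFinM lee_fin mulrA ler_wpM2r ?phi_ge0//.
have lx : 0 <= l * x by rewrite mulr_ge0.
have -> : k * l ^+ 2 * phi 0 ^+ 2 * x ^+ 2 = k * phi 0 ^+ 2 * (l * x) ^+ 2 by ring.
apply: le_trans (gauss2_triangle k0 lx).
rewrite (_ : ysection C x = [set z | 0 < z.1 < l * x /\ `|z.2| < k * z.1])//.
by apply/seteqP; split=> -[y z]; rewrite /ysection/= inE.
Qed.

End cones.

Ltac measurable_halfspaces :=
  repeat first [ apply: measurableI | apply: measurable_lt_set | apply: measurable_le_set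
  | exact: measurable_cst | apply: measurable_funD | apply: measurable_funM
  | apply: measurable_funB | exact: measurableT_comp | exact: measurable_fst | exact: measurable_snd
  | apply: measurableT_comp ].

Section pr_gauss3.
Context {R : realType}.
Local Notation T := (measurableTypeR R).
Local Notation V := (T * T * T)%type.
Local Notation gauss := (gauss R).
Local Notation gauss2 := (gauss2 R).
Local Notation gauss3 := (gauss3 R).

Lemma Pr_gauss3_setX (A : set T) (C : set (T * T)) : measurable A -> measurable C ->
  Pr gauss3 [set w | A w.1.1 /\ C (w.1.2, w.2)] = Pr gauss A * Pr gauss2 C.
Proof.
by move=> mA mC; rewrite {1}/Pr gauss3_setX// (PrE gauss mA) (PrE gauss2 mC).
Qed.

Lemma measurable_gauss3_setX (A : set T) (C : set (T * T)) : measurable A -> measurable C ->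
  measurable [set w : V | A w.1.1 /\ C (w.1.2, w.2)].
Proof.
move=> mA mC.
have m1 : measurable_fun setT (fun w : V => w.1.1) by exact: measurableT_comp.
have m2 : measurable_fun setT (fun w : V => (w.1.2, w.2)).
  by apply: measurable_fun_pair => //; exact: measurableT_comp.
rewrite -[X in measurable X]setTI.
exact: (measurable_fun_pair m1 m2 measurableT (measurableX mA mC)).
Qed.

Lemma Pr_gauss2_setX (A B : set T) : measurable A -> measurable B ->
  Pr gauss2 (A `*` B) = Pr gauss A * Pr gauss B.
Proof.
move=> mA mB; rewrite {1}/Pr (_ : gauss2 (A `*` B) = (gauss A * gauss B)%E).
  by rewrite (PrE gauss mA) (PrE gauss mB).
by rewrite gauss2.unlock; exact: product_measure1E.
Qed.

Lemma Pr_rot12 a b (C : set V) : a ^+ 2 + b ^+ 2 = 1 -> measurable C ->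
  Pr gauss3 (rot12 a b @^-1` C) = Pr gauss3 C.
Proof. by move=> ab mC; rewrite /Pr gauss3_rot12. Qed.

Lemma Pr_rot23 a b (C : set V) : a ^+ 2 + b ^+ 2 = 1 -> measurable C ->
  Pr gauss3 (rot23 a b @^-1` C) = Pr gauss3 C.
Proof. by move=> ab mC; rewrite /Pr gauss3_rot23. Qed.

Lemma measurable_rot12_preimage a b (C : set V) : measurable C ->
  measurable (rot12 a b @^-1` C).
Proof. by move=> mC; rewrite -[X in measurable X]setTI; exact: measurable_rot12. Qed.

Lemma measurable_rot23_preimage a b (C : set V) : measurable C ->
  measurable (rot23 a b @^-1` C).
Proof. by move=> mC; rewrite -[X in measurable X]setTI; exact: measurable_rot23. Qed.

Lemma gauss_symmetric_itv (h : R) : 0 < h -> Pr gauss `[- h, h]%classic <= 1 - 2 * tail h.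
Proof.
move=> h0; have hh : - h <= h by lra.
apply: (@le_trans _ _ (Pr gauss (`]- h, h] `|` [set - h]))).
  apply: Pr_mono => //; first exact: measurableU.
  move=> u /=; rewrite !in_itv/= => /andP[].
  by rewrite le_eqVlt => /orP[/eqP <-|-> ->]; [right|left].
apply: le_trans (PrU_le _ _ _) _ => //.
by rewrite gauss_set1 addr0 tail_itv// tailN; lra.
Qed.

End pr_gauss3.

(** * The acute fan at small thresholds *)

Section acute_fan_small.
Context {R : realType}.
Local Notation T := (measurableTypeR R).
Local Notation V := (T * T * T)%type.
Local Notation gauss := (gauss R).
Local Notation gauss2 := (gauss2 R).
Local Notation gauss3 := (gauss3 R).
Local Notation phi := (@phi R).
Variable h : R.
Hypothesis h0 : 0 < h.

Let X0 (w : V) : R := 3 / 5 * w.1.1 + 4 / 5 * w.1.2.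
Let X1 (w : V) : R := 35 / 37 * w.1.2 + 12 / 37 * w.2.
Let X2 (w : V) : R := - (3 / 5) * w.1.1 + 4 / 5 * w.1.2.

#[local] Lemma mX0 : measurable_fun setT (X0 : V -> T). Proof. by rewrite /X0; measurable_halfspaces. Qed.
#[local] Lemma mX1 : measurable_fun setT (X1 : V -> T). Proof. by rewrite /X1; measurable_halfspaces. Qed.
#[local] Lemma mX2 : measurable_fun setT (X2 : V -> T). Proof. by rewrite /X2; measurable_halfspaces. Qed.

Local Notation C := (cell gauss3 (exceeds (4 / 5) (3 / 5) (35 / 37) (12 / 37) h)).

Let A1 : set V := [set w | - h < X0 w] `&` [set w | X0 w <= h] `&` [set w | X2 w < - h] `&` [set w | h < X1 w].
Let A2 : set V := [set w | - h < X2 w] `&` [set w | X2 w <= h] `&` [set w | X0 w < - h] `&` [set w | h < X1 w].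
Let B : set V := [set w | X0 w < - h] `&` [set w | X2 w < - h] `&` [set w | - h <= X1 w] `&` ~` [set w | h < X1 w].
Let D : set V := [set w | X0 w < - h] `&` [set w | X2 w < - h] `&` [set w | - h <= X1 w] `&` [set w | h < X1 w].

#[local] Lemma mlt (f g : V -> T) : measurable_fun setT f -> measurable_fun setT g ->
  measurable [set w | f w < g w].
Proof. exact: measurable_lt_set. Qed.

#[local] Lemma mle (f g : V -> T) : measurable_fun setT f -> measurable_fun setT g ->
  measurable [set w | f w <= g w].
Proof. exact: measurable_le_set. Qed.

#[local] Lemma mk (x : T) : measurable_fun setT (fun _ : V => x).
Proof. exact: measurable_cst. Qed.

Ltac halfspaces := repeat apply: measurableI;
  first [apply: mlt | apply: mle]; match goal with
  | |- context [X0] => exact: mX0 | |- context [X1] => exact: mX1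
  | |- context [X2] => exact: mX2 | _ => exact: mk end.

#[local] Lemma mA1 : measurable A1. Proof. by halfspaces. Qed.
#[local] Lemma mA2 : measurable A2. Proof. by halfspaces. Qed.
#[local] Lemma mD : measurable D. Proof. by halfspaces. Qed.
#[local] Lemma mB : measurable B.
Proof. by apply: measurableI; last apply: measurableC; halfspaces. Qed.

(* Flipping the sign of (g, z_2) turns the pattern 101 into the event that X_0 and
   X_2 are below - h and X_1 is at least - h, so that both patterns can be compared
   on the common part D. *)
Lemma acute_fan_difference :
  C true false true + Pr gauss3 A1 + Pr gauss3 A2 <= C false true false + Pr gauss3 B.
Proof.
have [a1 a2 a3 a4] := (And4 mA1 mA2 mB mD).
have mc e0 e1 e2 := @measurable_fan_cell R (4 / 5) (3 / 5) (35 / 37) (12 / 37) h e0 e1 e2.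
have e : (-1 : R) ^+ 2 + 0 ^+ 2 = 1 by ring.
have -> : C true false true = Pr gauss3 D + Pr gauss3 B.
  rewrite fan_cellE -(Pr_rot23 e (mc _ _ _)) -Pr_split; last 2 first.
  - by halfspaces.
  - by halfspaces.
  congr Pr; apply/seteqP; split=> w /=.
    by move=> [w0 /negbT w1 w2]; move: w1; rewrite -leNgt /X0 /X1 /X2 => w1; split; [split|]; lra.
  rewrite /X0 /X1 /X2 => -[[w0 w2] w1]; split; [lra| |lra].
  by apply/negbTE; rewrite -leNgt; lra.
suff : Pr gauss3 A1 + (Pr gauss3 A2 + Pr gauss3 D) <= C false true false by lra.
rewrite -PrU//; last by move=> w; rewrite /A2 /D /= => -[[[w1 w2] w3] w4] [[[w5 w6] w7] w8]; lra.
rewrite -PrU//; last 2 first.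
- exact: measurableU.
- by move=> w; rewrite /A1 /A2 /D /= => -[[[w1 w2] w3] w4] [] [[[w5 w6] w7] w8]; lra.
rewrite fan_cellE; apply: Pr_mono => //.
  by apply: measurableU => //; exact: measurableU.
have F (P : bool) : ~~ P -> P = false by move/negbTE.
rewrite /A1 /A2 /D /X0 /X1 /X2.
move=> w /= [|[]] [[[w1 w2] w3] w4]; split; do ?[apply: F; rewrite -leNgt]; move: h0; clear e mc a1 a2 a3 a4; lra.
Qed.

#[local] Lemma sq : (3 / 5) ^+ 2 + (- (4 / 5)) ^+ 2 = 1 :> R. Proof. by field. Qed.
#[local] Lemma sq2 : (- (3 / 5)) ^+ 2 + (- (4 / 5)) ^+ 2 = 1 :> R. Proof. by field. Qed.
#[local] Lemma sq' : (35 / 37) ^+ 2 + (- (12 / 37)) ^+ 2 = 1 :> R. Proof. by field. Qed.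

(** The plane is the one left after a rotation takes X_0 (for [E1]) or X_2 (for [E2]) onto the first
    axis. That coordinate, being in [-h, h], perturbs the other of the two by at most 7/25 h and X_1
    by at most 28/37 h; the margins 4/3 h and 2 h compensate this. *)
Let E1 : set (T * T) :=
  [set z | z.1 < - (4 / 3 * h)] `&` [set z | 2 * h < 21 / 37 * z.1 + 12 / 37 * z.2].
Let E2 : set (T * T) :=
  [set z | 4 / 3 * h < z.1] `&` [set z | 2 * h < - (21 / 37) * z.1 + 12 / 37 * z.2].

#[local] Lemma mE1 : measurable E1. Proof. by measurable_halfspaces. Qed.
#[local] Lemma mE2 : measurable E2. Proof. by measurable_halfspaces. Qed.

(* Conditionally on one of the coordinates lying in [-h, h], the three events A1,
   A2, B are planar sectors up to O(h); the factor 1 - 2 * tail h is the mass of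
   [-h, h]. *)
#[local] Lemma Pr_A1 : (1 - 2 * tail h) * Pr gauss2 E1 <= Pr gauss3 A1.
Proof.
have hh := h0; have mE := mE1; have mA := mA1.
rewrite -(Pr_rot12 sq mA1).
have -> : 1 - 2 * tail h = Pr gauss `]- h, h]%classic by rewrite tail_itv ?tailN; lra.
rewrite -Pr_gauss3_setX//; apply: Pr_mono.
- exact: measurable_gauss3_setX.
- exact: measurable_rot12_preimage.
move=> w [] /=; rewrite in_itv/= => /andP[u1 u2] [/= v1 v2].
by rewrite /A1 /X0 /X1 /X2 /=; split; [split; [split|]|]; lra.
Qed.

#[local] Lemma Pr_A2 : (1 - 2 * tail h) * Pr gauss2 E2 <= Pr gauss3 A2.
Proof.
have hh := h0; have mE := mE2; have mA := mA2.
rewrite -(Pr_rot12 sq2 mA2).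
have -> : 1 - 2 * tail h = Pr gauss `]- h, h]%classic by rewrite tail_itv ?tailN; lra.
rewrite -Pr_gauss3_setX//; apply: Pr_mono.
- exact: measurable_gauss3_setX.
- exact: measurable_rot12_preimage.
move=> w [] /=; rewrite in_itv/= => /andP[u1 u2] [/= v1 v2].
by rewrite /A2 /X0 /X1 /X2 /=; split; [split; [split|]|]; lra.
Qed.

#[local] Lemma Pr_B : Pr gauss3 B <= (1 - 2 * tail h) * Pr gauss2 [set z | `|z.1| < 16 / 37 * z.2].
Proof.
have hh := h0; have e : (0 : R) ^+ 2 + (-1) ^+ 2 = 1 by ring.
have mS := measurable_abs_lt (16 / 37 : R); have mB0 := mB.
apply: (@le_trans _ _ (Pr gauss `[- h, h]%classic * Pr gauss2 [set z | `|z.1| < 16 / 37 * z.2])).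
  (* The rotations make X_1 the first coordinate. On [B] it stays in [-h, h], so its contribution to
     X_0 and X_2 is absorbed by the margin h; the slope 16/37 is 4/5 times 12/37 divided by 3/5. *)
  rewrite -(Pr_rot23 sq' mB) -(Pr_rot12 e); last exact: measurable_rot23_preimage.
  rewrite -Pr_gauss3_setX//; apply: Pr_mono.
  - by apply: measurable_rot12_preimage; exact: measurable_rot23_preimage.
  - exact: measurable_gauss3_setX.
  move=> w; rewrite /B /X0 /X1 /X2 /= => -[[[x0 x2] x1] /negP]; rewrite -leNgt => x1'.
  rewrite in_itv/=; split; first by apply/andP; split; lra.
  by rewrite ltr_norml; apply/andP; split; lra.
by rewrite ler_wpM2r ?Pr_ge0// gauss_symmetric_itv.
Qed.

#[local] Lemma Pr_E : Pr gauss2 [set z | `|z.1| < 4 / 7 * z.2] <=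
  Pr gauss2 E1 + Pr gauss2 E2 + 53 / 6 * h.
Proof.
have hh := h0; have [a1 a2] := (conj mE1 mE2).
pose F1 : set (T * T) := [set z | - (4 / 3 * h) <= z.1] `&` [set z | z.1 <= 4 / 3 * h].
pose f (v : T) : T := 7 / 4 * `|v|.
pose F2 : set (T * T) := [set z | f z.1 < z.2 <= f z.1 + 37 / 6 * h].
have mf : measurable_fun setT f.
  by apply: measurable_funM => //; apply: measurableT_comp.
have F2le : Pr gauss2 F2 <= 37 / 6 * h by apply: gauss2_strip => //; lra.
have mF1 : measurable F1 by measurable_halfspaces.
have mF2 : measurable F2.
  rewrite (_ : F2 = [set z | f z.1 < z.2] `&` [set z | z.2 <= f z.1 + 37 / 6 * h]); last first.
    by apply/seteqP; split=> z /=; [move/andP=> []|move=> [? ?]; apply/andP].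
  have mf1 : measurable_fun setT (fun z : T * T => f z.1) by exact: measurableT_comp.
  apply: measurableI; [apply: measurable_lt_set|apply: measurable_le_set] => //.
  exact: measurable_funD.
have F1le : Pr gauss2 F1 <= 8 / 3 * h.
  rewrite (_ : F1 = [set` `[- (4 / 3 * h), 4 / 3 * h]] `*` setT); last first.
    apply/seteqP; split=> z /=; rewrite /F1 /= in_itv/=; first by move=> [-> ->].
    by move=> [/andP[]].
  rewrite Pr_gauss2_setX// PrT mulr1.
  have a0 : 0 < 4 / 3 * h by lra.
  apply: le_trans (gauss_symmetric_itv a0) _.
  by have := tail_ge_half (ltW a0); lra.
apply: (@le_trans _ _ (Pr gauss2 (E1 `|` E2 `|` (F1 `|` F2)))).
  apply: Pr_mono; first exact: measurable_abs_lt.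
    by do !apply: measurableU.
  move=> z /=; rewrite ltr_norml => /andP[z1 z1'].
  rewrite /E1 /E2 /F1 /F2 /f /=.
  have [u|u] := ltP z.1 (- (4 / 3 * h)).
    rewrite ler0_norm; last by lra.
    have [v|v] := ltP (2 * h) (21 / 37 * z.1 + 12 / 37 * z.2); first by left; left.
    by right; right; apply/andP; split; lra.
  have [u'|u'] := ltP (4 / 3 * h) z.1; last by right; left.
  rewrite ger0_norm; last by lra.
  have [v|v] := ltP (2 * h) (- (21 / 37) * z.1 + 12 / 37 * z.2); first by left; right.
  by right; right; apply/andP; split; lra.
apply: le_trans (PrU_le _ _ _) _; try exact: measurableU.
have := PrU_le gauss2 mE1 mE2; have := PrU_le gauss2 mF1 mF2; lra.
Qed.

#[local] Lemma Pr_C101 : C true false true <= (4 / 3) * (12 / 35) ^+ 2 * phi 0 ^+ 2 / 2 + 2 * h.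
Proof.
have hh := h0.
have e : (0 : R) ^+ 2 + (-1) ^+ 2 = 1 by ring.
have e' : (-1 : R) ^+ 2 + 0 ^+ 2 = 1 by ring.
pose G : set V := [set w | 3 / 5 * w.1.1 < 4 / 5 * w.1.2] `&`
  [set w | - (3 / 5) * w.1.1 < 4 / 5 * w.1.2] `&` [set w | X1 w < 0].
pose H : set V := [set w | - h < X1 w] `&` ~` [set w | h < X1 w].
have m1 : measurable [set w | - h < X1 w] by halfspaces.
have m2 : measurable [set w | h < X1 w] by halfspaces.
have mH : measurable H by apply: measurableI => //; exact: measurableC.
have mG : measurable G.
  apply: measurableI; last by halfspaces.
  by measurable_halfspaces.
have PH : Pr gauss3 H <= 2 * h.
  have X1E (x : R) : Pr gauss3 [set w | x < X1 w] = tail x.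
    have := exceeds_prob fan_cb fan_cb' x i1; rewrite /exceeds => <-.
    congr Pr; apply/seteqP; split=> w /=;
      by rewrite /X1; have [_ -> _] := dot_fan (4 / 5) (3 / 5) (35 / 37) (12 / 37) w.
  have := Pr_split gauss3 m1 m2; rewrite !X1E.
  have -> : [set w | - h < X1 w] `&` [set w | h < X1 w] = [set w | h < X1 w].
    by apply/seteqP; split=> w /=; [case|move=> hw; split=> //; lra].
  rewrite X1E tailN -/H; have := tail_ge_half (ltW hh); lra.
have PG : Pr gauss3 G <= (4 / 3) * (12 / 35) ^+ 2 * phi 0 ^+ 2 / 2.
  have k0 : 0 <= 4 / 3 :> R by lra.
  have l0 : 0 <= 12 / 35 :> R by lra.
  apply: le_trans (gauss3_cone k0 l0).
  rewrite -(Pr_rot12 e mG) -(Pr_rot23 e'); last exact: measurable_rot12_preimage.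
  apply: Pr_mono.
  - by apply: measurable_rot23_preimage; exact: measurable_rot12_preimage.
  - exact: measurable_cone.
  move=> w; rewrite /G /X1 /= => -[[g1 g2] g3].
  by rewrite ltr_norml; split; apply/andP; split; clear mG PH m1 m2 mH; lra.
apply: (@le_trans _ _ (Pr gauss3 (G `|` H))).
  rewrite fan_cellE; apply: Pr_mono; first exact: measurable_fan_cell.
    exact: measurableU.
  move=> w /= [x0 x1 x2]; move: x1 => /negbT; rewrite -leNgt => x1.
  rewrite /G /H /= /X1 /=; have [x|x] := ltP (35 / 37 * w.1.2 + 12 / 37 * w.2) 0.
    by left; split; [split|]; clear mG PH PG m1 m2 mH; lra.
  by right; split; [|apply/negP; rewrite -leNgt]; clear mG PH PG m1 m2 mH; lra.
apply: le_trans (PrU_le _ mG mH) _; lra.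
Qed.

(** The claim is rewritten as (1 - 2p) P(101) < (P(010) - P(101)) p. The lower bound for the
    difference carries the same factor 1 - 2p; once it is cancelled, 96/1225 [phi 0 ^+ 2] is
    compared with 11/105 [phi 0 ^+ 2], and the hypothesis lets the gap absorb the terms of order
    h. *)
Lemma acute_fan_not_color : 20 * (20 * h) < phi 0 ^+ 2 ->
  ~ threshold_color (fan_vector fan_cb fan_cb' fan_b0) h.
Proof.
move=> hq; apply: fan_not_color => //.
have hh := h0; set q := phi 0 ^+ 2 in hq *.
have q0 : 0 < q by rewrite exprn_gt0// phi_gt0.
have q1 : q <= 1 by rewrite expr_le1// ?phi_ge0// phi0_le1.
have k1 : 0 < 16 / 37 :> R by lra.
have k12 : 16 / 37 <= 4 / 7 :> R by lra.
have W := gauss2_wedge k1 k12.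
have s0 : 0 < 1 - 2 * tail h by have := tail_lt_half hh; lra.
have th := tail_ge_half (ltW hh).
have diff := acute_fan_difference; have a1 := Pr_A1; have a2 := Pr_A2; have b := Pr_B; have e := Pr_E.
have c := Pr_C101.
rewrite -/q in W c.
set x := C true false true in diff c *; set y := C false true false in diff *.
set w1 := Pr gauss2 [set z | `|z.1| < 16 / 37 * z.2] in W b.
set w2 := Pr gauss2 [set z | `|z.1| < 4 / 7 * z.2] in W e.
set e1 := Pr gauss2 E1 in a1 e; set e2 := Pr gauss2 E2 in a2 e.
pose d := 2 * (4 / 7 - 16 / 37) * q / (1 + (4 / 7) ^+ 2) - 53 / 6 * h.
have d1 : (1 - 2 * tail h) * d <= y - x.
  have : (1 - 2 * tail h) * d <= (1 - 2 * tail h) * (e1 + e2 - w1).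
    by rewrite ler_wpM2l ?(ltW s0)//; rewrite /d; lra.
  lra.
suff : (1 - 2 * tail h) * x < (y - x) * tail h by lra.
(* 22/105 lies just below 2 * 36/259 * 49/65, the coefficient of [gauss2_wedge] for the slopes 16/37
   and 4/7. *)
have d0 : 22 / 105 * q - 53 / 6 * h <= d.
  rewrite /d lerD2r [leRHS](_ : _ = 2 * 36 / 259 * 49 / 65 * q); last by field.
  lra.
clearbody d x y e1 e2 w1 w2 q; clear W diff a1 a2 b e.
have d00 : 0 <= d by lra.
apply: (@lt_le_trans _ _ ((1 - 2 * tail h) * (d * tail h))); last first.
  by rewrite mulrA ler_wpM2r// tail_ge0.
rewrite ltr_pM2l//; apply: le_lt_trans c _.
apply: (@lt_le_trans _ _ ((22 / 105 * q - 53 / 6 * h) * (1 / 2 - h))); last first.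
  have hh2 : 0 <= 1 / 2 - h by lra.
  exact: le_trans (ler_wpM2r hh2 d0) (ler_wpM2l d00 th).
have : h * q <= h * 1 by rewrite ler_wpM2l// ltW.
have : 0 <= h * h by rewrite mulr_ge0// ltW.
lra.
Qed.

End acute_fan_small.

(** * One vector *)

Section single.
Context {R : realType}.
Local Notation T := (measurableTypeR R).
Local Notation V := (T * T * T)%type.
Local Notation gauss3 := (gauss3 R).

Definition axis (i : 'I_1) : V := ((0, 0), 1).

Lemma axis_unit i : dot (axis i) (axis i) = 1.
Proof. by rewrite /dot/= !mulr0 !add0r mulr1. Qed.

Lemma axis_inj : injective axis.
Proof. by move=> i j _; rewrite !ord1. Qed.

Definition single_vector : gaussianVector R := linear_gaussian axis_unit axis_inj.

Lemma single_nonneg : nonneg_correlations single_vector.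
Proof.
by apply: linear_gaussian_correlations => i j; rewrite (ord1 i) (ord1 j) axis_unit.
Qed.

Lemma single_color h : threshold_color single_vector h.
Proof.
pose Y (i : 'I_1) (w : V) := h < dot (axis i) w.
have mY i : measurable [set w | Y i w] by exact: measurable_dot_gt.
have Y0 : gauss3 [set w | Y ord0 w] = (tail h)%:E by exact/unit_dot_gt/axis_unit.
change (color_process gauss3 Y).
apply: (@color_process_labels _ _ _ _ _ _ 'I_1 'I_1 (tail h) (fun=> 1) (fun _ => id)) => //.
- by rewrite tail_ge0 tail_le1.
- by rewrite big_ord1.
move=> y; rewrite big_ord1 mul1r.
have -> : label_weight (tail h) id y = if y ord0 then tail h else 1 - tail h.
  have A (Q : pred 'I_1) : [forall i in fiber (id : 'I_1 -> 'I_1) ord0, Q i] = Q ord0.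
    by apply/forall_inP/idP => [|Q0 i _]; [apply; rewrite inE|rewrite (ord1 i)].
  rewrite /label_weight big_ord1 /block_weight !A.
  by case: (y ord0); rewrite ?mulr1 ?mulr0 ?addr0 ?add0r.
have E (b : bool) : [set t | forall i, Y i t = b] = [set t | Y ord0 t = b].
  by apply/seteqP; split=> t /= Yt => [|i]; rewrite ?(ord1 i).
rewrite (_ : [set t | _] = [set t | Y ord0 t = y ord0]); last first.
  by apply/seteqP; split=> t /= Yt => [|i]; rewrite ?(ord1 i).
case: (y ord0) => //.
rewrite (_ : [set t | _] = ~` [set t | Y ord0 t]); last first.
  by apply/seteqP; split=> t /=; [move=> ->|move/negP/negbTE].
by rewrite probability_setC// Y0.
Qed.

End single.

(** * Four vectors in a square *)

Section square.
Context {R : realType}.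
Local Notation T := (measurableTypeR R).
Local Notation V := (T * T * T)%type.
Local Notation gauss := (gauss R).
Local Notation gauss3 := (gauss3 R).
Variables c d : R.

(* Coordinates (z_1, z_2, g): X_0, X_1 = c g +- d z_1 and X_2, X_3 = c g +- d z_2.
   Both diagonals have mean c g, so no threshold separates them. *)
Definition square (i : 'I_4) : V :=
  nth (0 : V) [:: ((d, 0), c); ((- d, 0), c); ((0, d), c); ((0, - d), c)] i.

Definition square_exceeds (h : R) (i : 'I_4) (w : V) : bool := h < dot (square i) w.

Hypothesis cd : c ^+ 2 + d ^+ 2 = 1.
Hypothesis d0 : 0 < d.
Hypothesis dc : d < c.

Lemma square_unit i : dot (square i) (square i) = 1.
Proof.
by case: i => -[|[|[|[|//]]]] lt; rewrite /square /dot/= ?mulr0 ?mulrNN ?add0r ?addr0 -!expr2 addrC.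
Qed.

Lemma square_inj : injective square.
Proof.
move=> i j e; have e1 := congr1 (fun u : V => u.1.1) e; have e2 := congr1 (fun u : V => u.1.2) e.
have := d0; case: i j {e} e1 e2 => -[|[|[|[|//]]]] lt [[|[|[|[|//]]]] lt'] /= e1 e2 d0';
  apply/val_inj => //=; exfalso; rewrite /= in e1 e2; lra.
Qed.

Lemma square_correlation i j : i != j -> 0 <= dot (square i) (square j) < 1.
Proof.
have := d0; have := dc; have := cd; have := sqr_ge0 c; have := exprn_gt0 2 d0.
have c0 : 0 < c := lt_trans d0 dc.
have p2 : 0 < c ^+ 2 - d ^+ 2.
  by rewrite subr_sqr; apply: mulr_gt0; move: d0 dc; lra.
move: p2.
by case: i j => -[|[|[|[|//]]]] lt [[|[|[|[|//]]]] lt'] //= p2 d2 c2 cd' dc' d0' _;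
  rewrite /square /dot/=; apply/andP; split; lra.
Qed.

Definition square_vector : gaussianVector R := linear_gaussian square_unit square_inj.

Lemma square_nonneg : nonneg_correlations square_vector.
Proof.
apply: linear_gaussian_correlations => i j; have [->|ij] := eqVneq i j.
  by rewrite square_unit.
by have /andP[] := square_correlation ij.
Qed.

Lemma measurable_square_exceeds h i : measurable [set w | square_exceeds h i w].
Proof. exact: measurable_dot_gt. Qed.

Lemma square_exceeds_prob h i : Pr gauss3 [set w | square_exceeds h i w] = tail h.
Proof. by rewrite /Pr (unit_dot_gt h (square_unit i)). Qed.

Definition j0 : 'I_4 := @Ordinal 4 0 isT.
Definition j1 : 'I_4 := @Ordinal 4 1 isT.
Definition j2 : 'I_4 := @Ordinal 4 2 isT.
Definition j3 : 'I_4 := @Ordinal 4 3 isT.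

Lemma square_dotE w : [/\ dot (square j0) w = d * w.1.1 + c * w.2,
  dot (square j1) w = - d * w.1.1 + c * w.2,
  dot (square j2) w = d * w.1.2 + c * w.2 & dot (square j3) w = - d * w.1.2 + c * w.2].
Proof. by split; rewrite /square /dot/= ?mul0r ?addr0 ?add0r. Qed.

Definition square_cell h (b0 b1 b2 b3 : bool) : set V :=
  [set w | [/\ (h < d * w.1.1 + c * w.2) = b0, (h < - d * w.1.1 + c * w.2) = b1,
    (h < d * w.1.2 + c * w.2) = b2 & (h < - d * w.1.2 + c * w.2) = b3]].

Lemma square_cellE h b0 b1 b2 b3 :
  pattern (square_exceeds h) (pat4 b0 b1 b2 b3) = square_cell h b0 b1 b2 b3.
Proof.
apply/seteqP; split=> w /=; rewrite /square_cell /pattern /=.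
  have [<- <- <- <-] := square_dotE w.
  by move=> H; split; [have := H j0|have := H j1|have := H j2|have := H j3]; rewrite ffunE.
have [<- <- <- <-] := square_dotE w => -[h0 h1 h2 h3] [[|[|[|[|//]]]] lt]; rewrite ffunE/=.
- by rewrite -h0; congr (square_exceeds _ _ w); exact/val_inj.
- by rewrite -h1; congr (square_exceeds _ _ w); exact/val_inj.
- by rewrite -h2; congr (square_exceeds _ _ w); exact/val_inj.
- by rewrite -h3; congr (square_exceeds _ _ w); exact/val_inj.
Qed.

Lemma measurable_square_cell h b0 b1 b2 b3 : measurable (square_cell h b0 b1 b2 b3).
Proof. by rewrite -square_cellE; apply: measurable_pattern => i; exact: measurable_dot_gt. Qed.

Lemma square_cell1100 h : square_cell h true true false false = set0.
Proof.
apply/seteqP; split=> w //= [h0 h1 /negbT h2 /negbT h3].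
by move: h2 h3; rewrite -!leNgt; move: h0 h1; lra.
Qed.

Lemma square_not_color_large : for_large (fun h => ~ threshold_color square_vector h).
Proof.
(* Six pairs at 1/7 cost 6/7, less than 1, in the inclusion-exclusion bound: P(0000) <= 1 - 22/7 p <
   1 - 3p <= (1 - p)^3, against the bound for a null pattern. *)
have e7 : 0 < 1 / 7 :> R by lra.
have E (i j : 'I_4) : i != j -> exists2 k : R, 0 < k & forall h, k < h ->
    Pr gauss3 [set w | square_exceeds h i w /\ square_exceeds h j w] <= 1 / 7 * tail h.
  by move=> ij; exact: pair_exceedance (square_unit _) (square_unit _) (square_correlation ij) e7.
have [k01 p01 K01] := E j0 j1 isT; have [k02 p02 K02] := E j0 j2 isT.
have [k03 p03 K03] := E j0 j3 isT; have [k12 p12 K12] := E j1 j2 isT.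
have [k13 p13 K13] := E j1 j3 isT; have [k23 p23 K23] := E j2 j3 isT.
exists (k01 + k02 + k03 + k12 + k13 + k23); first by lra.
move=> h hh; have h0 : 0 < h by lra.
have {}K01 := K01 h ltac:(lra); have {}K02 := K02 h ltac:(lra); have {}K03 := K03 h ltac:(lra).
have {}K12 := K12 h ltac:(lra); have {}K13 := K13 h ltac:(lra); have {}K23 := K23 h ltac:(lra).
move=> [p' [q [p01' hq PY]]].
have mY := measurable_square_exceeds h.
have pp' : p' = tail h.
  have := color_marginal mY j0 hq PY.
  by rewrite [X in X = _](unit_dot_gt h (square_unit _)) => -[].
rewrite pp' in PY => {p01' pp' p'}.
have p0 := tail_gt0 h; have p2 := tail_lt_half h0.
have pp : 0 < tail h < 1 by apply/andP; split; lra.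
have := null_pattern_nonseparated (y := pat4 true true false false) pp hq PY.
rewrite square_cellE square_cell1100 measure0 => /(_ erefl).
rewrite card_ord PrE; last by apply: measurable_pattern.
rewrite lee_fin; set z := Pr _ _ => zp.
pose Y i := [set w | square_exceeds h i w].
have mI i j : measurable (Y i `&` Y j) by apply: measurableI; exact: mY.
have PU A B : measurable A -> measurable B -> Pr gauss3 A + Pr gauss3 B - Pr gauss3 (A `&` B) <= Pr gauss3 (A `|` B).
  move=> mA mB; have := Pr_split gauss3 mB mA; rewrite setIC => ->.
  suff : Pr gauss3 A + Pr gauss3 (B `&` ~` A) <= Pr gauss3 (A `|` B) by lra.
  rewrite -PrU//; last by move=> w wA [_].
    apply: Pr_mono; [apply: measurableU => //|exact: measurableU|].
      by apply: measurableI => //; exact: measurableC.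
    by move=> w [|[]]; [left|right].
  by apply: measurableI => //; exact: measurableC.
have U1 := PU (Y j0) (Y j1) (mY _) (mY _).
have mU1 : measurable (Y j0 `|` Y j1) by apply: measurableU; exact: mY.
have U2 := PU _ (Y j2) mU1 (mY _).
have mU2 : measurable (Y j0 `|` Y j1 `|` Y j2) by apply: measurableU => //; exact: mY.
have U3 := PU _ (Y j3) mU2 (mY _).
have I2 : Pr gauss3 ((Y j0 `|` Y j1) `&` Y j2) <= Pr gauss3 (Y j0 `&` Y j2) + Pr gauss3 (Y j1 `&` Y j2).
  by rewrite setIUl; exact: PrU_le.
have I3 : Pr gauss3 ((Y j0 `|` Y j1 `|` Y j2) `&` Y j3) <=
    Pr gauss3 (Y j0 `&` Y j3) + Pr gauss3 (Y j1 `&` Y j3) + Pr gauss3 (Y j2 `&` Y j3).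
  rewrite !setIUl; apply: le_trans (PrU_le _ _ _) _ => //; first exact: measurableU.
  by rewrite lerD2r; exact: PrU_le.
have Z : z = 1 - Pr gauss3 (Y j0 `|` Y j1 `|` Y j2 `|` Y j3).
  transitivity (Pr gauss3 (pattern (square_exceeds h) [ffun=> false])); first by [].
  rewrite -PrC; last by apply: measurableU => //; exact: mY.
  congr Pr; apply/seteqP; split=> w /= H.
    by move=> [[[]|]|] /=; rewrite /Y /= H ffunE.
  move=> i; rewrite ffunE; apply/negbTE/negP => Hi; apply: H.
  case: i Hi => -[|[|[|[|//]]]] lt Hi.
  - by left; left; left; rewrite /Y /= (_ : j0 = Ordinal lt)//; exact/val_inj.
  - by left; left; right; rewrite /Y /= (_ : j1 = Ordinal lt)//; exact/val_inj.
  - by left; right; rewrite /Y /= (_ : j2 = Ordinal lt)//; exact/val_inj.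
  - by right; rewrite /Y /= (_ : j3 = Ordinal lt)//; exact/val_inj.
have YP i : Pr gauss3 (Y i) = tail h by exact: square_exceeds_prob.
rewrite !YP in U1 U2 U3.
have J (i j : 'I_4) : Pr gauss3 (Y i `&` Y j) = Pr gauss3 [set w | square_exceeds h i w /\ square_exceeds h j w] by [].
rewrite !J in U1 U2 U3 I2 I3.
have zle : z <= 1 - 4 * tail h + 6 / 7 * tail h.
  by move: Z U1 U2 U3 I2 I3 K01 K02 K03 K12 K13 K23; clear; lra.
move: zp; rewrite /= !exprS expr0; have := sqr_ge0 (tail h).
by move: zle p0 p2; clear; nra.
Qed.

End square.

Section gauss3_reflection.
Context {R : realType}.
Local Notation T := (measurableTypeR R).
Local Notation V := (T * T * T)%type.
Local Notation gauss := (gauss R).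
Local Notation gauss2 := (gauss2 R).
Local Notation gauss3 := (gauss3 R).
Local Notation phi := (@phi R).

Lemma gauss3_le_xsection (C D : set V) : measurable C -> measurable D ->
  (forall z, Pr gauss (xsection C z) <= Pr gauss (xsection D z)) -> Pr gauss3 C <= Pr gauss3 D.
Proof.
move=> mC mD CD; rewrite -lee_fin -!PrE// !gauss3_xsection.
apply: ge0_le_integral => //=; try exact: measurable_fun_xsection.
by move=> z _; rewrite !PrE ?lee_fin//; exact: measurable_xsection.
Qed.

(* Reflecting the last coordinate about s >= 0 moves it closer to 0, where the
   density is larger. *)
Lemma gauss3_reflect_le (s : R) (C D : set V) : 0 <= s -> measurable C -> measurable D ->
  (forall w, C w -> s <= w.2 /\ D (w.1, 2 * s - w.2)) -> Pr gauss3 C <= Pr gauss3 D.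
Proof.
move=> s0 mC mD CD; apply: gauss3_le_xsection => // z.
rewrite -[leRHS]mul1r; apply: (@gauss_transport _ (-1) (2 * s)) => //.
- exact: measurable_xsection.
- exact: measurable_xsection.
move=> u; rewrite /xsection /= !inE => /CD[/= su Du]; rewrite normrN normr1 !mul1r.
rewrite (_ : 2 * s - _ = u) in Du; last by ring.
split=> //; rewrite phi_le_abs// ler_norml; have := ler_norm (- (-1 * u + 2 * s)).
by have := ler_norm (-1 * u + 2 * s); rewrite normrN => n1 n2; apply/andP; split; lra.
Qed.

Lemma Pr_last (A : set T) : measurable A -> Pr gauss3 [set w | A w.2] = Pr gauss A.
Proof.
move=> mA; have := gauss3_box measurableT measurableT mA.
rewrite !probability_setT !mul1e => e; rewrite /Pr -e; congr (fine (_ _)).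
by apply/seteqP; split=> w //= [].
Qed.

Lemma Pr_first (A : set T) : measurable A -> Pr gauss3 [set w | A w.1.1] = Pr gauss A.
Proof.
move=> mA; have := gauss3_box mA measurableT measurableT.
rewrite !probability_setT !mule1 => e; rewrite /Pr -e; congr (fine (_ _)).
by apply/seteqP; split=> w //= [].
Qed.

Lemma measurable_last (A : set T) : measurable A -> measurable [set w : V | A w.2].
Proof. by move=> mA; rewrite -[X in measurable X]setTI; exact: measurable_snd. Qed.

Lemma measurable_first (A : set T) : measurable A -> measurable [set w : V | A w.1.1].
Proof.
move=> mA; rewrite -[X in measurable X]setTI.
have m : measurable_fun setT (fun w : V => w.1.1) by exact: measurableT_comp.
exact: (m measurableT A mA).
Qed.

Lemma Pr_dot_eq (u : V) (h : R) : dot u u = 1 -> Pr gauss3 [set w | dot u w = h] = 0.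
Proof.
move=> u1; rewrite /Pr (_ : [set w | _] = dot u @^-1` [set h])// dot_law//.
rewrite (_ : [set x | _] = [set h]) -?/(Pr gauss _) ?gauss_set1//.
by rewrite /norm3 u1 sqrtr1; apply/seteqP; split=> x /=; rewrite mul1r.
Qed.

Lemma measurable_dot_eq (u : V) (h : R) : measurable [set w : V | dot u w = h].
Proof.
by rewrite -[X in measurable X]setTI; exact: (measurable_dot u measurableT (measurable_set1 h)).
Qed.

Lemma tail10_le : tail 10 <= 1 / 102 :> R.
Proof.
have t := @tail_expR R 10 ltac:(lra); apply: le_trans t _.
have : (expR 50 : R) ^-1 <= 51^-1.
  by rewrite lef_pV2 ?posrE ?expR_gt0//; have := @expR_ge1Dx R 50; lra.
rewrite -expRN; have -> : - (10 ^+ 2 / 2) = - 50 :> R by field.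
lra.
Qed.

End gauss3_reflection.

(** * The square at small thresholds *)

Section square_small.
Context {R : realType}.
Local Notation T := (measurableTypeR R).
Local Notation V := (T * T * T)%type.
Local Notation gauss := (gauss R).
Local Notation gauss3 := (gauss3 R).
Local Notation phi := (@phi R).
Variables c d h : R.
Hypothesis cd : c ^+ 2 + d ^+ 2 = 1.
Hypothesis d0 : 0 < d.
Hypothesis c2 : 1 / 2 <= c.
Hypothesis c1 : c <= 1.
Hypothesis h0 : 0 < h.

Local Notation cell := (square_cell c d h).
Local Notation p := (tail h).
Local Notation Pr := (Pr gauss3).

Let mcell b0 b1 b2 b3 : measurable (cell b0 b1 b2 b3) := measurable_square_cell c d h b0 b1 b2 b3.

(** A quarter turn of (z_1, z_2) permutes the four vectors cyclically. *)
Lemma square_cell_cycle b0 b1 b2 b3 :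
  Pr (cell b0 b1 b2 b3) = Pr (cell b3 b2 b0 b1).
Proof.
have e : (0 : R) ^+ 2 + 1 ^+ 2 = 1 by ring.
rewrite -(Pr_rot12 e (mcell b0 b1 b2 b3)); congr Pr; apply/seteqP; split=> w;
  rewrite /square_cell /=.
  have -> : d * (0 * w.1.1 + 1 * w.1.2) = d * w.1.2 by ring.
  have -> : - d * (0 * w.1.1 + 1 * w.1.2) = - d * w.1.2 by ring.
  have -> : d * (- 1 * w.1.1 + 0 * w.1.2) = - d * w.1.1 by ring.
  have -> : - d * (- 1 * w.1.1 + 0 * w.1.2) = d * w.1.1 by ring.
  by move=> [? ? ? ?].
have -> : d * (0 * w.1.1 + 1 * w.1.2) = d * w.1.2 by ring.
have -> : - d * (0 * w.1.1 + 1 * w.1.2) = - d * w.1.2 by ring.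
have -> : d * (- 1 * w.1.1 + 0 * w.1.2) = - d * w.1.1 by ring.
have -> : - d * (- 1 * w.1.1 + 0 * w.1.2) = d * w.1.1 by ring.
by move=> [? ? ? ?].
Qed.

Local Notation A := (Pr (cell true true true true)).
Local Notation B := (Pr (cell false false false false)).
Local Notation f1 := (Pr (cell true false false false)).
Local Notation f3 := (Pr (cell true true true false)).
Local Notation g := (Pr (cell true false true false)).

Let cell1100 : cell true true false false = set0.
Proof. exact: square_cell1100. Qed.

Let cell0011 : Pr (cell false false true true) = 0.
Proof. by rewrite square_cell_cycle cell1100 Pr0. Qed.

Lemma square_patternE b0 b1 b2 b3 :
  Pr (cell b0 b1 b2 b3) = square_pattern A B f1 f3 g b0 b1 b2 b3.
Proof.
have s1 := square_cell_cycle true false false false.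
have s2 := square_cell_cycle false false true false.
have s3 := square_cell_cycle false true false false.
have t1 := square_cell_cycle true true true false.
have t2 := square_cell_cycle false true true true.
have t3 := square_cell_cycle true true false true.
have u1 := square_cell_cycle true false true false.
have u2 := square_cell_cycle false true true false.
have u3 := square_cell_cycle false true false true.
case: b0 b1 b2 b3 => -[] [] []; rewrite /square_pattern //=; try by rewrite ?cell1100 ?cell0011 ?Pr0.
all: by rewrite ?t1 ?t2 ?t3 ?u1 ?u2 ?u3 ?s1 ?s2 ?s3.
Qed.

Lemma Pr_square_split (E : set V) : measurable E ->
  Pr E = \sum_(b0 : bool) \sum_(b1 : bool) \sum_(b2 : bool) \sum_(b3 : bool)
    Pr (E `&` cell b0 b1 b2 b3).
Proof.
have split1 (F : set V) (Y : V -> bool) : measurable F -> measurable [set w | Y w] ->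
    Pr F = \sum_(b : bool) Pr (F `&` [set w | Y w = b]).
  move=> mF mY; rewrite big_bool /= (Pr_split _ mF mY); congr (_ + Pr (_ `&` _)).
  by apply/seteqP; split=> w /=; [move/negP/negbTE|move=> ->].
have mb (Y : V -> bool) b : measurable [set w | Y w] -> measurable [set w | Y w = b].
  move=> mY; case: b => //.
  rewrite (_ : [set w | _] = ~` [set w | Y w]); first exact: measurableC.
  by apply/seteqP; split=> w /=; [move=> ->|move/negP/negbTE].
move=> mE.
have m0 := measurable_square_exceeds c d h j0; have m1 := measurable_square_exceeds c d h j1.
have m2 := measurable_square_exceeds c d h j2; have m3 := measurable_square_exceeds c d h j3.
rewrite (split1 _ _ mE m0); apply: eq_bigr => b0 _.
have mE0 := measurableI _ _ mE (mb _ b0 m0).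
rewrite (split1 _ _ mE0 m1); apply: eq_bigr => b1 _.
have mE1 := measurableI _ _ mE0 (mb _ b1 m1).
rewrite (split1 _ _ mE1 m2); apply: eq_bigr => b2 _.
have mE2 := measurableI _ _ mE1 (mb _ b2 m2).
rewrite (split1 _ _ mE2 m3); apply: eq_bigr => b3 _.
congr Pr; apply/seteqP; split=> w; rewrite /square_cell /square_exceeds /=;
  have [-> -> -> ->] := square_dotE c d w.
  by move=> [[[[? ?] ?] ?] ?].
by move=> [? [? ? ? ?]].
Qed.

End square_small.

Section square_small_color.
Context {R : realType}.
Local Notation T := (measurableTypeR R).
Local Notation V := (T * T * T)%type.
Local Notation gauss := (gauss R).
Local Notation gauss3 := (gauss3 R).
Local Notation phi := (@phi R).
Variables c d h : R.
Hypothesis cd : c ^+ 2 + d ^+ 2 = 1.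
Hypothesis d0 : 0 < d.
Hypothesis c2 : 1 / 2 <= c.
Hypothesis c1 : c <= 1.
Hypothesis h0 : 0 < h.

Local Notation cell := (square_cell c d h).
Local Notation p := (tail h).
Local Notation Pr := (Pr gauss3).
Local Notation A := (Pr (cell true true true true)).
Local Notation B := (Pr (cell false false false false)).
Local Notation f1 := (Pr (cell true false false false)).
Local Notation f3 := (Pr (cell true true true false)).
Local Notation g := (Pr (cell true false true false)).

Let mcell b0 b1 b2 b3 : measurable (cell b0 b1 b2 b3) := measurable_square_cell c d h b0 b1 b2 b3.
Let c_gt0 : 0 < c. Proof. by apply: lt_le_trans c2; lra. Qed.
Let hc0 : 0 <= h / c. Proof. by rewrite divr_ge0// ltW. Qed.

Let patternE := square_patternE c d h.

Ltac cells := rewrite ?(patternE true true false true) ?(patternE true false true true)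
  ?(patternE false true true true) ?(patternE false true false false) ?(patternE false false true false)
  ?(patternE false false false true) ?(patternE true false false true) ?(patternE false true true false)
  ?(patternE false true false true) ?(patternE true true false false) ?(patternE false false true true)
  /square_pattern /=.

Lemma square_marginal : A + 3 * f3 + f1 + 2 * g = p.
Proof.
have mE := measurable_square_exceeds c d h j0.
have Et b1 b2 b3 : Pr ([set w | square_exceeds c d h j0 w] `&` cell true b1 b2 b3) =
    Pr (cell true b1 b2 b3).
  congr Pr; apply/seteqP; split=> w [] // x0 x1 x2 x3; split=> //.
  by rewrite /= /square_exceeds; have [-> _ _ _] := square_dotE c d w.
have Ef b1 b2 b3 : Pr ([set w | square_exceeds c d h j0 w] `&` cell false b1 b2 b3) = 0.
  rewrite (_ : _ `&` _ = set0) ?Pr0//; apply/seteqP; split=> w //= [+ [x0 _ _ _]].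
  by rewrite /square_exceeds; have [-> _ _ _] := square_dotE c d w; rewrite x0.
rewrite -(square_exceeds_prob cd h j0) (Pr_square_split c d h mE) !big_bool /= !Et !Ef; cells.
lra.
Qed.

Lemma square_total : A + B + 4 * f1 + 4 * f3 + 4 * g = 1.
Proof.
transitivity (Pr setT); last exact: PrT.
rewrite (Pr_square_split c d h measurableT) !big_bool /= !setTI; cells.
lra.
Qed.

(** Reflection about c g = h trades strict exceedance for strict non-exceedance, so the null events
    where a coordinate equals h are removed beforehand. *)
Let Pr_off C i : measurable C -> Pr C <= Pr (C `&` ~` [set w | dot (square c d i) w = h]).
Proof.
move=> mC; have mN := measurable_dot_eq (square c d i) h.
have := Pr_mono gauss3 (measurableI _ _ mC mN) mN (@subIsetr _ _ _).
by rewrite (Pr_dot_eq h (square_unit cd i)) (Pr_split gauss3 mC mN); lra.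
Qed.

Let measurable_off i : measurable (~` [set w : V | dot (square c d i) w = h]).
Proof. by apply: measurableC; exact: measurable_dot_eq. Qed.

Let c_reflect x : c * (2 * (h / c) - x) = 2 * h - c * x.
Proof. by field; rewrite gt_eqF. Qed.

(** Reflection about c g = h replaces X_0 by 2 h - X_1, and likewise within the other diagonal, so
    it turns 0111 into 0100. The first cell lies above the mirror because X_2 and X_3 average to c
    g. *)
Lemma square_f3_le_f1 : f3 <= f1.
Proof.
suff : Pr (cell false true true true) <= Pr (cell false true false false) by cells.
apply: le_trans (Pr_off j0 (mcell _ _ _ _)) _.
apply: (gauss3_reflect_le hc0) => //; first exact: measurableI.
have hh := h0; move=> w [[x0 x1 x2 x3]] /=; have [-> _ _ _] := square_dotE c d w => x0'.
have {x0}x0 : d * w.1.1 + c * w.2 < h.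
  by rewrite lt_neqAle leNgt x0 andbT; apply/eqP.
split; first by rewrite ler_pdivrMr// mulrC; lra.
by rewrite /square_cell /= c_reflect; split; do ?[apply/negbTE; rewrite -leNgt]; lra.
Qed.

Let E : set V := [set w | h < c * w.2].

Let mE : measurable E.
Proof. by apply: measurable_lt_set => //; apply: measurable_funM. Qed.

(* Given z_1 and z_2, such a cell is symmetric about c g = h up to null sets, and
   its upper half has the smaller mass. *)
Let g_half b0 b2 : Pr (E `&` cell b0 (~~ b0) b2 (~~ b2)) <= g / 2.
Proof.
have -> : g = Pr (cell b0 (~~ b0) b2 (~~ b2)) by case: b0 b2 => -[]; cells.
have mC := measurableI _ _ mE (mcell b0 (~~ b0) b2 (~~ b2)).
have mC' : measurable (~` E `&` cell b0 (~~ b0) b2 (~~ b2)).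
  by apply: measurableI => //; exact: measurableC.
suff : Pr (E `&` cell b0 (~~ b0) b2 (~~ b2)) <= Pr (~` E `&` cell b0 (~~ b0) b2 (~~ b2)).
  by have := Pr_split gauss3 (mcell b0 (~~ b0) b2 (~~ b2)) mE; rewrite !(setIC (cell _ _ _ _)); lra.
apply: le_trans (Pr_off j0 mC) _.
apply: le_trans (Pr_off j1 _) _; first exact: measurableI.
apply: le_trans (Pr_off j2 _) _; first by do 2 apply: measurableI => //.
apply: le_trans (Pr_off j3 _) _; first by do 3 apply: measurableI => //.
apply: (gauss3_reflect_le hc0) => //; first by do 4 apply: measurableI => //.
have hh := h0; move=> w [[[[[Ew [x0 x1 x2 x3]] n0] n1] n2] n3].
rewrite /= in n0 n1 n2 n3; have [e0 e1 e2 e3] := square_dotE c d w.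
rewrite e0 in n0; rewrite e1 in n1; rewrite e2 in n2; rewrite e3 in n3.
rewrite /E /= in Ew.
split; first by rewrite ler_pdivrMr// mulrC; lra.
rewrite /E /square_cell /= c_reflect.
have lt x b : (h < x) = b -> x <> h -> (x < h) = ~~ b.
  by move=> <- /eqP xh; rewrite lt_neqAle xh /= leNgt.
have {n0}y0 := lt _ _ x0 n0; have {n1}y1 := lt _ _ x1 n1.
have {n2}y2 := lt _ _ x2 n2; have {n3}y3 := lt _ _ x3 n3.
have r x y : x + y = 2 * h -> (h < x) = (y < h).
  by move=> xy; apply/idP/idP => ?; lra.
split; first by apply/negP; rewrite -leNgt; lra.
split.
- by rewrite (r _ (- d * w.1.1 + c * w.2)) ?y1 ?negbK//; ring.
- by rewrite (r _ (d * w.1.1 + c * w.2)) ?y0//; ring.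
- by rewrite (r _ (- d * w.1.2 + c * w.2)) ?y3 ?negbK//; ring.
- by rewrite (r _ (d * w.1.2 + c * w.2)) ?y2//; ring.
Qed.

(** The left side is the mass of c g > h. There no diagonal lies entirely below h, which leaves
    1111, the four cells with three ones, and, by [g_half], at most half of each of the four mixed
    cells. *)
Lemma square_tail_le : tail (h / c) <= A + 4 * f3 + 2 * g.
Proof.
have -> : tail (h / c) = Pr E.
  rewrite /tail -Pr_last//; congr Pr; apply/seteqP; split=> w /=;
    by rewrite /E /= in_itv/= andbT ltr_pdivrMr// mulrC.
have le b0 b1 b2 b3 : Pr (E `&` cell b0 b1 b2 b3) <= Pr (cell b0 b1 b2 b3).
  exact: Pr_mono (measurableI _ _ mE (mcell _ _ _ _)) (mcell _ _ _ _) (@subIsetr _ _ _).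
have z0 b2 b3 : Pr (E `&` cell false false b2 b3) = 0.
  rewrite (_ : E `&` _ = set0) ?Pr0//; apply/seteqP; split=> w //= [Ew [/negbT x0 /negbT x1 _ _]].
  by move: x0 x1 Ew; rewrite -!leNgt /E /=; lra.
have z2 b0 b1 : Pr (E `&` cell b0 b1 false false) = 0.
  rewrite (_ : E `&` _ = set0) ?Pr0//; apply/seteqP; split=> w //= [Ew [_ _ /negbT x0 /negbT x1]].
  by move: x0 x1 Ew; rewrite -!leNgt /E /=; lra.
have l1 := le true true true true; have l2 := le true true true false.
have l3 := le true true false true; have l4 := le true false true true.
have l5 := le false true true true.
have m1 := g_half true true; have m2 := g_half true false.
have m3 := g_half false true; have m4 := g_half false false.
rewrite /= in m1 m2 m3 m4.
rewrite (Pr_square_split c d h mE) !big_bool /= !z0 !z2.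
move: l3 l4 l5; cells => l3 l4 l5; lra.
Qed.

(** By [square_marginal], [f1 - f3] is [tail h] minus the right side of [square_tail_le], hence at
    most [tail h - tail (h / c)]. The dilation bound then ties it to both small factors at once. *)
Lemma square_f1_sub_f3 : f1 - f3 <= (c^-1 - 1) * (1 / 2 - p).
Proof.
have := square_marginal; have := square_tail_le; have := tail_dilation c_gt0 c1 (ltW h0).
lra.
Qed.

End square_small_color.

Section square_small_bounds.
Context {R : realType}.
Local Notation T := (measurableTypeR R).
Local Notation V := (T * T * T)%type.
Local Notation gauss := (gauss R).
Local Notation gauss3 := (gauss3 R).
Local Notation phi := (@phi R).

(** This and [pair_const] are lower bounds, per unit of [d], for boxes inside the cells 0111 and
    1010. They involve neither [c] nor [d] nor [h], so [d] can be chosen below them. *)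
Definition triple_const : R := Pr gauss `]-3, -2]%classic * Pr gauss `]0, 1]%classic * phi 1.
Definition pair_const : R := Pr gauss `]1, 2]%classic * Pr gauss `]1, 2]%classic * phi 1.

Lemma triple_const_gt0 : 0 < triple_const.
Proof. by rewrite !mulr_gt0 ?phi_gt0 ?gauss_itv_gt0//; lra. Qed.

Lemma pair_const_gt0 : 0 < pair_const.
Proof. by rewrite !mulr_gt0 ?phi_gt0 ?gauss_itv_gt0//; lra. Qed.

Variables c d h : R.
Hypothesis cd : c ^+ 2 + d ^+ 2 = 1.
Hypothesis d0 : 0 < d.
Hypothesis c2 : 1 / 2 <= c.
Hypothesis c1 : c <= 1.
Hypothesis h0 : 0 < h.
Hypothesis hd : h <= d.
Hypothesis d_small : 64 * (64 * d) <= 1.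

Local Notation cell := (square_cell c d h).
Local Notation p := (tail h).
Local Notation A := (Pr gauss3 (cell true true true true)).
Local Notation B := (Pr gauss3 (cell false false false false)).
Local Notation f1 := (Pr gauss3 (cell true false false false)).
Local Notation f3 := (Pr gauss3 (cell true true true false)).
Local Notation g := (Pr gauss3 (cell true false true false)).

Let mcell b0 b1 b2 b3 : measurable (cell b0 b1 b2 b3) := measurable_square_cell c d h b0 b1 b2 b3.

Let c_gt0 : 0 < c. Proof. by apply: lt_le_trans c2; lra. Qed.

(** The length is d / c, at least [d] because c <= 1; since [h] and [d] are tiny, the interval stays
    inside [0, 1]. *)
Let last_itv_ge (k : R) : 0 <= k <= 1 ->
  d * phi 1 <= Pr gauss `](h + k * d) / c, (h + (k + 1) * d) / c]%classic.
Proof.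
move=> /andP[k0 k1]; have := h0; have := hd; have := d_small; have := c2; have := d0; have := c1.
move=> c1' d0' c2' ds hd' h0'.
have kd : k * d <= d by rewrite ler_piMl// ltW.
have kd0 : 0 <= k * d by rewrite mulr_ge0// ltW.
have le : (h + k * d) / c <= (h + (k + 1) * d) / c by rewrite ler_pM2r ?invr_gt0//; lra.
apply: le_trans (gauss_itv_ge (M := 1) le _).
  rewrite -mulrBl (_ : h + (k + 1) * d - (h + k * d) = d); last by ring.
  by rewrite ler_wpM2r ?phi_ge0// ler_pdivlMr// ler_piMr// ltW.
move=> u /andP[u1 u2]; have u0 : 0 <= u.
  by apply: le_trans (ltW u1); rewrite divr_ge0// ?(ltW c_gt0)//; lra.
rewrite ger0_norm//; apply: (le_trans u2); rewrite ler_pdivrMr// mul1r; lra.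
Qed.

Lemma square_f3_ge : triple_const * d <= f3.
Proof.
have -> : f3 = Pr gauss3 (cell false true true true).
  by rewrite (square_patternE c d h false true true true).
have := d0; have := h0 => h0' d0'.
have i1 : 0 <= (1 : R) <= 1 by apply/andP; split; lra.
(* With c g in ]h + d, h + 2 d], z_1 in ]-3, -2] pulls X_0 down to h or below and raises X_1, while
   z_2 in ]0, 1] moves X_2 and X_3 by at most d. *)
apply: le_trans (@box_mass R (-3) (-2) 0 1 ((h + 1 * d) / c) ((h + (1 + 1) * d) / c) _ (mcell _ _ _ _) _).
  rewrite /triple_const -mulrA (mulrC _ d) ler_wpM2l ?last_itv_ge// mulr_ge0 ?Pr_ge0//.
move=> w /andP[x1 x2] /andP[y1 y2] /andP[].
rewrite ltr_pdivrMr// ler_pdivlMr// mul1r (mulrC w.2) => z1 z2.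
have a1 : d * w.1.1 <= d * -2 by rewrite ler_wpM2l// ltW.
have a2 : 0 <= d * w.1.2 by rewrite mulr_ge0// ltW.
have a3 : d * w.1.2 <= d * 1 by rewrite ler_wpM2l// ltW.
by rewrite /square_cell /=; split; do ?[apply/negbTE; rewrite -leNgt]; lra.
Qed.

Lemma square_g_ge : pair_const * d <= g.
Proof.
have := d0; have := h0 => h0' d0'.
have i0 : 0 <= (0 : R) <= 1 by apply/andP; split; lra.
(* With c g in ]h, h + d] and z_1, z_2 in ]1, 2], adding d z_i stays above h and subtracting it
   gives at most h. *)
apply: le_trans (@box_mass R 1 2 1 2 ((h + 0 * d) / c) ((h + (0 + 1) * d) / c) _ (mcell _ _ _ _) _).
  rewrite /pair_const -mulrA (mulrC _ d) ler_wpM2l ?last_itv_ge// mulr_ge0 ?Pr_ge0//.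
move=> w /andP[x1 x2] /andP[y1 y2] /andP[].
rewrite ltr_pdivrMr// ler_pdivlMr// mul0r (mulrC w.2) => z1 z2.
have a1 : d * 1 <= d * w.1.1 by rewrite ler_wpM2l// ltW.
have a2 : d * 1 <= d * w.1.2 by rewrite ler_wpM2l// ltW.
by rewrite /square_cell /=; split; do ?[apply/negbTE; rewrite -leNgt]; lra.
Qed.

(** The event confines c g to a window of half-width d |z_1| about h. The part |z_1| > 10 costs at
    most twice [tail 10], bounded by 1/51; elsewhere g lies in an interval of length O(d). *)
Lemma square_cell_le (C : set V) : measurable C ->
  (forall w, C w -> h - d * `|w.1.1| <= c * w.2 <= h + d * `|w.1.1|) ->
  Pr gauss3 C <= 1 / 51 + 42 * d.
Proof.
move=> mC HC; have := d0; have := h0; have := c2 => c2' h0' d0'.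
(* The interval is half-open, so it is extended by [d] on the left to contain the endpoint; its
   length 20 d / c + d is at most 41 d. *)
pose I : set T := `](h - 10 * d) / c - d, (h + 10 * d) / c]%classic.
pose J : set T := `]10, +oo[%classic; pose K : set T := ~` `]-10, +oo[%classic.
have mI : measurable I by exact: measurable_itv.
have mJ : measurable J by exact: measurable_itv.
have mK : measurable K by apply: measurableC; exact: measurable_itv.
have m1 := measurable_last mI; have m2 := measurable_first mJ; have m3 := measurable_first mK.
have CI : Pr gauss3 C <= Pr gauss3 ([set w | I w.2] `|` ([set w | J w.1.1] `|` [set w | K w.1.1])).
  apply: Pr_mono => //; first by do 2 apply: measurableU => //.
  move=> w /HC /andP[w1 w2]; have [a|a] := leP `|w.1.1| 10.
    left; rewrite /I /= in_itv/=.
    have da : d * `|w.1.1| <= d * 10 by rewrite ler_wpM2l// ltW.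
    apply/andP; split; last by rewrite ler_pdivlMr// mulrC; lra.
    apply: (@lt_le_trans _ _ ((h - 10 * d) / c)); first lra.
    by rewrite ler_pdivrMr// mulrC; lra.
  right; move: a; rewrite ltr_normr =>  /orP[a|a]; [left|right].
    by rewrite /J /= in_itv/= andbT.
  by rewrite /K /= in_itv/= andbT => a'; lra.
apply: (le_trans CI); apply: le_trans (PrU_le _ _ _) _ => //; first exact: measurableU.
have PI : Pr gauss3 [set w | I w.2] <= 42 * d.
  rewrite Pr_last//; apply: le_trans (gauss_itv_le _) _.
    rewrite -subr_ge0 (_ : _ - _ = 20 * d / c + d); last by field; rewrite gt_eqF.
    by rewrite addr_ge0 ?divr_ge0 ?mulr_ge0 ?(ltW c_gt0)//; lra.
  rewrite (_ : _ - _ = 20 * d / c + d); last by field; rewrite gt_eqF.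
  have : 20 * d / c <= 40 * d.
    by rewrite ler_pdivrMr//; have : d * (1 / 2) <= d * c by [rewrite ler_wpM2l// ltW]; lra.
  lra.
have PJ : Pr gauss3 ([set w | J w.1.1] `|` [set w | K w.1.1]) <= tail 10 + tail 10.
  apply: le_trans (PrU_le _ _ _) _ => //.
  rewrite !Pr_first// /K PrC//.
  by rewrite -/(tail 10) -/(tail (-10)) tailN; lra.
have := @tail10_le R; lra.
Qed.

Lemma square_f3_small : f3 <= 1 / 51 + 42 * d.
Proof.
have -> : f3 = Pr gauss3 (cell false true true true).
  by rewrite (square_patternE c d h false true true true).
have := d0 => d0'; apply: square_cell_le => // w [/negbT x0 x1 x2 x3].
move: x0; rewrite -leNgt => x0.
have n1 : d * w.1.1 <= d * `|w.1.1| by rewrite ler_pM2l// ler_norm.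
have n2 : d * - w.1.1 <= d * `|w.1.1| by rewrite ler_pM2l// -normrN ler_norm.
by apply/andP; split; lra.
Qed.

Lemma square_g_small : g <= 1 / 51 + 42 * d.
Proof.
have := d0 => d0'; apply: square_cell_le => // w [x0 /negbT x1 x2 x3].
move: x1; rewrite -leNgt => x1.
have n1 : d * w.1.1 <= d * `|w.1.1| by rewrite ler_pM2l// ler_norm.
have n2 : d * - w.1.1 <= d * `|w.1.1| by rewrite ler_pM2l// -normrN ler_norm.
by apply/andP; split; lra.
Qed.

Hypothesis d_triple : d <= triple_const.
Hypothesis d_pair : d <= pair_const.

(** In the two delicate inequalities of [color_of_square] both sides are bounded by multiples of 1/2
    - p. Without that factor, a multiple of d^2 is compared with [f3] or [g], each at least d^2
    since [d] is below the two box constants. *)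
Lemma square_exceeds_color : color_process gauss3 (square_exceeds c d h).
Proof.
have := d0; have := h0; have := hd; have := d_small => ds hd' h0' d0'.
have pl : p < 1 / 2 by exact: tail_lt_half.
have pg : 1 / 2 - h <= p by apply: tail_ge_half; exact: ltW.
have f30 : 0 <= f3 by exact: Pr_ge0.
have g3 := square_f3_ge; have gg := square_g_ge.
(* From d^2 = (1 - c)(1 + c) and c (1 + c) >= 3/4 for c >= 1/2. *)
have cc : c^-1 - 1 <= 4 / 3 * d ^+ 2.
  rewrite -(ler_pM2l c_gt0) mulrBr mulfV ?gt_eqF// mulr1.
  have : 0 <= (1 - c) * (c - 1 / 2) by apply: mulr_ge0; move: c1 c2; lra.
  have : 0 <= (c - 1 / 2) * d ^+ 2 by apply: mulr_ge0; [move: c2; lra|exact: sqr_ge0].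
  by move: cd; lra.
have k1 : d ^+ 2 <= f3.
  by apply: le_trans g3; rewrite expr2 ler_wpM2r// ltW.
have k2 : d ^+ 2 <= g.
  by apply: le_trans gg; rewrite expr2 ler_wpM2r// ltW.
have sub : f1 - f3 <= 4 / 3 * d ^+ 2 * (1 / 2 - p).
  apply: le_trans (square_f1_sub_f3 cd c2 c1 h0) _.
  by rewrite ler_wpM2r// subr_ge0 ltW.
have d2 : 0 <= d ^+ 2 by exact: sqr_ge0.
have q0 : 0 <= 1 / 2 - p by lra.
apply: (@color_of_square _ _ _ _ _ p A B f1 f3 g) => //.
- by apply/andP; split; lra.
- by move=> b0 b1 b2 b3; rewrite square_cellE PrE// square_patternE.
- exact: square_marginal.
- exact: square_total.
- exact: square_f3_le_f1.
- have s1 : (f1 - f3) * p <= 4 / 3 * d ^+ 2 * (1 / 2 - p) * p by rewrite ler_wpM2r// tail_ge0.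
  have s2 : 4 / 3 * d ^+ 2 * (1 / 2 - p) * p <= 4 / 3 * d ^+ 2 * (1 / 2 - p) * (1 / 2).
    by rewrite ler_wpM2l ?mulr_ge0// ltW.
  have s3 : d ^+ 2 * (1 / 2 - p) <= f3 * (1 / 2 - p) by rewrite ler_wpM2r.
  have s4 : 0 <= f3 * (1 / 2 - p) by rewrite mulr_ge0.
  lra.
- have s3 : d ^+ 2 * (1 / 2 - p) <= g * (1 / 2 - p) by rewrite ler_wpM2r.
  have s4 : 0 <= g * (1 / 2 - p) by rewrite mulr_ge0 ?Pr_ge0.
  lra.
(* Here 4 f3 + 2 g is at most 6 (1/51 + 42 d), below 1/5, whereas p (1 - p) is close to 1/4. *)
- have a1 := square_f3_small; have a2 := square_g_small.
  have : 0 <= (p - (1 / 2 - h)) * (1 / 2 - p) by rewrite mulr_ge0//; lra.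
  have : 64 * (64 * h) * (1 / 2 - p) <= 1 * (1 / 2 - p) by rewrite ler_wpM2r//; lra.
  nra.
Qed.

End square_small_bounds.

(** * The mixed cases and the failure of monotonicity *)

Lemma square_vector_cases (R : realType) : exists X : gaussianVector R,
  [/\ nonneg_correlations X, for_large (fun h => ~ threshold_color X h) &
      for_small (fun h => threshold_color X h)].
Proof.
(* [K] serves both as the width [d] of the square and as the threshold below which [h] must stay;
   the term 1/64/64 is the smallness required by the numerical bounds. *)
pose K := Order.min (1 / 64 / 64) (Order.min (@triple_const R) (@pair_const R)).
have K0 : 0 < K by rewrite !lt_min triple_const_gt0 pair_const_gt0 !andbT; lra.
have [K1 K2 K3] : [/\ K <= 1 / 64 / 64, K <= @triple_const R & K <= @pair_const R].
  by rewrite /K !ge_min !lexx !orbT.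
pose c := Num.sqrt (1 - K ^+ 2).
have KK : K ^+ 2 <= 1 / 4.
  have : K * K <= (1 / 2) * (1 / 2) by apply: ler_pM; lra.
  by rewrite expr2; lra.
have cK : c ^+ 2 + K ^+ 2 = 1 by rewrite /c sqr_sqrtr; lra.
have c0 : 0 <= c by exact: sqrtr_ge0.
have c2 : 1 / 2 <= c by rewrite leNgt; apply/negP => cl; nra.
have c1 : c <= 1 by rewrite leNgt; apply/negP => cl; nra.
have Kc : K < c by lra.
exists (square_vector cK K0); split.
- exact: square_nonneg.
- exact: square_not_color_large.
exists K => // h /andP[h0 hK]; apply: square_exceeds_color => //; [exact: ltW|lra].
Qed.

Lemma acute_fan_cases (R : realType) : exists X : gaussianVector R,
  [/\ nonneg_correlations X, for_large (fun h => threshold_color X h) &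
      for_small (fun h => ~ threshold_color X h)].
Proof.
have bc : 3 / 5 < 4 / 5 :> R by lra.
have c'0 : 0 < 35 / 37 :> R by lra.
have cc' : 4 / 5 * (35 / 37) < 1 :> R by lra.
exists (fan_vector fan_cb fan_cb' fan_b0); split.
- exact: fan_nonneg.
- by apply: fan_color_large => //; exact: acute_fan_cells.
have q0 : 0 < phi 0 ^+ 2 :> R by apply: exprn_gt0; exact: phi_gt0.
exists (phi 0 ^+ 2 / 20 / 20); first by lra.
by move=> h /andP[h0 hq]; apply: acute_fan_not_color => //; lra.
Qed.

Theorem corollary6p6 (R : realType) :
  (exists X : gaussianVector R,
    [/\ nonneg_correlations X,
        for_large (fun h => threshold_color X h) &
        for_small (fun h => threshold_color X h)]) /\
  (exists X : gaussianVector R,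
    [/\ nonneg_correlations X,
        for_large (fun h => ~ threshold_color X h) &
        for_small (fun h => ~ threshold_color X h)]) /\
  (exists X : gaussianVector R,
    [/\ nonneg_correlations X,
        for_large (fun h => threshold_color X h) &
        for_small (fun h => ~ threshold_color X h)]) /\
  (exists X : gaussianVector R,
    [/\ nonneg_correlations X,
        for_large (fun h => ~ threshold_color X h) &
        for_small (fun h => threshold_color X h)]) /\
  (exists X : gaussianVector R,
    nonneg_correlations X /\
    ~ (forall h1 h2 : R, 0 < h1 -> h1 <= h2 ->
         threshold_color X h1 -> threshold_color X h2)) /\
  (exists X : gaussianVector R,
    nonneg_correlations X /\
    ~ (forall h1 h2 : R, 0 < h1 -> h1 <= h2 ->
         threshold_color X h2 -> threshold_color X h1)).
Proof.
have [X [X0 Xlarge Xsmall]] := acute_fan_cases R.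
have [Y [Y0 Ylarge Ysmall]] := square_vector_cases R.
have [Z [Z0 Zn]] := @coplanar_vector_never_color R.
split.
  exists (single_vector (R := R)); split; first exact: single_nonneg.
  - by exists 1 => // h _; exact: single_color.
  - by exists 1 => // h _; exact: single_color.
split.
  exists Z; split=> //.
  - by exists 1 => // h h1; apply: Zn; exact: lt_trans h1.
  - by exists 1 => // h /andP[h0 _]; exact: Zn.
split; first by exists X.
split; first by exists Y.
split.
  (* The thresholds [b / 2] and [a + b] lie in the small and the large regime and are ordered; the
     square refutes one direction, the acute fan the other. *)
  exists Y; split=> // mono.
  case: Ylarge Ysmall => a a0 la [b b0 sb].
  have b2 : 0 < b / 2 < b by apply/andP; split; lra.
  have [b20 _] := andP b2.
  apply: (la (a + b)); first lra.
  by apply: (mono (b / 2)) => //; [lra|exact: sb].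
exists X; split=> // mono.
case: Xlarge Xsmall => a a0 la [b b0 sb].
have b2 : 0 < b / 2 < b by apply/andP; split; lra.
have [b20 _] := andP b2.
apply: (sb (b / 2)) => //; apply: (mono _ (a + b)) => //; first lra.
by apply: la; lra.
Qed.
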